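(* Let $s>1/2$. If $u_0\in G^{1,s+1}$, then there exists a positive time $T=T(u_0,s)$ such that for every $\delta\in\,]0,1[$, the Cauchy problem $$u_t+uu_x+\partial_xA^{-1}\Big[2\mu(u)u+\tfrac12u_x^2\Big]=0,\qquad u(0,x)=u_0(x),$$ has a unique solution which is a holomorphic function valued in $G^{\delta,s+1}$ in the disk $D(0,T(1-\delta))$. Furthermore, the analytic lifespan $T$ satisfies, for $u_0\neq0$, $$T=\frac{\mathrm{const.}}{\|u_0\|_{1,s+1}},$$ where $\mathrm{const.}$ is a positive constant which does not depend on $u_0$ (it may depend on $s$).
   Context: $S^1=\mathbb R/\mathbb Z$; $L^2(S^1)$ denotes real-valued square-integrable functions; $\hat\varphi(k)=\int_{S^1}\varphi(x)e^{-2k\pi ix}\,dx$; $\langle k\rangle=(1+k^2)^{1/2}$. For $\delta\ge0,s\ge0$, $G^{\delta,s}=\{\varphi\in L^2(S^1):\|\varphi\|_{\delta,s}<\infty\}$ with $\|\varphi\|_{\delta,s}^2=\sum_{k\in\mathbb Z}\langle k\rangle^{2s}e^{4\pi\delta|k|}|\hat\varphi(k)|^2$. $\mu(\varphi)=\int_{S^1}\varphi\,dx$ (integration in $x$), $A(\varphi)=\mu(\varphi)-\varphi_{xx}$, whose inverse is $A^{-1}(\varphi)=\hat\varphi(0)+\sum_{k\ne0}\frac{\hat\varphi(k)}{(2\pi k)^2}e^{2k\pi ix}$. $D(0,r)=\{t\in\mathbb C:|t|<r\}$. For complex $t$ the values of a holomorphic function of $t$ are taken in the complexification of $G^{\delta,s+1}$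 (complex-valued functions, same norm), with $\mu$, $A^{-1}$, $\partial_x$ and products extended by the same formulas. *)

(* Defs.v *)
From mathcomp Require Import all_boot all_order all_algebra.
From mathcomp Require Import all_classical all_reals all_analysis.
From mathcomp Require Import complex.
Set Implicit Arguments.
Unset Strict Implicit.
Unset Printing Implicit Defensive.
Import Order.TTheory GRing.Theory Num.Theory.
Import numFieldNormedType.Exports.
Import ComplexField.Normc.
Local Open Scope classical_set_scope.
Local Open Scope ring_scope.
Local Open Scope complex_scope.

(** A function on the circle R/Z is a 1-periodic function on the real line.
    Elements of L^2(R/Z) are given by such functions, two of them being
    identified when they agree almost everywhere ([eqae]); consequently the
    differential equation, the initial condition and the uniqueness of the
    solution are stated up to [eqae].  All spaces are the complexified ones; a
    real-valued function enters through [toC]. *)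

Section Circle.
Variable R : realType.
Implicit Types (f g : R -> R[i]) (k : int) (d s r : R).

Definition toC (f : R -> R) : R -> R[i] := fun x => (f x)%:C.

Definition eqae f g : Prop := {ae lebesgue_measure, forall x : R, f x = g x}.

Definition L2circle f : Prop :=
  [/\ periodic f 1,
      measurable_fun [set: R] (fun x => complex.Re (f x)),
      measurable_fun [set: R] (fun x => complex.Im (f x)) &
      (\int[lebesgue_measure]_(x in `[0%R, 1%R]) ((normc (f x)) ^+ 2)%:E
         < +oo)%E].

Definition mean f : R[i] :=
  (\int[lebesgue_measure]_(x in `[0, 1]) complex.Re (f x)) +i*
  (\int[lebesgue_measure]_(x in `[0, 1]) complex.Im (f x)).

(* x |-> exp (2 i pi k x) *)
Definition expmode k : R -> R[i] := fun x =>
  cos (2 * pi * k%:~R * x) +i* sin (2 * pi * k%:~R * x).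

Definition fourier f k : R[i] := mean (fun x => f x * expmode (- k) x).

Definition bracket k : R := Num.sqrt (1 + k%:~R ^+ 2).

Definition gevrey_norm d s f : \bar R :=
  ((\esum_(k in [set: int])
      (bracket k `^ (2 * s) * expR (4 * pi * d * `|k%:~R|)
       * (normc (fourier f k)) ^+ 2)%:E) `^ 2^-1)%E.

Definition gevrey d s f : Prop := L2circle f /\ (gevrey_norm d s f < +oo)%E.

(* The series over k != 0 is summed symmetrically; for f in L^2 it converges
   absolutely at every x. *)
Definition Ainv f : R -> R[i] := fun x =>
  fourier f 0 +
  limn (fun n => \sum_(1 <= k < n.+1)
    (fourier f k%:Z / ((2 * pi * k%:R) ^+ 2)%:C * expmode k%:Z x +
     fourier f (- k%:Z) / ((2 * pi * k%:R) ^+ 2)%:C * expmode (- k%:Z) x)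
    : R[i]^o).

(* g is the x-derivative of the class of f: the class has a continuously
   differentiable representative w, necessarily unique, and g = w'.  For d > 0
   every element of G^{d,s} has an analytic representative. *)
Definition is_dx f g : Prop :=
  exists w : R -> R[i],
    [/\ eqae f w,
        forall x : R, is_derive x 1 (fun y => complex.Re (w y)) (complex.Re (g x)),
        forall x : R, is_derive x 1 (fun y => complex.Im (w y)) (complex.Im (g x)),
        continuous (fun x => complex.Re (g x)) &
        continuous (fun x => complex.Im (g x))].

Definition disk r : set R[i] := [set t | normc t < r].

(* v is the complex derivative at t, in the norm of G^{d,s}, of the curve u. *)
Definition is_Gderive d s (u : R[i] -> R -> R[i]) (t : R[i]) (v : R -> R[i])
    : Prop :=
  gevrey d s v /\
  (gevrey_norm d s (fun x => h^-1 * (u (t + h) x - u t x) - v x)%R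
     @[h --> (0 : R[i]^o)^'] --> 0%E).

Definition Gholomorphic d s r (u : R[i] -> R -> R[i]) : Prop :=
  (forall t, disk r t -> gevrey d s (u t)) /\
  (forall t, disk r t -> exists v, is_Gderive d s u t v).

(* ut + u u_x + d/dx A^{-1} [2 mu(u) u + u_x^2 / 2] = 0 at a fixed time, ut
   standing for the time derivative. *)
Definition equation_at (u ut : R -> R[i]) : Prop :=
  exists ux w : R -> R[i],
    [/\ is_dx u ux,
        is_dx (Ainv (fun x => 2 * mean u * u x + 2^-1 * ux x ^+ 2)) w &
        eqae (fun x => ut x + u x * ux x + w x) (fun=> 0)].

Definition Gsolution d s r (u0 : R -> R) (u : R[i] -> R -> R[i]) : Prop :=
  [/\ Gholomorphic d s r u,
      eqae (u 0) (toC u0) &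
      forall t, disk r t ->
        exists2 ut, is_Gderive d s u t ut & equation_at (u t) ut].

End Circle.

(* Main.v *)
Require Import Defs.
From mathcomp Require Import all_boot all_order all_algebra.
From mathcomp Require Import all_classical all_reals all_analysis.
From mathcomp Require Import complex.
From mathcomp Require Import finmap measurable_realfun ring lra zify.

(** The equation is read on Fourier coefficients, in a scale of weighted l^1
    spaces, where it is an ordinary differential equation
    [a' = Bil a a] whose right-hand side loses one derivative.

    The norm [nrm d a], the sum of [(1 + |k|) exp (2 pi d |k|) |a_k|], grows
    with the width [d]; since [2 pi |k| <= e^-1 exp (2 pi e |k|)], a derivative
    costs a factor [1 / e] and a loss [e] of width.  The nonlinearity
    [u u_x + (d/dx) A^{-1} (2 mu(u) u + u_x^2 / 2)] loses only one derivative: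
    [(d/dx) A^{-1}] has order -1, and the two derivatives of [u_x^2] are carried
    by different factors, whose weights [1 + |k|] pay for them.  Hence
    [nrm d (Bil a b) <= (9 / e) nrm (d + e) a * nrm (d + e) b] ([Bil_bound]).

    Existence.  The Taylor coefficients [pc n] of the solution in the time
    variable satisfy a quadratic recursion, and the Cauchy-Kovalevsky argument
    gives [nrm d (pc n) <= N (Kps N / (1 - d))^n / (n + 1)^2], where [N] bounds
    [nrm 1] of the initial coefficients ([pc_bound]).  The series [sol]
    therefore converges for [|t| Kps N < 1 - d]; summing Taylor remainders it is
    differentiable ([sol_derivative]), and the Cauchy product turns the
    recursion into the equation ([sol_equation]).

    Comparison of norms.  For [s > 1/2] the Cauchy-Schwarz inequality bounds
    [nrm 1] of the data by [K] times the norm in G^{1,s+1} ([nrm_le_gsum]);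
    therefore [T = 1 / (Kps K ||u_0||)] is a lifespan, which is the announced
    form.  In the other direction the norm in G^{d,s+1} is bounded by [nrm e] for
    every [e > d] ([gsum_le_nrm]); as the disk is open, such a width is still
    available at each of its points, so that convergence in [nrm e] yields
    holomorphy in G^{d,s+1}.

    Uniqueness.  Along a ray the difference of two solutions satisfies a linear
    equation with the same loss of width.  Iterating the mean value inequality
    [n] times and spending the width in [n] equal steps bounds the difference by
    [(A x / d)^n], which tends to 0 for short times; a continuation argument
    reaches the whole ray ([ray_zero]).

    Return to functions.  Functions on the circle are identified almost
    everywhere, and [fourier_inj] says that a periodic integrable function is
    determined up to that by its coefficients.  Its proof multiplies a function
    without coefficients by polynomials in a trigonometric polynomial that
    converge boundedly to the indicator of an arc: all integrals over arcs
    vanish, and so does the function by Lebesgue differentiation.  On series with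
    exponentially decreasing coefficients, derivatives, products and [Ainv] act
    on coefficients as expected, whence the dictionary [equation_synth],
    [equation_coef] between the two forms of the equation. *)

Set Implicit Arguments.
Unset Strict Implicit.
Unset Printing Implicit Defensive.
Import Order.TTheory GRing.Theory Num.Theory.
Import numFieldNormedType.Exports.
Import ComplexField.Normc.
Local Open Scope classical_set_scope.
Local Open Scope ring_scope.
Local Open Scope complex_scope.
Local Notation Re := complex.Re.
Local Notation Im := complex.Im.

(** * Unordered sums of nonnegative families *)
Section NonnegSums.
Context {R : realType}.

(** Summation without an order on the indices: rearrangement and Fubini for
    nonnegative families then hold without any hypothesis of convergence. *)
Definition esumr (T : choiceType) (f : T -> R) : \bar R :=
  (\esum_(k in [set: T]) (f k)%:E)%E.

Definition summ (T : choiceType) (f : T -> R) : bool := (esumr f < +oo)%E.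

Lemma esumr_ge0 (T : choiceType) (f : T -> R) :
  (forall k, 0 <= f k) -> (0 <= esumr f)%E.
Proof. by move=> f0; apply: esum_ge0 => k _; rewrite lee_fin. Qed.

Lemma le_esumr (T : choiceType) (f g : T -> R) :
  (forall k, f k <= g k) -> (esumr f <= esumr g)%E.
Proof. by move=> fg; apply: le_esum => k _; rewrite lee_fin. Qed.

Lemma eq_esumr (T : choiceType) (f g : T -> R) :
  (forall k, f k = g k) -> esumr f = esumr g.
Proof. by move=> fg; congr esumr; apply/funext. Qed.

Lemma esumrD (T : choiceType) (f g : T -> R) :
  (forall k, 0 <= f k) -> (forall k, 0 <= g k) ->
  esumr (fun k => f k + g k) = (esumr f + esumr g)%E.
Proof.
move=> f0 g0; rewrite /esumr -esumD//; last by move=> k _; rewrite lee_fin.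
by move=> k _; rewrite lee_fin.
Qed.

Lemma esumr_seq (T : choiceType) (f : T -> R) (s : seq T) :
  (forall k, 0 <= f k) -> uniq s -> ((\sum_(k <- s) f k)%:E <= esumr f)%E.
Proof.
move=> f0 us; apply: esum_ge; exists [set` s].
  by split => //; exact: finite_seq.
by rewrite -fsbig_seq// sumEFin.
Qed.

Lemma esumr_le (T : choiceType) (f : T -> R) (M : \bar R) :
  (forall s : seq T, uniq s -> ((\sum_(k <- s) f k)%:E <= M)%E) ->
  (esumr f <= M)%E.
Proof.
move=> h; apply: ge_ereal_sup => _ [X [finX _] <-].
by rewrite fsbig_finite//= sumEFin; apply: h; exact: fset_uniq.
Qed.

Lemma esumr_term (T : choiceType) (f : T -> R) (k : T) :
  (forall k, 0 <= f k) -> ((f k)%:E <= esumr f)%E.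
Proof. by move=> f0; have := @esumr_seq T f [:: k] f0 isT; rewrite big_seq1. Qed.

Lemma esum_term (T : choiceType) (F : T -> \bar R) (t : T) :
  (forall t, (0 <= F t)%E) -> (F t <= \esum_(k in [set: T]) F k)%E.
Proof.
move=> F0; rewrite -(@esum_set1 R T t F)// esum_mkcond.
by apply: le_esum => u _; case: ifP.
Qed.

Lemma esumrZ (T : choiceType) (c : R) (f : T -> R) :
  0 <= c -> (forall k, 0 <= f k) ->
  esumr (fun k => c * f k) = (c%:E * esumr f)%E.
Proof.
have le_ (d : R) (g : T -> R) : 0 <= d -> (forall k, 0 <= g k) ->
    (esumr (fun k => d * g k)%R <= d%:E * esumr g)%E.
  move=> d0 g0; apply: esumr_le => s us; rewrite -mulr_sumr EFinM.
  by apply: lee_pmul => //; rewrite ?lee_fin ?sumr_ge0//; exact: esumr_seq.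
move=> c0 f0; apply/eqP; rewrite eq_le le_//=.
have [->|cn0] := eqVneq c 0.
  by rewrite mul0e esumr_ge0// => k; rewrite mul0r.
have cgt0 : 0 < c by rewrite lt_def cn0.
have : (c%:E * esumr f <= c%:E * (c^-1%:E * esumr (fun k => c * f k)%R))%E.
  apply: lee_pmul => //; rewrite ?lee_fin ?esumr_ge0//.
  rewrite [X in (X <= _)%E](@eq_esumr _ _ (fun k => c^-1 * (c * f k))); last first.
    by move=> k; rewrite mulKf.
  by apply: le_; rewrite ?invr_ge0// => k; rewrite mulr_ge0.
by rewrite muleA -EFinM divff// mul1e.
Qed.

Lemma esum_swap (T U : choiceType) (f : T -> U -> \bar R) :
  (forall t u, (0 <= f t u)%E) ->
  (\esum_(t in [set: T]) \esum_(u in [set: U]) f t u =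
   \esum_(u in [set: U]) \esum_(t in [set: T]) f t u)%E.
Proof.
move=> f0; rewrite !esum_esum//.
rewrite (reindex_esum ([set: U] `*`` fun=> [set: T]) _ (fun x => (x.2, x.1)))//.
split => //=.
- by move=> [i1 i2] [j1 j2] /= _ _ [] -> ->.
- by move=> [i1 i2] _ /=; exists (i2, i1).
Qed.

Lemma esumr_pair (T U : choiceType) (f : T -> U -> R) :
  (forall t u, 0 <= f t u) ->
  esumr (fun p : T * U => f p.1 p.2) =
  (\esum_(t in [set: T]) esumr (f t))%E.
Proof.
move=> f0; rewrite /esumr esum_esum; last by move=> *; rewrite lee_fin.
apply: congr2 => //; apply/seteqP; split => //.
Qed.

Lemma esumr_prod (T U : choiceType) (f : T -> R) (g : U -> R) :
  (forall t, 0 <= f t) -> (forall t, 0 <= g t) -> summ g ->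
  esumr (fun p : T * U => f p.1 * g p.2) = (esumr f * esumr g)%E.
Proof.
move=> f0 g0 gfin; rewrite (@esumr_pair T U (fun t u => f t * g u)); last first.
  by move=> *; rewrite mulr_ge0.
under eq_esum => t _ do rewrite esumrZ//.
have gf : esumr g \is a fin_num by rewrite ge0_fin_numE// esumr_ge0.
rewrite -(fineK gf) muleC -esumrZ//; last by rewrite fine_ge0// esumr_ge0.
by apply: eq_esum => t _; rewrite -EFinM mulrC.
Qed.

Lemma esumr_reindex (T U : choiceType) (e : T -> U) (e' : U -> T) (f : U -> R) :
  cancel e e' -> cancel e' e -> esumr (fun t => f (e t)) = esumr f.
Proof.
move=> ee' e'e; rewrite /esumr.
rewrite (@reindex_esum R T U [set: T] [set: U] e)//.
split => // [x y _ _ /(congr1 e')|y _]; first by rewrite !ee'.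
by exists (e' y).
Qed.

(** Replaces an infinite sum by a finite one up to [eps]; it is used on the
    coefficients of Fourier series, for their partial sums. *)
Lemma esumr_tail (T : choiceType) (f : T -> R) (eps : R) :
  (forall k, 0 <= f k) -> summ f -> 0 < eps ->
  exists s : seq T, uniq s /\
    (esumr (fun k => if k \in s then 0%R else f k) <= eps%:E)%E.
Proof.
move=> f0 ffin eps0.
have fn : esumr f \is a fin_num by rewrite ge0_fin_numE// esumr_ge0.
have [_ [X [finX _] <-] hX] := ub_ereal_sup_adherent eps0 fn.
pose s := fset_set X : seq T; have us : uniq s by exact: fset_uniq.
exists s; split => //.
have e : esumr f = (esumr (fun k => if k \in s then f k else 0%R) +
     esumr (fun k => if k \in s then 0%R else f k))%E.
  rewrite -esumrD.
  - by apply: eq_esumr => k; case: ifP; rewrite ?addr0 ?add0r.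
  - by move=> k; case: ifP.
  - by move=> k; case: ifP.
move: hX; rewrite fsbig_finite//= sumEFin -/s -[ereal_sup _]/(esumr f) e => hX.
have le1 : ((\sum_(k <- s) f k)%:E <= esumr (fun k => if k \in s then f k else 0%R))%E.
  rewrite (eq_big_seq (fun k => if k \in s then f k else 0)).
    by apply: esumr_seq => // k; case: ifP.
  by move=> k ->.
have le2 : (esumr (fun k => if k \in s then f k else 0%R) <= (\sum_(k <- s) f k)%:E)%E.
  apply: esumr_le => s' us'; rewrite lee_fin -big_mkcond/=.
  rewrite [leRHS](bigID (mem s'))/= -big_filter -[X in _ <= X + _]big_filter.
  rewrite (perm_big [seq x <- s | x \in s']); first by rewrite lerDl sumr_ge0.
  apply: uniq_perm; rewrite ?filter_uniq// => x.
  by rewrite !mem_filter andbC.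
have eq1 : esumr (fun k => if k \in s then f k else 0%R) = (\sum_(k <- s) f k)%:E.
  by apply/eqP; rewrite eq_le le1 le2.
move: hX; rewrite eq1; case: (esumr _) => [t||]//.
  by rewrite -!EFinD lte_fin !lee_fin => h; lra.
by rewrite leNye.
Qed.

End NonnegSums.

(** * The modulus of complex numbers *)
Section ComplexModulus.
Context {R : realType}.
Implicit Types z w : R[i].

Lemma normc_ge0 z : 0 <= normc z.
Proof. by case: z => a b; rewrite sqrtr_ge0. Qed.

Lemma RecM z w : Re (z * w) = Re z * Re w - Im z * Im w.
Proof. by case: z; case: w. Qed.

Lemma ImcM z w : Im (z * w) = Re z * Im w + Im z * Re w.
Proof. by case: z => a b; case: w => c d /=; rewrite addrC. Qed.

Lemma RecD z w : Re (z + w) = Re z + Re w. Proof. by case: z; case: w. Qed.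
Lemma ImcD z w : Im (z + w) = Im z + Im w. Proof. by case: z; case: w. Qed.
Lemma RecN z : Re (- z) = - Re z. Proof. by case: z. Qed.
Lemma ImcN z : Im (- z) = - Im z. Proof. by case: z. Qed.

Lemma RecB z w : Re (z - w) = Re z - Re w. Proof. by rewrite RecD RecN. Qed.
Lemma ImcB z w : Im (z - w) = Im z - Im w. Proof. by rewrite ImcD ImcN. Qed.

Lemma RecZ (x : R) z : Re (x%:C * z) = x * Re z.
Proof. by rewrite RecM mul0r subr0. Qed.

Lemma ImcZ (x : R) z : Im (x%:C * z) = x * Im z.
Proof. by rewrite ImcM mul0r addr0. Qed.

Lemma complex_eqP z w : Re z = Re w -> Im z = Im w -> z = w.
Proof. by case: z; case: w => c d a b /= -> ->. Qed.

Lemma normc_Re z : `|Re z| <= normc z.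
Proof.
by case: z => a b /=; rewrite -sqrtr_sqr ler_sqrt ?lerDl ?addr_ge0 ?sqr_ge0.
Qed.

Lemma normc_Im z : `|Im z| <= normc z.
Proof.
by case: z => a b /=; rewrite -sqrtr_sqr ler_sqrt ?lerDr ?addr_ge0 ?sqr_ge0.
Qed.

Lemma normc_sqr z : normc z ^+ 2 = Re z ^+ 2 + Im z ^+ 2.
Proof. by case: z => a b /=; rewrite sqr_sqrtr// addr_ge0 ?sqr_ge0. Qed.

Lemma normc_ReIm z : normc z <= `|Re z| + `|Im z|.
Proof.
rewrite -(@ler_pXn2r _ 2)// ?nnegrE ?normc_ge0 ?addr_ge0//.
rewrite normc_sqr sqrrD !real_normK ?num_real//.
by rewrite addrAC lerDl mulrn_wge0// mulr_ge0.
Qed.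

Lemma normcR (x : R) : normc x%:C = `|x|.
Proof. by rewrite /= expr0n addr0 sqrtr_sqr. Qed.

Lemma normc_conj z : normc z^* = normc z.
Proof. by case: z => a b /=; rewrite sqrrN. Qed.

Lemma normc_natr (n : nat) : normc (n%:R : R[i]) = n%:R.
Proof. by rewrite -(rmorph_nat (real_complex R)) normcR ger0_norm. Qed.

Lemma normcX z n : normc (z ^+ n) = normc z ^+ n.
Proof. by elim: n => [|n IH]; rewrite ?normc1// !exprS normcM IH. Qed.

Lemma ler_normcD z w : normc (z + w) <= normc z + normc w.
Proof. exact: le_normcD. Qed.

Lemma normcB z w : normc (z - w) = normc (w - z).
Proof. by rewrite -opprB normcN. Qed.

Lemma ler_normcB z w : normc (z - w) <= normc z + normc w.
Proof. by rewrite -(normcN w) ler_normcD. Qed.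

Lemma Rec_sum (I : Type) (s : seq I) (P : pred I) (F : I -> R[i]) :
  Re (\sum_(i <- s | P i) F i) = \sum_(i <- s | P i) Re (F i).
Proof. by elim/big_rec2: _ => // i x y _ <-; rewrite RecD. Qed.

Lemma normc_gt0 z : z != 0 -> 0 < normc z.
Proof.
rewrite lt_def normc_ge0 andbT; apply: contra => /eqP h.
by rewrite (eq0_normc h).
Qed.

(** By duality, this reduces estimates of complex quantities to estimates of
    real parts. *)
Lemma normc_rotate z : exists2 th : R[i], normc th = 1 & Re (th * z) = normc z.
Proof.
have [->|z0] := eqVneq z 0.
  by exists 1; rewrite ?normc1// mulr0 normc0.
have n0 := normc_gt0 z0.
exists (z^* * (normc z)^-1%:C).
  by rewrite normcM normc_conj normcR ger0_norm ?invr_ge0 ?normc_ge0// divff ?gt_eqF.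
rewrite mulrAC RecM/= mulr0 subr0.
have -> : Re (z^* * z) = normc z ^+ 2.
  by rewrite normc_sqr; case: z {z0 n0} => a b /=; ring.
by rewrite expr2 mulfK ?gt_eqF.
Qed.

End ComplexModulus.

(** * Unordered sums of real families *)
Section SignedSums.
Context {R : realType}.

Definition rsum (T : choiceType) (f : T -> R) : R :=
  fine (esumr (fun k => Num.max (f k) 0)) -
  fine (esumr (fun k => Num.max (- f k) 0)).

Lemma esumr_fin (T : choiceType) (f : T -> R) : (forall k, 0 <= f k) ->
  summ f -> esumr f \is a fin_num.
Proof. by move=> f0 h; rewrite ge0_fin_numE// esumr_ge0. Qed.

(** If [p - q] is the difference of the positive and negative parts [f] and
    [g], then [f + q = g + p], so that every decomposition into summable
    nonnegative families computes the sum. The algebraic rules and Fubini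
    for signed families follow from those for nonnegative ones through this. *)
Lemma rsumE (T : choiceType) (p q : T -> R) :
  (forall k, 0 <= p k) -> (forall k, 0 <= q k) ->
  summ p -> summ q ->
  rsum (fun k => p k - q k) = fine (esumr p) - fine (esumr q).
Proof.
move=> p0 q0 pf qf; rewrite /rsum.
set f := fun k => Num.max (p k - q k) 0.
set g := fun k => Num.max (- (p k - q k)) 0.
have f0 k : 0 <= f k by rewrite /f le_max lexx orbT.
have g0 k : 0 <= g k by rewrite /g le_max lexx orbT.
have ff : summ f.
  apply: le_lt_trans pf; apply: le_esumr => k.
  by rewrite /f ge_max lerBlDr lerDl q0 p0.
have gf : summ g.
  apply: le_lt_trans qf; apply: le_esumr => k.
  by rewrite /g ge_max opprB lerBlDr lerDl q0 p0.
have e : (esumr f + esumr q = esumr g + esumr p)%E.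
  rewrite -!esumrD//; apply: eq_esumr => k; rewrite /f /g.
  by case: (leP (p k - q k) 0) => h; case: (leP (- (p k - q k)) 0) => h'; lra.
move/(congr1 fine): e; rewrite !fineD ?esumr_fin// => e; lra.
Qed.

Lemma rsum_posneg (T : choiceType) (f : T -> R) :
  summ (fun k => `|f k|) ->
  exists p q : T -> R, [/\ forall k, f k = p k - q k,
    forall k, 0 <= p k <= `|f k|, forall k, 0 <= q k <= `|f k| &
    summ p /\ summ q].
Proof.
move=> ff.
have hp k : 0 <= Num.max (f k) 0 <= `|f k|.
  by rewrite le_max lexx orbT/= ge_max normr_ge0 ler_norm.
have hq k : 0 <= Num.max (- f k) 0 <= `|f k|.
  by rewrite le_max lexx orbT/= ge_max normr_ge0 -normrN ler_norm.
exists (fun k => Num.max (f k) 0), (fun k => Num.max (- f k) 0); split => //.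
  move=> k; case: (leP (f k) 0) => h; case: (leP (- f k) 0) => h'; lra.
split; apply: le_lt_trans ff; apply: le_esumr => k.
  by case/andP: (hp k).
by case/andP: (hq k).
Qed.

Lemma eq_rsum (T : choiceType) (f g : T -> R) :
  (forall k, f k = g k) -> rsum f = rsum g.
Proof. by move=> fg; congr rsum; apply/funext. Qed.

Lemma rsum_le (T : choiceType) (f : T -> R) (M : R) :
  (esumr (fun k => `|f k|%R) <= M%:E)%E -> rsum f <= M.
Proof.
move=> ff; have fo : summ (fun k => `|f k|).
  by rewrite /summ (le_lt_trans ff)// ltry.
rewrite /rsum (@le_trans _ _ (fine (esumr (fun k => Num.max (f k) 0))))//.
  rewrite lerBlDr lerDl fine_ge0// esumr_ge0// => k.
  by rewrite le_max lexx orbT.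
rewrite -lee_fin fineK; last first.
  apply: esumr_fin => [k|]; first by rewrite le_max lexx orbT.
  apply: le_lt_trans fo; apply: le_esumr => k.
  by rewrite ge_max normr_ge0 ler_norm.
apply: le_trans ff; apply: le_esumr => k.
by rewrite ge_max normr_ge0 ler_norm.
Qed.

Lemma rsumD (T : choiceType) (f g : T -> R) :
  summ (fun k => `|f k|) -> summ (fun k => `|g k|) ->
  rsum (fun k => f k + g k) = rsum f + rsum g.
Proof.
move=> /rsum_posneg[p [q [fE p0 q0 [pf qf]]]].
move=> /rsum_posneg[r [s [gE r0 s0 [rf sf]]]].
have P0 k : 0 <= p k by case/andP: (p0 k).
have Q0 k : 0 <= q k by case/andP: (q0 k).
have R0 k : 0 <= r k by case/andP: (r0 k).
have S0 k : 0 <= s k by case/andP: (s0 k).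
rewrite (eq_rsum fE) (eq_rsum gE) !rsumE//.
have -> : rsum (fun k => f k + g k) = rsum (fun k => (p k + r k) - (q k + s k)).
  by apply: eq_rsum => k; rewrite fE gE; ring.
rewrite rsumE.
- by rewrite !esumrD// !fineD ?esumr_fin//; ring.
- by move=> k; rewrite addr_ge0.
- by move=> k; rewrite addr_ge0.
- by rewrite /summ esumrD// lte_add_pinfty.
- by rewrite /summ esumrD// lte_add_pinfty.
Qed.

Lemma rsumN (T : choiceType) (f : T -> R) : rsum (fun k => - f k) = - rsum f.
Proof.
by rewrite /rsum opprB; under [X in _ - fine X = _]eq_esumr do rewrite opprK.
Qed.

Lemma rsumZ (T : choiceType) (c : R) (f : T -> R) :
  summ (fun k => `|f k|) -> rsum (fun k => c * f k) = c * rsum f.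
Proof.
wlog c0 : c / 0 <= c => [H ff|].
  have [/H|/ltW c0] := leP 0 c; first exact.
  rewrite -[c]opprK [RHS]mulNr -H// ?oppr_ge0// -rsumN.
  by apply: eq_rsum => k; rewrite mulNr.
move=> /rsum_posneg[p [q [fE p0 q0 [pf qf]]]].
have P0 k : 0 <= p k by case/andP: (p0 k).
have Q0 k : 0 <= q k by case/andP: (q0 k).
rewrite (eq_rsum fE) rsumE//.
have -> : rsum (fun k => c * f k) = rsum (fun k => c * p k - c * q k).
  by apply: eq_rsum => k; rewrite fE; ring.
rewrite rsumE.
- by rewrite !esumrZ// !fineM ?esumr_fin//= -mulrBr.
- by move=> k; rewrite mulr_ge0.
- by move=> k; rewrite mulr_ge0.
- by rewrite /summ esumrZ// lte_mul_pinfty ?lee_fin.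
- by rewrite /summ esumrZ// lte_mul_pinfty ?lee_fin.
Qed.

Lemma esumr_row (T U : choiceType) (p : T -> U -> R) t :
  (forall t u, 0 <= p t u) -> summ (fun x => p x.1 x.2) ->
  summ (p t).
Proof.
move=> p0; rewrite /summ esumr_pair//; apply: le_lt_trans.
by apply: (@esum_term R T (fun t => esumr (p t))) => u; exact: esumr_ge0.
Qed.

Lemma rsum_pair (T U : choiceType) (f : T -> U -> R) :
  summ (fun p => `|f p.1 p.2|) ->
  rsum (fun t => rsum (f t)) = rsum (fun p => f p.1 p.2).
Proof.
move=> ff; have [p [q [fE p0 q0 [pf qf]]]] := rsum_posneg ff.
have P0 k : 0 <= p k by case/andP: (p0 k).
have Q0 k : 0 <= q k by case/andP: (q0 k).
rewrite [RHS](eq_rsum fE) rsumE//.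
have pE : p = (fun x => p (x.1, x.2)) by apply/funext => -[].
have qE : q = (fun x => q (x.1, x.2)) by apply/funext => -[].
have Pf t : summ (fun u => p (t, u)).
  by apply: (@esumr_row _ _ (fun t u => p (t, u))) => //; rewrite -pE.
have Qf t : summ (fun u => q (t, u)).
  by apply: (@esumr_row _ _ (fun t u => q (t, u))) => //; rewrite -qE.
have row t : rsum (f t) = fine (esumr (fun u => p (t, u))) -
                          fine (esumr (fun u => q (t, u))).
  by rewrite -rsumE//; apply: eq_rsum => u; rewrite -fE.
have tot (r : T * U -> R) : (forall x, 0 <= r x) ->
    (forall t, summ (fun u => r (t, u))) ->
    esumr (fun t => fine (esumr (fun u => r (t, u)))) = esumr r.
  move=> r0 rf; rewrite [RHS](_ : _ = esumr (fun x => r (x.1, x.2))).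
    rewrite (@esumr_pair _ _ _ (fun t u => r (t, u)))//.
    by apply: eq_esum => t _; rewrite fineK// esumr_fin.
  by apply: eq_esumr => -[].
rewrite (eq_rsum row) rsumE ?tot//; rewrite /summ ?tot// => t.
  by rewrite fine_ge0// esumr_ge0.
by rewrite fine_ge0// esumr_ge0.
Qed.

Lemma rsum_reindex (T U : choiceType) (e : T -> U) (e' : U -> T) (f : U -> R) :
  cancel e e' -> cancel e' e -> rsum (fun t => f (e t)) = rsum f.
Proof.
move=> ee' e'e; rewrite /rsum.
by rewrite -(esumr_reindex _ ee' e'e) -[in RHS](esumr_reindex _ ee' e'e).
Qed.

Lemma rsum_seq (T : choiceType) (f : T -> R) (s : seq T) : uniq s ->
  (forall k, k \notin s -> f k = 0) -> rsum f = \sum_(k <- s) f k.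
Proof.
move=> us fs; have key (g : T -> R) : (forall k, 0 <= g k) ->
    (forall k, k \notin s -> g k = 0) -> esumr g = (\sum_(k <- s) g k)%:E.
  move=> g0 gs; apply/eqP; rewrite eq_le esumr_seq// andbT.
  apply: esumr_le => s' us'; rewrite lee_fin (bigID (mem s))/=.
  rewrite [X in _ + X]big1; last by move=> k /gs.
  rewrite addr0 [leRHS](bigID (mem s'))/= -big_filter -[X in _ <= X + _]big_filter.
  rewrite (perm_big [seq x <- s | x \in s']); first by rewrite lerDl sumr_ge0.
  by apply: uniq_perm; rewrite ?filter_uniq// => x; rewrite !mem_filter andbC.
rewrite /rsum !key.
- rewrite -sumrB; apply: eq_bigr => k _ /=.
  by case: (leP (f k) 0) => h; case: (leP (- f k) 0) => h'; lra.
- by move=> k; rewrite le_max lexx orbT.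
- by move=> k /fs ->; rewrite oppr0 maxxx.
- by move=> k; rewrite le_max lexx orbT.
- by move=> k /fs ->; rewrite maxxx.
Qed.

End SignedSums.

(** * Unordered sums of complex families *)
Section ComplexSums.
Context {R : realType}.
Local Notation C := R[i].

Definition asumm (T : choiceType) (f : T -> C) : bool :=
  summ (fun k => normc (f k)).

Definition csum (T : choiceType) (f : T -> C) : C :=
  rsum (fun k => Re (f k)) +i* rsum (fun k => Im (f k)).

Lemma le_summ (T : choiceType) (f g : T -> R) :
  (forall k, f k <= g k) -> summ g -> summ f.
Proof. by move=> fg; apply: le_lt_trans; exact: le_esumr. Qed.

Lemma asumm_le (T : choiceType) (f : T -> C) (g : T -> R) :
  (forall k, normc (f k) <= g k) -> summ g -> asumm f.
Proof. exact: le_summ. Qed.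

Lemma asumm_Re (T : choiceType) (f : T -> C) :
  asumm f -> summ (fun k => `|Re (f k)|).
Proof. by apply: le_summ => k; exact: normc_Re. Qed.

Lemma asumm_Im (T : choiceType) (f : T -> C) :
  asumm f -> summ (fun k => `|Im (f k)|).
Proof. by apply: le_summ => k; exact: normc_Im. Qed.

Lemma summD (T : choiceType) (f g : T -> R) :
  (forall k, 0 <= f k) -> (forall k, 0 <= g k) -> summ f -> summ g ->
  summ (fun k => f k + g k).
Proof. by move=> *; rewrite /summ esumrD// lte_add_pinfty. Qed.

Lemma summZ (T : choiceType) (c : R) (f : T -> R) :
  0 <= c -> (forall k, 0 <= f k) -> summ f -> summ (fun k => c * f k).
Proof. by move=> *; rewrite /summ esumrZ// lte_mul_pinfty ?lee_fin. Qed.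

Lemma asummD (T : choiceType) (f g : T -> C) :
  asumm f -> asumm g -> asumm (fun k => f k + g k).
Proof.
move=> ff gf; apply: asumm_le (fun k => ler_normcD _ _) _.
by apply: summD => // k; exact: normc_ge0.
Qed.

Lemma asummZ (T : choiceType) (c : C) (f : T -> C) :
  asumm f -> asumm (fun k => c * f k).
Proof.
move=> ff; apply: (asumm_le (g := fun k => normc c * normc (f k))).
  by move=> k; rewrite normcM.
by apply: summZ => [||//] *; exact: normc_ge0.
Qed.

Lemma asummN (T : choiceType) (f : T -> C) :
  asumm f -> asumm (fun k => - f k).
Proof. by move=> ff; apply: asumm_le ff => k; rewrite normcN. Qed.

Lemma asummB (T : choiceType) (f g : T -> C) :
  asumm f -> asumm g -> asumm (fun k => f k - g k).
Proof. by move=> ff gf; apply: asummD => //; exact: asummN. Qed.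

Lemma eq_csum (T : choiceType) (f g : T -> C) :
  (forall k, f k = g k) -> csum f = csum g.
Proof. by move=> fg; congr csum; apply/funext. Qed.

Lemma csumD (T : choiceType) (f g : T -> C) : asumm f -> asumm g ->
  csum (fun k => f k + g k) = csum f + csum g.
Proof.
move=> ff gf; apply: complex_eqP; rewrite ?RecD ?ImcD /=.
  rewrite -rsumD ?asumm_Re//; apply: eq_rsum => k; exact: RecD.
by rewrite -rsumD ?asumm_Im//; apply: eq_rsum => k; exact: ImcD.
Qed.

Lemma csumN (T : choiceType) (f : T -> C) : csum (fun k => - f k) = - csum f.
Proof.
apply: complex_eqP; rewrite ?RecN ?ImcN /= -rsumN; apply: eq_rsum => k.
  exact: RecN.
exact: ImcN.
Qed.

Lemma csumB (T : choiceType) (f g : T -> C) : asumm f -> asumm g ->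
  csum (fun k => f k - g k) = csum f - csum g.
Proof. by move=> ff gf; rewrite csumD ?csumN//; exact: asummN. Qed.

Lemma csumZ (T : choiceType) (c : C) (f : T -> C) : asumm f ->
  csum (fun k => c * f k) = c * csum f.
Proof.
move=> ff; have cR (d : R) := rsumZ d (asumm_Re ff).
have cI (d : R) := rsumZ d (asumm_Im ff).
have sR (d : R) : summ (fun k => `|d * Re (f k)|).
  under [X in summ X]eq_fun do rewrite normrM.
  by apply: summZ => //; exact: asumm_Re.
have sI (d : R) : summ (fun k => `|d * Im (f k)|).
  under [X in summ X]eq_fun do rewrite normrM.
  by apply: summZ => //; exact: asumm_Im.
apply: complex_eqP; rewrite [RHS](RecM, ImcM) /=.
  rewrite -cR -cI -rsumN -rsumD//.
    by apply: eq_rsum => k; rewrite RecM.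
  by under [X in summ X]eq_fun do rewrite normrN.
rewrite -(cI (Re c)) -(cR (Im c)) -rsumD//.
by apply: eq_rsum => k; rewrite ImcM.
Qed.

(** A rotation makes the sum real and nonnegative, and the real parts are
    bounded by the moduli. *)
Lemma csum_le (T : choiceType) (f : T -> C) (M : R) :
  (esumr (fun k => normc (f k)) <= M%:E)%E -> normc (csum f) <= M.
Proof.
move=> fM; have ff : asumm f by rewrite /asumm /summ (le_lt_trans fM)// ltry.
have [th th1 <-] := normc_rotate (csum f).
rewrite -csumZ//= rsum_le//; apply: le_trans fM; apply: le_esumr => k.
by rewrite (le_trans (normc_Re _))// normcM th1 mul1r.
Qed.

Lemma csum_le_esumr (T : choiceType) (f : T -> C) : asumm f ->
  ((normc (csum f))%:E <= esumr (fun k => normc (f k)))%E.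
Proof.
move=> ff; have e := esumr_fin (fun k => normc_ge0 (f k)) ff.
by rewrite -(fineK e) lee_fin csum_le// fineK.
Qed.

Lemma csum_pair (T U : choiceType) (f : T -> U -> C) :
  asumm (fun p => f p.1 p.2) ->
  csum (fun t => csum (f t)) = csum (fun p => f p.1 p.2).
Proof.
move=> ff; apply: complex_eqP => /=.
  exact: (@rsum_pair _ _ _ (fun t u => Re (f t u)) (asumm_Re ff)).
exact: (@rsum_pair _ _ _ (fun t u => Im (f t u)) (asumm_Im ff)).
Qed.

Lemma csum_reindex (T U : choiceType) (e : T -> U) (e' : U -> T) (f : U -> C) :
  cancel e e' -> cancel e' e -> csum (fun t => f (e t)) = csum f.
Proof.
move=> ee' e'e; apply: complex_eqP => /=.
  exact: (rsum_reindex (fun k => Re (f k)) ee' e'e).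
exact: (rsum_reindex (fun k => Im (f k)) ee' e'e).
Qed.

Lemma summ_reindex (T U : choiceType) (e : T -> U) (e' : U -> T) (f : U -> R) :
  cancel e e' -> cancel e' e -> summ (fun t => f (e t)) = summ f.
Proof. by move=> ee' e'e; rewrite /summ (esumr_reindex _ ee' e'e). Qed.

Lemma csum_swap (T U : choiceType) (f : T -> U -> C) :
  asumm (fun p => f p.1 p.2) ->
  csum (fun t => csum (f t)) = csum (fun u => csum (fun t => f t u)).
Proof.
move=> ff; rewrite csum_pair//.
have sK : cancel (fun p : T * U => (p.2, p.1)) (fun p : U * T => (p.2, p.1)).
  by case.
have sK' : cancel (fun p : U * T => (p.2, p.1)) (fun p : T * U => (p.2, p.1)).
  by case.
rewrite (@csum_pair _ _ (fun u t => f t u)).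
  by rewrite -(csum_reindex _ sK' sK).
by rewrite /asumm (summ_reindex (fun p => normc (f p.1 p.2)) sK' sK).
Qed.

Lemma csum_seq (T : choiceType) (f : T -> C) (s : seq T) : uniq s ->
  (forall k, k \notin s -> f k = 0) -> csum f = \sum_(k <- s) f k.
Proof.
move=> us fs; apply: complex_eqP => /=.
  by rewrite (rsum_seq us) => [|k /fs ->//]; rewrite Rec_sum.
rewrite (rsum_seq us) => [|k /fs ->//].
by elim/big_ind2: _ => // x y z w -> ->; rewrite ImcD.
Qed.

Lemma csum1 (T : choiceType) (f : T -> C) (k0 : T) :
  (forall k, k != k0 -> f k = 0) -> csum f = f k0.
Proof.
move=> h; rewrite (@csum_seq _ _ [:: k0])// ?big_seq1// => k.
by rewrite inE; exact: h.
Qed.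

Lemma asumm_seq (T : choiceType) (f : T -> C) (s : seq T) :
  (forall k, k \notin s -> f k = 0) -> asumm f.
Proof.
move=> fs; apply: (@le_lt_trans _ _ (\sum_(k <- undup s) normc (f k))%:E); last exact: ltry.
apply: esumr_le => s' us'; rewrite lee_fin (bigID (mem s))/=.
rewrite [X in _ + X]big1; last by move=> k /fs ->; rewrite normc0.
rewrite addr0 [leRHS](bigID (mem s'))/= -big_filter -[X in _ <= X + _]big_filter.
rewrite (perm_big [seq x <- undup s | x \in s']).
  by rewrite lerDl sumr_ge0// => k _; exact: normc_ge0.
apply: uniq_perm; rewrite ?filter_uniq// ?undup_uniq// => x.
by rewrite !mem_filter mem_undup andbC.
Qed.

Lemma summ_prod (T U : choiceType) (f : T -> R) (g : U -> R) :
  (forall t, 0 <= f t) -> (forall t, 0 <= g t) -> summ f -> summ g ->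
  summ (fun p : T * U => f p.1 * g p.2).
Proof.
move=> f0 g0 ff gf; rewrite /summ esumr_prod//.
by rewrite -(fineK (esumr_fin f0 ff)) lte_mul_pinfty// lee_fin fine_ge0// esumr_ge0.
Qed.

Lemma csumM (T U : choiceType) (f : T -> C) (g : U -> C) : asumm f -> asumm g ->
  csum f * csum g = csum (fun p : T * U => f p.1 * g p.2).
Proof.
move=> ff gf; rewrite -(@csum_pair _ _ (fun t u => f t * g u)).
  rewrite mulrC -csumZ//; apply: eq_csum => t.
  by rewrite mulrC csumZ.
rewrite /asumm; under [X in summ X]eq_fun do rewrite normcM.
by apply: (@summ_prod _ _ (fun t => normc (f t)) (fun u => normc (g u))) => // *;
   exact: normc_ge0.
Qed.

(** Fubini on the graph of [e]. With the addition of two indices for [e]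
    this gives the Cauchy product, with the successor the shift of the
    index. *)
Lemma csum_fibers (T U : choiceType) (e : T -> U) (f : T -> C) : asumm f ->
  csum f = csum (fun u => csum (fun t => if e t == u then f t else 0)).
Proof.
move=> ff; rewrite -csum_swap.
  apply: eq_csum => t; rewrite (@csum1 _ _ (e t)) ?eqxx// => u.
  by rewrite eq_sym => /negbTE ->.
rewrite /asumm /summ (@esumr_pair _ _ _ (fun t u => normc (if e t == u then f t else 0))).
  rewrite (_ : (\esum_(t in _) _)%E = esumr (fun t => normc (f t)))//.
  apply: eq_esum => t _; apply/eqP; rewrite eq_le; apply/andP; split.
    apply: esumr_le => s us; rewrite lee_fin.
    rewrite (eq_bigr (fun u => if u == e t then normc (f t) else 0)); last first.
      by move=> u _; rewrite eq_sym; case: ifP; rewrite ?normc0.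
    rewrite -big_mkcond/= big_const_seq iter_addr_0 -mulr_natl.
    rewrite ler_piMl ?normc_ge0// (_ : 1 = 1%:R)// ler_nat.
    by rewrite -/(count_mem (e t) s) count_uniq_mem// leq_b1.
  have := @esumr_term R _ (fun u => normc (if e t == u then f t else 0)) (e t).
  by rewrite eqxx; apply => k; exact: normc_ge0.
by move=> *; exact: normc_ge0.
Qed.

Lemma csum_cauchy (f : nat -> nat -> C) : asumm (fun p : nat * nat => f p.1 p.2) ->
  csum (fun p : nat * nat => f p.1 p.2) =
  csum (fun n => \sum_(i < n.+1) f i (n - i)%N).
Proof.
move=> ff; rewrite (csum_fibers (fun p => p.1 + p.2)%N)//.
apply: eq_csum => n; rewrite (@csum_seq _ _ [seq (val i, n - val i)%N | i <- enum 'I_n.+1]).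
- rewrite big_map big_enum/=; apply: eq_bigr => i _ /=.
  by rewrite subnKC ?eqxx// -ltnS.
- rewrite map_inj_uniq ?enum_uniq// => i j [/val_inj -> //].
- move=> [i j] /=; case: eqP => // <- /negP[]; apply/mapP.
  have h : (i < (i + j).+1)%N by rewrite ltnS leq_addr.
  by exists (Ordinal h); rewrite ?mem_enum//= addKn.
Qed.

(** The difference is the sum of the family obtained by replacing the terms
    in [s] by 0. *)
Lemma csum_approx (T : choiceType) (f : T -> C) (s : seq T) (M : R) :
  asumm f -> uniq s ->
  (esumr (fun k => if k \in s then 0%R else normc (f k)) <= M%:E)%E ->
  normc (csum f - \sum_(k <- s) f k) <= M.
Proof.
move=> ff us hM.
rewrite (eq_big_seq (fun k => if k \in s then f k else 0)); last by move=> k ->.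
rewrite -(csum_seq us); last by move=> k /negbTE ->.
rewrite -csumB//; last by apply: (@asumm_seq _ _ s) => k /negbTE ->.
apply: csum_le; apply: le_trans hM; apply: le_esumr => k.
by case: ifP; rewrite ?subrr ?subr0 ?normc0.
Qed.

End ComplexSums.

(** * Weights on frequencies and the symbol of the nonlinearity *)
Section CoefficientSpace.
Context {R : realType}.
Local Notation C := R[i].
Implicit Types (d e : R) (a b : int -> C) (j k l : int).

(** The factor [1 + |k|] is the l^1 counterpart of the exponent [s + 1]
    instead of [s]: the norm of width [d] controls [u_x] at the same width. *)
Definition wt d k : R := (1 + `|k%:~R|) * expR (2 * pi * d * `|k%:~R|).

Definition nrm d a : \bar R := esumr (fun k => wt d k * normc (a k)).

(** The symbol of [d/dx]. *)
Definition Dk k : C := 0 +i* (2 * pi * k%:~R).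

(** The symbol of [(d/dx) A^{-1}]; the inverse of 0 is 0, and the value at
    the frequency 0 is correct because the derivative annihilates constants. *)
Definition mk k : C := 0 +i* (2 * pi * k%:~R)^-1.

(** The symbol of [- (a b_x + (d/dx) A^{-1} (2 mu(a) b + a_x b_x / 2))] on
    the pair of frequencies [(j, l)]; the test [j == 0] selects the mean of
    [a]. *)
Definition bker j l : C :=
  - Dk l - mk (j + l) * ((if j == 0 then 2 else 0) + 2^-1 * (Dk j * Dk l)).

Definition Bil a b k : C := csum (fun j => bker j (k - j) * a j * b (k - j)).

Lemma pi2_gt0 : 0 < 2 * pi :> R.
Proof. by rewrite mulr_gt0// pi_gt0. Qed.

Lemma absz_int (k : int) : k != 0 -> 1 <= `|k%:~R : R|.
Proof. by move=> k0; rewrite -intr_norm ler1z; lia. Qed.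

Lemma wt_ge1 d k : 0 <= d -> 1 <= wt d k.
Proof.
move=> d0; rewrite /wt -[1 in leLHS]mulr1 ler_pM// ?lerDl//.
by rewrite (le_trans _ (expR_ge1Dx _))// lerDl !mulr_ge0// ?pi_ge0.
Qed.

Lemma wt_ge0 d k : 0 <= wt d k.
Proof. by rewrite mulr_ge0 ?addr_ge0 ?expR_ge0. Qed.

Lemma wt_gt0 d k : 0 < wt d k.
Proof. by rewrite mulr_gt0 ?expR_gt0// ltr_pwDl. Qed.

Lemma le_wt d e k : d <= e -> wt d k <= wt e k.
Proof.
move=> de; rewrite ler_pM2l ?ltr_pwDl// ler_expR ler_wpM2r//.
by rewrite ler_wpM2l// ltW// pi2_gt0.
Qed.

Lemma normc_Dk k : normc (Dk k) = 2 * pi * `|k%:~R|.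
Proof.
by rewrite /= expr0n add0r sqrtr_sqr normrM ger0_norm// ltW// pi2_gt0.
Qed.

Lemma normc_mk k : normc (mk k) = (2 * pi * `|k%:~R|)^-1.
Proof.
by rewrite /= expr0n add0r sqrtr_sqr normfV normrM ger0_norm// ltW// pi2_gt0.
Qed.

(** One derivative is worth a loss [e] of the width of analyticity, at the
    price of a factor [1 / e]. *)
Lemma freq_le_exp e k : 0 < e ->
  2 * pi * `|k%:~R| <= e^-1 * expR (2 * pi * e * `|k%:~R|).
Proof.
move=> e0; rewrite -ler_pdivrMl ?invr_gt0// invrK.
apply: le_trans (expR_ge1Dx _); rewrite ler_wpDl//.
by rewrite le_eqVlt; apply/orP; left; apply/eqP; ring.
Qed.

Lemma wt_split d e k : wt (d + e) k = wt d k * expR (2 * pi * e * `|k%:~R|).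
Proof. by rewrite /wt -[RHS]mulrA -expRD; congr (_ * expR _); ring. Qed.

(** Since [|j + l| <= |j| + |l|], the weights are submultiplicative, and the
    weighted l^1 space is an algebra for the convolution. *)
Lemma wtD d j l : 0 <= d -> wt d (j + l) <= wt d j * wt d l.
Proof.
move=> d0; rewrite /wt [leRHS]mulrACA -expRD.
have h : `|(j + l)%:~R : R| <= `|j%:~R| + `|l%:~R| by rewrite intrD ler_normD.
have p0 : 0 <= 2 * pi * d by rewrite mulr_ge0// ltW// pi2_gt0.
apply: ler_pM; rewrite ?addr_ge0 ?expR_ge0//.
  have := mulr_ge0 (normr_ge0 (j%:~R : R)) (normr_ge0 (l%:~R : R)); nra.
by rewrite ler_expR -mulrDr ler_wpM2l.
Qed.

(** The quadratic term loses a single derivative: the two derivatives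
    carried by [u_x ^+ 2] are compensated by the weight [1 + |k|] on each
    factor and by the multiplier [mk] of order -1. *)
Lemma bker_bound d e j l : 0 <= d -> 0 < e -> e <= 1 ->
  wt d (j + l) * normc (bker j l) <= 9 / e * (wt (d + e) j * wt (d + e) l).
Proof.
move=> d0 e0 e1.
set W := wt (d + e) j * wt (d + e) l.
have W0 : 0 <= W by rewrite mulr_ge0 ?wt_ge0.
have ei : 1 <= e^-1 by rewrite invf_ge1.
have de0 : 0 <= d + e by rewrite addr_ge0// ltW.
have first : wt d (j + l) * normc (Dk l) <= e^-1 * W.
  rewrite normc_Dk (le_trans (ler_wpM2r _ (wtD _ _ d0)))//.
    by rewrite mulr_ge0// ltW// pi2_gt0.
  rewrite [leLHS](_ : _ = wt d j * (wt d l * (2 * pi * `|l%:~R|))); last by ring.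
  rewrite [leRHS](_ : _ = wt (d + e) j * (e^-1 * wt (d + e) l)); last first.
    by rewrite /W; ring.
  apply: ler_pM; rewrite ?wt_ge0// ?mulr_ge0 ?wt_ge0// ?pi_ge0//.
    by rewrite le_wt// lerDl ltW.
  rewrite wt_split [leRHS]mulrCA ler_wpM2l ?wt_ge0//.
  exact: freq_le_exp.
have second : wt d (j + l) * normc (mk (j + l) *
    ((if j == 0 then 2 else 0) + 2^-1 * (Dk j * Dk l))) <= 8 * W.
  (* The factor [1 + K] of the weight cancels the factor [1 / K] of the
     multiplier; the frequency 0 is apart because the multiplier vanishes
     there. *)
  have [jl0|jl0] := eqVneq (j + l) 0.
    have -> : mk (j + l) = 0 by rewrite /mk jl0 mulr0 invr0.
    by rewrite mul0r normc0 mulr0 mulr_ge0.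
  have := absz_int jl0; set K := `|(j + l)%:~R : R| => K1.
  have K0 : 0 < K by rewrite (lt_le_trans _ K1).
  have pi0 : 0 < pi :> R := pi_gt0 R.
  have pi4 : pi < 4 :> R by have := pihalf_lt2 R; lra.
  have pi2 : 2 <= pi :> R := pi_ge2 R.
  set J := `|j%:~R : R|; set L := `|l%:~R : R|.
  have J0 : 0 <= J by exact: normr_ge0.
  have L0 : 0 <= L by exact: normr_ge0.
  have JL : 0 <= J * L by exact: mulr_ge0.
  have inner : normc ((if j == 0 then 2 else 0 : C) + 2^-1 * (Dk j * Dk l)) <=
      2 + 2 * pi ^+ 2 * (J * L).
    apply: le_trans (ler_normcD _ _) _; apply: lerD.
      by case: ifP => _; rewrite ?normc0// normc_natr.
    rewrite normcM normcV (normc_natr 2) normcM !normc_Dk -/J -/L.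
    by rewrite le_eqVlt; apply/orP; left; apply/eqP; field.
  have expE : expR (2 * pi * d * K) <= expR (2 * pi * (d + e) * J) *
                                       expR (2 * pi * (d + e) * L).
    rewrite -expRD ler_expR.
    have h : K <= J + L by rewrite /K /J /L intrD ler_normD.
    apply: le_trans (_ : 2 * pi * (d + e) * (J + L) <= _); last by rewrite mulrDr.
    apply: ler_pM => //; [by rewrite !mulr_ge0// ltW|exact: ltW|].
    by rewrite ler_wpM2l ?lerDl ?ltW// mulr_gt0.
  rewrite normcM normc_mk /W /wt -/K -/J -/L.
  rewrite [leLHS](_ : _ = expR (2 * pi * d * K) * ((1 + K) / (2 * pi * K) *
    normc ((if j == 0 then 2 else 0 : C) + 2^-1 * (Dk j * Dk l)))); last by ring.
  rewrite [leRHS](_ : _ = expR (2 * pi * (d + e) * J) *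
      expR (2 * pi * (d + e) * L) * (8 * ((1 + J) * (1 + L)))); last by ring.
  apply: ler_pM => //.
    by rewrite mulr_ge0 ?normc_ge0// divr_ge0 ?addr_ge0 ?mulr_ge0 ?ltW.
  have k1 : (1 + K) / (2 * pi * K) <= pi^-1.
    rewrite ler_pdivrMr ?mulr_gt0//.
    rewrite [leRHS](_ : _ = 2 * K); first by lra.
    by rewrite [2 * pi]mulrC -mulrA mulKf ?gt_eqF.
  apply: (@le_trans _ _ (pi^-1 * (2 + 2 * pi ^+ 2 * (J * L)))).
    by apply: ler_pM; rewrite ?normc_ge0// divr_ge0 ?addr_ge0 ?mulr_ge0 ?ltW.
  rewrite mulrC ler_pdivrMr//.
  have h1 : 0 <= pi * (4 - pi) * (J * L) by rewrite !mulr_ge0// ?subr_ge0 ltW.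
  have h2 : 0 <= pi * J by rewrite mulr_ge0// ltW.
  have h3 : 0 <= pi * L by rewrite mulr_ge0// ltW.
  have h4 : 0 <= pi * (J * L) by rewrite mulr_ge0// ltW.
  move: (pi : R) pi2 h1 h2 h3 h4 => p p2 h1 h2 h3 h4.
  rewrite [leRHS](_ : _ = 8 * p + 8 * (p * J) + 8 * (p * L) + 8 * (p * (J * L)));
    last by ring.
  rewrite [p * (4 - p) * _](_ : _ = 4 * (p * (J * L)) - p ^+ 2 * (J * L)) in h1;
    last by ring.
  lra.
rewrite /bker; apply: le_trans (ler_wpM2l (wt_ge0 _ _) (ler_normcB _ _)) _.
rewrite normcN mulrDr (le_trans (lerD first second))//.
rewrite -mulrDl ler_wpM2r//; lra.
Qed.

End CoefficientSpace.

(** * Weighted l^1 norms and the bilinear estimate *)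
Section BilinearEstimate.
Context {R : realType}.
Local Notation C := R[i].
Implicit Types (d e : R) (a b : int -> C) (j k l : int).

Lemma nrm_ge0 d a : (0 <= nrm d a)%E.
Proof. by apply: esumr_ge0 => k; rewrite mulr_ge0 ?wt_ge0 ?normc_ge0. Qed.

Lemma le_nrm d e a : d <= e -> (nrm d a <= nrm e a)%E.
Proof.
by move=> de; apply: le_esumr => k; rewrite ler_wpM2r ?normc_ge0 ?le_wt.
Qed.

Lemma nrm_term d a k : (((wt d k * normc (a k))%R)%:E <= nrm d a)%E.
Proof.
by apply: (@esumr_term R _ (fun k => wt d k * normc (a k))) => j;
   rewrite mulr_ge0 ?wt_ge0 ?normc_ge0.
Qed.

Lemma nrmD d a b : (nrm d (fun k => (a k + b k)%R) <= nrm d a + nrm d b)%E.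
Proof.
rewrite -esumrD; last 2 first.
- by move=> k; rewrite mulr_ge0 ?wt_ge0 ?normc_ge0.
- by move=> k; rewrite mulr_ge0 ?wt_ge0 ?normc_ge0.
by apply: le_esumr => k; rewrite -mulrDr ler_wpM2l ?wt_ge0 ?ler_normcD.
Qed.

Lemma nrmZ d (c : C) a : nrm d (fun k => c * a k) = ((normc c)%:E * nrm d a)%E.
Proof.
rewrite -esumrZ ?normc_ge0//; last by move=> k; rewrite mulr_ge0 ?wt_ge0 ?normc_ge0.
by apply: eq_esumr => k; rewrite normcM mulrCA.
Qed.

Lemma nrmN d a : nrm d (fun k => - a k) = nrm d a.
Proof. by apply: eq_esumr => k; rewrite normcN. Qed.

Lemma nrmB d a b : (nrm d (fun k => (a k - b k)%R) <= nrm d a + nrm d b)%E.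
Proof. by rewrite -[X in (_ + X)%E]nrmN nrmD. Qed.

(** The shear (j, l) -> (j, j + l) turns sums over pairs of frequencies into
    sums of convolution type. *)
Lemma esumr_shear (f : int -> int -> R) : (forall j l, 0 <= f j l) ->
  esumr (fun p : int * int => f p.1 p.2) =
  (\esum_(k in [set: int]) esumr (fun j => f j (k - j)%R))%E.
Proof.
move=> f0; rewrite -(@esumr_pair _ _ _ (fun k j => f j (k - j)))//.
pose g (p : int * int) : int * int := (p.1 + p.2, p.1).
pose h (p : int * int) : int * int := (p.2, p.1 - p.2).
have gh : cancel g h by case=> x y; rewrite /g /h /= addrAC subrr add0r.
have hg : cancel h g by case=> x y; rewrite /g /h /= addrC subrK.
rewrite -(esumr_reindex (fun p : int * int => f p.2 (p.1 - p.2)) gh hg).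
by apply: eq_esumr => -[x y] /=; rewrite addrAC subrr add0r.
Qed.

Section Bounds.
Variables (d e A B : R) (a b : int -> C).
Hypotheses (d0 : 0 <= d) (e0 : 0 < e) (e1 : e <= 1).
Hypotheses (aA : (nrm (d + e) a <= A%:E)%E) (bB : (nrm (d + e) b <= B%:E)%E).

(** The double series behind [Bil a b] converges absolutely; its rows and
    its weighted norm are bounded by its total. *)
Lemma Bil_pair_bound :
  (esumr (fun p : int * int =>
     (wt d (p.1 + p.2) * normc (bker p.1 p.2 * a p.1 * b p.2))%R) <=
   (9 / e * (A * B))%:E)%E.
Proof.
have n0 (x : int -> C) k : 0 <= wt (d + e) k * normc (x k).
  by rewrite mulr_ge0 ?wt_ge0 ?normc_ge0.
have bfin : summ (fun k => wt (d + e) k * normc (b k)).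
  by apply: le_lt_trans bB _; exact: ltry.
have afin : summ (fun k => wt (d + e) k * normc (a k)).
  by apply: le_lt_trans aA _; exact: ltry.
apply: (@le_trans _ _ (esumr (fun p : int * int => 9 / e *
    ((wt (d + e) p.1 * normc (a p.1)) * (wt (d + e) p.2 * normc (b p.2)))))).
  apply: le_esumr => -[j l] /=; rewrite !normcM.
  rewrite [leLHS](_ : _ = wt d (j + l) * normc (bker j l) *
    (normc (a j) * normc (b l))); last by ring.
  rewrite [leRHS](_ : _ = 9 / e * (wt (d + e) j * wt (d + e) l) *
    (normc (a j) * normc (b l))); last by ring.
  by rewrite ler_wpM2r ?mulr_ge0 ?normc_ge0// bker_bound.
have e9 : 0 <= 9 / e by rewrite divr_ge0// ltW.
rewrite esumrZ//; last by move=> [j l]; exact: mulr_ge0.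
rewrite [leRHS]EFinM lee_pmul ?lee_fin//.
  by apply: esumr_ge0 => -[j l]; exact: mulr_ge0.
rewrite (@esumr_prod _ _ _ (fun j => wt (d + e) j * normc (a j)) (fun l => wt (d + e) l * normc (b l)))//.
by rewrite EFinM lee_pmul// nrm_ge0.
Qed.

Lemma Bil_row_bound k :
  (esumr (fun j => normc (bker j (k - j) * a j * b (k - j))%R) <=
   (9 / e * (A * B))%:E)%E.
Proof.
apply: le_trans Bil_pair_bound.
rewrite (@esumr_shear (fun j l => wt d (j + l) * normc (bker j l * a j * b l))); last first.
  by move=> *; rewrite mulr_ge0 ?wt_ge0 ?normc_ge0.
apply: (@le_trans _ _ (esumr (fun j => wt d (j + (k - j)) *
    normc (bker j (k - j) * a j * b (k - j))))).
  by apply: le_esumr => j; rewrite ler_peMl ?normc_ge0// wt_ge1.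
apply: (@esum_term R _ (fun k => esumr (fun j => wt d (j + (k - j)) *
    normc (bker j (k - j) * a j * b (k - j))))) => i.
by apply: esumr_ge0 => j; rewrite mulr_ge0 ?wt_ge0 ?normc_ge0.
Qed.

Lemma Bil_row k : asumm (fun j => bker j (k - j) * a j * b (k - j)).
Proof. exact: le_lt_trans (Bil_row_bound k) (ltry _). Qed.

Lemma Bil_bound : (nrm d (Bil a b) <= (9 / e * (A * B))%:E)%E.
Proof.
apply: le_trans Bil_pair_bound.
rewrite (@esumr_shear (fun j l => wt d (j + l) * normc (bker j l * a j * b l))); last first.
  by move=> *; rewrite mulr_ge0 ?wt_ge0 ?normc_ge0.
apply: le_esum => k _.
under [leRHS]eq_esumr do rewrite subrKC.
rewrite esumrZ ?wt_ge0//; last by move=> *; exact: normc_ge0.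
by rewrite EFinM lee_pmul ?lee_fin ?wt_ge0 ?normc_ge0// csum_le_esumr// Bil_row.
Qed.

End Bounds.

Lemma nrm_fin d a : (nrm d a < +oo)%E -> exists2 A, 0 <= A & (nrm d a <= A%:E)%E.
Proof.
move=> h; have f : nrm d a \is a fin_num by rewrite ge0_fin_numE// nrm_ge0.
by exists (fine (nrm d a)); rewrite ?fineK// fine_ge0// nrm_ge0.
Qed.

Lemma Bil_rowE e a b k : 0 < e -> e <= 1 -> (nrm e a < +oo)%E -> (nrm e b < +oo)%E ->
  asumm (fun j => bker j (k - j) * a j * b (k - j)).
Proof.
move=> e0 e1 /nrm_fin[A _ aA] /nrm_fin[B _ bB].
by apply: (@Bil_row 0 e A B); rewrite // add0r.
Qed.

(** Polarization: the difference of two solutions satisfies a linear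
    equation. *)
Lemma Bil_diff e a b k : 0 < e -> e <= 1 ->
  (nrm e a < +oo)%E -> (nrm e b < +oo)%E ->
  Bil a a k - Bil b b k =
  Bil (fun j => a j - b j) a k + Bil b (fun j => a j - b j) k.
Proof.
move=> e0 e1 af bf.
have cf : (nrm e (fun j => (a j - b j)%R) < +oo)%E.
  by rewrite (le_lt_trans (nrmB _ _ _))// lte_add_pinfty.
pose c j := a j - b j.
rewrite -(csumD (@Bil_rowE e c a k e0 e1 cf af) (@Bil_rowE e b c k e0 e1 bf cf)).
rewrite -(csumB (@Bil_rowE e a a k e0 e1 af af) (@Bil_rowE e b b k e0 e1 bf bf)).
by apply: eq_csum => j; rewrite /c; ring.
Qed.

End BilinearEstimate.

(** * Taylor coefficients of the solution in time *)
Section PowerSeriesCoefficients.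
Context {R : realType}.
Local Notation C := R[i].

Lemma natr_succ2_le (n : nat) : n.+2%:R <= 2 * n.+1%:R :> R.
Proof. by rewrite -natrM ler_nat; lia. Qed.

Lemma sum_inv_sqr (n : nat) : \sum_(i < n) (i.+1%:R ^+ 2)^-1 <= 2 :> R.
Proof.
suff h m : \sum_(i < m.+1) (i.+1%:R ^+ 2)^-1 <= 2 - m.+1%:R^-1 :> R.
  case: n => [|n]; first by rewrite big_ord0.
  by rewrite (le_trans (h n))// lerBlDr lerDl invr_ge0.
elim: m => [|m IH]; first by rewrite big_ord_recr big_ord0/= expr1n invr1; lra.
rewrite big_ord_recr/= (le_trans (lerD IH (lexx _)))//.
set x : R := m.+1%:R; have x0 : 0 < x by rewrite ltr0n.
have -> : m.+2%:R = x + 1 by rewrite -natr1.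
have y0 : 0 < x + 1 by rewrite addr_gt0.
rewrite -subr_ge0 [leRHS](_ : _ = (x * (x + 1) ^+ 2)^-1).
  by rewrite invr_ge0; apply: mulr_ge0; rewrite ?exprn_ge0 ?ltW.
by field; rewrite !gt_eqF.
Qed.

(** Squared inverses convolve to squared inverses; this weight absorbs the
    number of terms in the recursion for the Taylor coefficients. *)
Lemma sum_inv_sqr_conv (n : nat) :
  \sum_(i < n.+1) (i.+1%:R ^+ 2)^-1 * ((n - i).+1%:R ^+ 2)^-1 <=
  8 / n.+2%:R ^+ 2 :> R.
Proof.
have -> : 8 / n.+2%:R ^+ 2 = 2 / n.+2%:R ^+ 2 * (2 + 2) :> R by ring.
have := lerD (sum_inv_sqr n.+1) (sum_inv_sqr n.+1).
rewrite [X in _ + X](reindex_inj rev_ord_inj)/= -big_split/= => h.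
rewrite (le_trans _ (ler_wpM2l _ h)) ?divr_ge0 ?exprn_ge0//.
rewrite mulr_sumr; apply: ler_sum => i _; rewrite subSS.
set x : R := i.+1%:R; set y : R := (n - i).+1%:R.
have x0 : 0 < x by rewrite ltr0n.
have y0 : 0 < y by rewrite ltr0n.
have -> : n.+2%:R = x + y.
  by rewrite /x /y -natrD; congr (_%:R); have := ltn_ord i; lia.
have xy0 : 0 < x + y by rewrite addr_gt0.
(* With [x + y = n + 2], this is [(x + y)^2 <= 2 (x^2 + y^2)] up to a
   factor. *)
rewrite -subr_ge0 [leRHS](_ : _ = (x - y) ^+ 2 / (x * y * (x + y)) ^+ 2).
  by rewrite divr_ge0 ?sqr_ge0.
by field; rewrite !gt_eqF.
Qed.

(** Giving up the fraction [1 / (n + 2)] of the width multiplies an n-th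
    power by at most the number e. *)
Lemma exp_step (n : nat) : (n.+2%:R / n.+1%:R) ^+ n <= expR 1 :> R.
Proof.
have n1 : 0 < n.+1%:R :> R by rewrite ltr0n.
apply: (@le_trans _ _ (expR (n.+1%:R^-1) ^+ n)).
  rewrite lerXn2r ?nnegrE ?expR_ge0 ?divr_ge0//.
  apply: le_trans (expR_ge1Dx _).
  by rewrite -natr1 mulrDl divff ?gt_eqF// mul1r.
rewrite -expRM_natl ler_expR ler_pdivrMr// mul1r ler_nat; lia.
Qed.

Variable a0 : int -> C.

(** The recursion uses all previous coefficients: the list [pseq n] holds
    those of order at most [n]. *)
Definition pstep (s : seq (int -> C)) (k : int) : C :=
  (size s)%:R^-1 * \sum_(i < size s)
    Bil (nth (fun=> 0) s i) (nth (fun=> 0) s ((size s).-1 - i)) k.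

Fixpoint pseq (n : nat) : seq (int -> C) :=
  if n is n'.+1 then rcons (pseq n') (pstep (pseq n')) else [:: a0].

Definition pc (n : nat) : int -> C := nth (fun=> 0) (pseq n) n.

Lemma size_pseq n : size (pseq n) = n.+1.
Proof. by elim: n => //= n IH; rewrite size_rcons IH. Qed.

Lemma nth_pseq n i : (i <= n)%N -> nth (fun=> 0) (pseq n) i = pc i.
Proof.
elim: n => [|n IH]; first by rewrite leqn0 => /eqP ->.
rewrite leq_eqVlt => /orP[/eqP -> //|]; rewrite ltnS => h /=.
by rewrite nth_rcons size_pseq ltnS h IH.
Qed.

Lemma pc0 : pc 0 = a0. Proof. by []. Qed.

Lemma pcS n k :
  pc n.+1 k = n.+1%:R^-1 * \sum_(i < n.+1) Bil (pc i) (pc (n - i)) k.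
Proof.
rewrite {1}/pc /= nth_rcons size_pseq ltnn eqxx /pstep size_pseq /=.
congr (_ * _); apply: eq_bigr => i _.
by rewrite !nth_pseq// ?leq_subr// -ltnS.
Qed.

Lemma nrm_sum (I : Type) (s : seq I) (P : pred I) (F : I -> int -> C) (M : I -> R) d :
  (forall i, P i -> (nrm d (F i) <= (M i)%:E)%E) ->
  (nrm d (fun k => (\sum_(i <- s | P i) F i k)%R) <= (\sum_(i <- s | P i) M i)%:E)%E.
Proof.
move=> h; elim: s => [|i s IH].
  under [X in nrm _ X]eq_fun do rewrite big_nil.
  rewrite big_nil (_ : nrm _ _ = 0%E)//.
  by rewrite /nrm /esumr esum1// => k _; rewrite normc0 mulr0.
under [X in nrm _ X]eq_fun do rewrite big_cons.
rewrite big_cons; case: ifP => // Pi.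
apply: le_trans (nrmD _ _ _) _; rewrite EFinD leeD//; exact: h.
Qed.

(** The product of the four losses of one step of the recursion: 9 for the
    bilinear estimate, 2 for [natr_succ2_le], 8 for [sum_inv_sqr_conv] and e
    for [exp_step]. *)
Definition Kps : R := 144 * expR 1.

Variable N : R.
Hypotheses (N0 : 0 < N) (a0N : (nrm 1 a0 <= N%:E)%E).

(** Cauchy-Kovalevsky estimate: each recursion step gives up the fraction
    [1 / (n + 2)] of the distance [1 - d] to the full width. The factor
    [1 / e] of the bilinear estimate is then of order [n / (1 - d)], and the
    factor [n] is cancelled by the one that comes from the differentiation
    in time. *)
Lemma pc_bound n d : 0 <= d -> d < 1 ->
  (nrm d (pc n) <= (N * (Kps * N / (1 - d)) ^+ n / n.+1%:R ^+ 2)%:E)%E.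
Proof.
elim/ltn_ind: n d => -[_|n IH] d d0 d1.
  rewrite pc0 expr0 expr1n mulr1 divr1.
  by apply: le_trans a0N; apply: le_nrm; exact: ltW.
set e : R := (1 - d) / n.+2%:R.
have d1' : 0 < 1 - d by rewrite subr_gt0.
have n2 : 0 < n.+2%:R :> R by rewrite ltr0n.
have n1 : 0 < n.+1%:R :> R by rewrite ltr0n.
have e0 : 0 < e by rewrite divr_gt0.
have e1 : e <= 1.
  rewrite ler_pdivrMr// mul1r; apply: le_trans (_ : 1 <= _); first by lra.
  by rewrite (ler_nat R 1).
have de : 1 - (d + e) = (1 - d) * (n.+1%:R / n.+2%:R).
  have -> : n.+1%:R = n.+2%:R - 1 :> R by rewrite -[n.+2%:R]natr1 addrK.
  by rewrite /e; field; rewrite gt_eqF.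
have de1 : d + e < 1 by rewrite -subr_gt0 de mulr_gt0// divr_gt0.
set q := Kps * N / (1 - (d + e)).
have qE : q = Kps * N / (1 - d) * (n.+2%:R / n.+1%:R).
  by rewrite /q de; field; rewrite !gt_eqF.
have de0 : 0 <= d + e by rewrite addr_ge0// ltW.
have K0 : 0 < Kps * N by rewrite !mulr_gt0// expR_gt0.
pose M (i : 'I_n.+1) := 9 / e * (N ^+ 2 * q ^+ n) *
  ((i.+1%:R ^+ 2)^-1 * ((n - i).+1%:R ^+ 2)^-1).
have step (i : 'I_n.+1) : (nrm d (Bil (pc i) (pc (n - i))) <= (M i)%:E)%E.
  have i1 : (i < n.+1)%N by [].
  have i2 : (n - i < n.+1)%N by rewrite ltnS leq_subr.
  have := Bil_bound d0 e0 e1 (IH _ i1 _ de0 de1) (IH _ i2 _ de0 de1).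
  rewrite -/q => /le_trans; apply; rewrite lee_fin le_eqVlt; apply/orP; left.
  apply/eqP; rewrite /M -[in q ^+ n](subnKC (i1 : (i <= n)%N)) exprD; ring.
have -> : pc n.+1 = fun k => n.+1%:R^-1 * \sum_(i < n.+1) Bil (pc i) (pc (n - i)) k.
  by apply/funext => k; rewrite pcS.
rewrite nrmZ normcV normc_natr.
apply: (@le_trans _ _ (n.+1%:R^-1%:E * (\sum_(i < n.+1) M i)%:E)%E).
  by rewrite lee_pmul ?nrm_ge0// ?lee_fin ?invr_ge0//; exact: nrm_sum.
rewrite -EFinM lee_fin -mulr_sumr.
have Q0 : 0 <= Kps * N / (1 - d) by rewrite divr_ge0 ?ltW.
have qn : q ^+ n <= (Kps * N / (1 - d)) ^+ n * expR 1.
  by rewrite qE exprMn ler_wpM2l ?exprn_ge0// exp_step.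
have c1 : n.+1%:R^-1 * (9 / e) <= 18 / (1 - d).
  rewrite /e [leLHS](_ : _ = 9 / (1 - d) * (n.+2%:R / n.+1%:R)); last first.
    by field; rewrite !gt_eqF.
  rewrite [leRHS](_ : _ = 9 / (1 - d) * 2); last by ring.
  apply: ler_wpM2l; first by rewrite divr_ge0// ltW.
  by rewrite ler_pdivrMr// natr_succ2_le.
have q0 : 0 <= q by rewrite qE mulr_ge0// divr_ge0// ltW.
have c0 : 0 <= n.+1%:R^-1 * (9 / e) by rewrite mulr_ge0 ?invr_ge0// divr_ge0// ltW.
apply: (@le_trans _ _ (18 / (1 - d) * (N ^+ 2 *
    ((Kps * N / (1 - d)) ^+ n * expR 1)) * (8 / n.+2%:R ^+ 2))).
  rewrite [leLHS](_ : _ = n.+1%:R^-1 * (9 / e) * (N ^+ 2 * q ^+ n) *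
    \sum_(i < n.+1) (i.+1%:R ^+ 2)^-1 * ((n - i).+1%:R ^+ 2)^-1); last by ring.
  have N2 : 0 <= N ^+ 2 by rewrite sqr_ge0.
  have qn0 : 0 <= q ^+ n by rewrite exprn_ge0.
  apply: ler_pM (sum_inv_sqr_conv n).
  - by apply: mulr_ge0 => //; exact: mulr_ge0.
  - by apply: sumr_ge0 => i _; rewrite mulr_ge0 ?invr_ge0 ?exprn_ge0.
  - by apply: ler_pM => //; [exact: mulr_ge0|exact: ler_wpM2l].
rewrite [_ ^+ n.+1]exprSr le_eqVlt; apply/orP; left; apply/eqP.
move: ((Kps * N / (1 - d)) ^+ n) => Qn; rewrite /Kps.
move: (expR 1) (n.+2%:R) n2 => E m m0.
by field; rewrite !gt_eqF.
Qed.

End PowerSeriesCoefficients.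

(** * Geometric series and Taylor remainders of powers *)
Section SeriesInTime.
Context {R : realType}.
Local Notation C := R[i].

Lemma esumr_geometric (r : R) : 0 <= r -> r < 1 ->
  (esumr (fun n : nat => (r ^+ n)%R) <= ((1 - r)^-1)%:E)%E.
Proof.
move=> r0 r1; apply: esumr_le => s us; rewrite lee_fin.
have r1' : 0 < 1 - r by rewrite subr_gt0.
pose m := (\max_(i <- s) i).+1.
apply: (@le_trans _ _ (\sum_(i <- iota 0 m) r ^+ i)).
  rewrite [leRHS](bigID (mem s))/= -[X in _ <= X + _]big_filter.
  rewrite (perm_big [seq x <- iota 0 m | x \in s]).
    by rewrite lerDl sumr_ge0// => i _; rewrite exprn_ge0.
  apply: uniq_perm; rewrite ?filter_uniq ?iota_uniq// => x.
  rewrite mem_filter mem_iota/= add0n; case xs: (x \in s) => //=.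
  by rewrite ltnS (@leq_bigmax_seq _ s xpredT id).
rewrite -[m]subn0 -/(index_iota 0 m) big_mkord.
rewrite -[leRHS]mul1r ler_pdivlMr// mulrC.
have := subrX1 r m; have := exprn_ge0 m r0; lra.
Qed.

(** The shift is an injection of the indices, along which the fibres have at
    most one element. *)
Lemma csum_shift (f : nat -> C) : asumm f -> f 0%N = 0 ->
  csum f = csum (fun n => f n.+1).
Proof.
move=> ff f0; have fS : asumm (fun n => f n.+1).
  apply: le_lt_trans ff; apply: esumr_le => s us.
  rewrite -(big_map succn xpredT (fun n => normc (f n))).
  apply: (@esumr_seq R _ (fun n => normc (f n))) => [n|]; first exact: normc_ge0.
  by rewrite map_inj_uniq// => x y [].
rewrite (csum_fibers succn fS); apply: eq_csum => -[|n].
  by rewrite f0 (@csum1 _ _ _ 0%N).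
rewrite (@csum1 _ _ _ n) ?eqxx// => k /negbTE kn.
by rewrite eqSS kn.
Qed.

(** Taylor remainders of powers, uniformly in the exponent: enlarging the
    radius by [eta] bounds one derivative by [1 / eta]. *)
Lemma pow_diff (t h : C) (eta : R) n : 0 <= eta -> normc h <= eta ->
  normc ((t + h) ^+ n - t ^+ n) * eta <= normc h * (normc t + eta) ^+ n.
Proof.
move=> eta0 hh; have rho0 : 0 <= normc t + eta by rewrite addr_ge0 ?normc_ge0.
elim: n => [|n IH].
  by rewrite !expr0 subrr normc0 mul0r mulr1 normc_ge0.
rewrite [X in normc X](_ : _ = t * ((t + h) ^+ n - t ^+ n) + h * (t + h) ^+ n).
  apply: (@le_trans _ _ ((normc t * normc ((t + h) ^+ n - t ^+ n) +
                         normc h * (normc t + eta) ^+ n) * eta)).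
    rewrite ler_wpM2r// (le_trans (ler_normcD _ _))// !normcM lerD2l normcX.
    rewrite ler_wpM2l ?normc_ge0// lerXn2r ?nnegrE ?normc_ge0//.
    by rewrite (le_trans (ler_normcD _ _))// lerD2l.
  have := ler_wpM2l (normc_ge0 t) IH; rewrite exprS => IH'.
  rewrite mulrDl; nra.
by rewrite !exprS; ring.
Qed.

Lemma pow_remainder (t h : C) (eta : R) n : 0 <= eta -> normc h <= eta ->
  normc ((t + h) ^+ n - t ^+ n - h * (n%:R * t ^+ n.-1)) * eta ^+ 2 <=
  normc h ^+ 2 * (normc t + eta) ^+ n.
Proof.
move=> eta0 hh; have rho0 : 0 <= normc t + eta by rewrite addr_ge0 ?normc_ge0.
elim: n => [|n IH].
  rewrite !expr0 subrr mul0r mulr0 subr0 normc0 mul0r mulr1.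
  by rewrite exprn_ge0 ?normc_ge0.
rewrite [X in normc X](_ : _ =
    t * ((t + h) ^+ n - t ^+ n - h * (n%:R * t ^+ n.-1)) +
    h * ((t + h) ^+ n - t ^+ n)).
  apply: (@le_trans _ _ ((normc t * normc ((t + h) ^+ n - t ^+ n -
      h * (n%:R * t ^+ n.-1)) + normc h * normc ((t + h) ^+ n - t ^+ n)) *
      eta ^+ 2)).
    by rewrite ler_wpM2r ?exprn_ge0// (le_trans (ler_normcD _ _))// !normcM.
  have h1 := ler_wpM2l (normc_ge0 t) IH.
  have h2 := ler_wpM2l (normc_ge0 h) (ler_wpM2r eta0 (pow_diff t n eta0 hh)).
  rewrite [leLHS](_ : _ = normc t * (normc ((t + h) ^+ n - t ^+ n -
      h * (n%:R * t ^+ n.-1)) * eta ^+ 2) +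
    normc h * (normc ((t + h) ^+ n - t ^+ n) * eta * eta)); last by ring.
  rewrite [leRHS](_ : _ = normc t * (normc h ^+ 2 * (normc t + eta) ^+ n) +
    normc h * (normc h * (normc t + eta) ^+ n * eta)); first exact: lerD.
  by rewrite [_ ^+ n.+1]exprS; ring.
case: n {IH} => [|n]; first by rewrite /= !expr1 !expr0; ring.
by rewrite /= -[n.+2%:R]natr1 !exprS; ring.
Qed.

Lemma pow_derivative (t : C) (eta : R) n : 0 <= eta ->
  normc (n%:R * t ^+ n.-1) * eta <= (normc t + eta) ^+ n.
Proof.
move=> eta0; have rho0 : 0 <= normc t + eta by rewrite addr_ge0 ?normc_ge0.
elim: n => [|n IH]; first by rewrite mul0r normc0 mul0r exprn_ge0.
rewrite /= normcM normc_natr normcX -natr1 mulrDl mul1r mulrDl exprSr mulrDr.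
have tn : normc t ^+ n <= (normc t + eta) ^+ n.
  by rewrite lerXn2r ?nnegrE ?normc_ge0// lerDl.
apply: lerD; last by rewrite ler_wpM2r.
case: n IH {tn} => [|n] IH; first by rewrite !mul0r mulr_ge0 ?normc_ge0.
rewrite exprSr; rewrite /= normcM normc_natr normcX in IH.
rewrite mulrA mulrAC; apply: ler_wpM2r => //; exact: normc_ge0.
Qed.

End SeriesInTime.

(** * The power series solution *)
Section PowerSeriesSolution.
Context {R : realType}.
Local Notation C := R[i].
Variables (a0 : int -> C) (N : R).
Hypotheses (N0 : 0 < N) (a0N : (nrm 1 a0 <= N%:E)%E).
Implicit Types (d rho : R) (t h : C).

Definition sol t (k : int) : C := csum (fun n => t ^+ n * pc a0 n k).

Lemma KN_gt0 : 0 < Kps * N.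
Proof. by rewrite !mulr_gt0// expR_gt0. Qed.

Lemma pc_geometric n d : 0 <= d -> d < 1 ->
  (nrm d (pc a0 n) <= (N * (Kps * N / (1 - d)) ^+ n)%:E)%E.
Proof.
move=> d0 d1; apply: le_trans (pc_bound N0 a0N n d0 d1) _.
rewrite lee_fin ler_piMr//.
  rewrite mulr_ge0 ?(ltW N0)// exprn_ge0// divr_ge0 ?subr_ge0 ?ltW//.
  exact: KN_gt0.
by rewrite invf_le1 ?exprn_gt0 ?ltr0n// exprn_ege1// ler1n.
Qed.

Lemma ratio_lt1 d rho : d < 1 -> rho * (Kps * N) < 1 - d ->
  rho * (Kps * N / (1 - d)) < 1.
Proof. by move=> d1 h; rewrite mulrA ltr_pdivrMr ?mul1r// subr_gt0. Qed.

Section Superposition.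
Variables (d rho c : R) (g : nat -> C).
Hypotheses (d0 : 0 <= d) (d1 : d < 1) (rho0 : 0 <= rho) (c0 : 0 <= c).
Hypothesis hrho : rho * (Kps * N) < 1 - d.
Hypothesis hg : forall n, normc (g n) <= c * rho ^+ n.

Let q := Kps * N / (1 - d).

Let q0 : 0 <= q. Proof. by rewrite divr_ge0 ?subr_ge0 ?ltW ?KN_gt0. Qed.

Let rq0 : 0 <= rho * q. Proof. exact: mulr_ge0. Qed.

(** Any time factors [g n] of size [rho ^ n] can be put in front of the
    Taylor coefficients, as long as [rho] is inside the disk of convergence.
    The powers of [t], their derivatives and their Taylor remainders are all
    of this kind. *)
Lemma superposition_pair :
  (esumr (fun p : nat * int => (wt d p.2 * normc (g p.1 * pc a0 p.1 p.2))%R) <=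
   (c * (N / (1 - rho * q)))%:E)%E.
Proof.
have wn0 n k : 0 <= wt d k * normc (g n * pc a0 n k).
  by rewrite mulr_ge0 ?wt_ge0 ?normc_ge0.
rewrite (@esumr_pair _ _ _ (fun n k => wt d k * normc (g n * pc a0 n k)))//.
apply: (@le_trans _ _ (esumr (fun n => c * N * (rho * q) ^+ n))).
  apply: le_esum => n _.
  have -> : esumr (fun k => wt d k * normc (g n * pc a0 n k)) =
      nrm d (fun k => g n * pc a0 n k) by [].
  rewrite nrmZ [leRHS](_ : _ = ((c * rho ^+ n)%:E * (N * q ^+ n)%:E)%E).
    by rewrite lee_pmul ?lee_fin ?normc_ge0 ?nrm_ge0// pc_geometric.
  by rewrite -EFinM exprMn; congr EFin; ring.
rewrite esumrZ ?mulr_ge0 ?(ltW N0)//; last by move=> n; rewrite exprn_ge0.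
rewrite mulrA [leRHS]EFinM lee_pmul ?lee_fin ?mulr_ge0 ?(ltW N0)//.
  by apply: esumr_ge0 => n; rewrite exprn_ge0.
by rewrite esumr_geometric// ratio_lt1.
Qed.

Lemma superposition_asumm k : asumm (fun n => g n * pc a0 n k).
Proof.
apply: (@asumm_le _ _ _ (fun n => c * (wt d k)^-1 * N * (rho * q) ^+ n)); last first.
  apply: summZ => [|n|]; rewrite ?exprn_ge0//.
    by rewrite !mulr_ge0 ?invr_ge0 ?wt_ge0 ?(ltW N0).
  by apply: le_lt_trans (esumr_geometric rq0 (ratio_lt1 d1 hrho)) (ltry _).
move=> n; rewrite normcM exprMn.
have h : wt d k * normc (pc a0 n k) <= N * q ^+ n.
  by rewrite -lee_fin (le_trans (nrm_term _ _ _))// pc_geometric.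
rewrite [leRHS](_ : _ = c * rho ^+ n * ((wt d k)^-1 * (N * q ^+ n))); last by ring.
by apply: ler_pM; rewrite ?normc_ge0// ler_pdivlMl ?wt_gt0.
Qed.

Lemma superposition_bound :
  (nrm d (fun k => csum (fun n => g n * pc a0 n k)%R) <=
   (c * (N / (1 - rho * q)))%:E)%E.
Proof.
apply: le_trans superposition_pair.
have wn0 n k : 0 <= wt d k * normc (g n * pc a0 n k).
  by rewrite mulr_ge0 ?wt_ge0 ?normc_ge0.
rewrite (@esumr_pair _ _ _ (fun n k => wt d k * normc (g n * pc a0 n k)))//.
rewrite /esumr esum_swap; last by move=> *; rewrite lee_fin.
apply: le_esum => k _; rewrite -/(esumr _).
rewrite esumrZ ?wt_ge0//; last by move=> *; exact: normc_ge0.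
rewrite EFinM lee_pmul ?lee_fin ?wt_ge0 ?normc_ge0//.
by rewrite csum_le_esumr// superposition_asumm.
Qed.

End Superposition.

Lemma sol_bound d t : 0 <= d -> d < 1 -> normc t * (Kps * N) < 1 - d ->
  (nrm d (sol t) < +oo)%E.
Proof.
move=> d0 d1 ht; apply: (le_lt_trans _ (ltry _)).
apply: (@superposition_bound d (normc t) 1 _ d0 d1 (normc_ge0 t) _ ht) => // n.
by rewrite normcX mul1r.
Qed.

Lemma sol0 k : sol 0 k = a0 k.
Proof.
rewrite /sol (@csum1 _ _ _ 0%N) ?expr0 ?mul1r// => n n0.
by rewrite expr0n (negbTE n0) mul0r.
Qed.

(** An open disk leaves room for a slightly larger radius. *)
Lemma room (x y : R) (M : R) : 0 < M -> x * M < y ->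
  exists2 eta, 0 < eta & (x + eta) * M < y.
Proof.
move=> M0 h; exists ((y - x * M) / (2 * M)).
  by rewrite divr_gt0 ?subr_gt0// mulr_gt0.
rewrite mulrDl [X in _ + X](_ : _ = (y - x * M) / 2); first by lra.
by field; rewrite gt_eqF.
Qed.

Lemma asumm_sol d t k : 0 <= d -> d < 1 -> normc t * (Kps * N) < 1 - d ->
  asumm (fun n => t ^+ n * pc a0 n k).
Proof.
move=> d0 d1 ht.
apply: (@superposition_asumm d (normc t) 1 _ d0 d1 (normc_ge0 t) _ ht) => // n.
by rewrite normcX mul1r.
Qed.

(** The recursion for the coefficients is the equation: it is the Cauchy
    product of the two time series inside the bilinear term. *)
Lemma sol_equation d t k : 0 < d -> d < 1 -> normc t * (Kps * N) < 1 - d ->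
  csum (fun n => n%:R * t ^+ n.-1 * pc a0 n k) = Bil (sol t) (sol t) k.
Proof.
move=> d0 d1 ht.
have [eta eta0 hrho] := room KN_gt0 ht; set rho := normc t + eta in hrho.
have rho0 : 0 <= rho by rewrite addr_ge0 ?normc_ge0 ?ltW.
have dsum : asumm (fun n => n%:R * t ^+ n.-1 * pc a0 n k).
  apply: (@superposition_asumm d rho eta^-1 _ (ltW d0) d1 rho0 _ hrho).
    by rewrite invr_ge0 ltW.
  move=> n; rewrite ler_pdivlMl// mulrC; exact/pow_derivative/ltW.
rewrite csum_shift//; last by rewrite !mul0r.
pose q := Kps * N / (1 - d); pose r := normc t * q.
have q0 : 0 <= q by rewrite divr_ge0 ?subr_ge0 ?ltW ?KN_gt0.
have r0 : 0 <= r by rewrite mulr_ge0 ?normc_ge0.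
have r1 : r < 1 by exact: ratio_lt1.
pose c := 9 / d * (N * N).
have c0 : 0 <= c by rewrite mulr_ge0 ?divr_ge0 ?mulr_ge0 ?ltW.
pose G (p : nat * nat) (j : int) := t ^+ p.1 * t ^+ p.2 *
  (bker j (k - j) * pc a0 p.1 j * pc a0 p.2 (k - j)).
have row (p : nat * nat) :
    (esumr (fun j => normc (G p j)) <= (c * (r ^+ p.1 * r ^+ p.2))%:E)%E.
  under eq_esumr do rewrite normcM.
  rewrite esumrZ ?normc_ge0//; last by move=> *; exact: normc_ge0.
  have hb n : (nrm (0 + d) (pc a0 n) <= (N * q ^+ n)%:E)%E.
    by rewrite add0r pc_geometric// ltW.
  have := Bil_row_bound (lexx 0) d0 (ltW d1) (hb p.1) (hb p.2) k => hrow.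
  apply: (@le_trans _ _ ((normc (t ^+ p.1 * t ^+ p.2))%:E *
     (9 / d * (N * q ^+ p.1 * (N * q ^+ p.2)))%:E)%E).
    rewrite lee_pmul ?lee_fin ?normc_ge0//.
    by apply: esumr_ge0 => *; exact: normc_ge0.
  rewrite -EFinM lee_fin normcM !normcX /r !exprMn /c.
  by rewrite le_eqVlt; apply/orP; left; apply/eqP; ring.
have geo : summ (fun n => r ^+ n).
  exact: le_lt_trans (esumr_geometric r0 r1) (ltry _).
have tot : summ (fun p : nat * nat => c * (r ^+ p.1 * r ^+ p.2)).
  apply: summZ => // [p|]; first by rewrite mulr_ge0 ?exprn_ge0.
  by apply: (@summ_prod _ _ _ (fun n => r ^+ n) (fun n => r ^+ n)) => // n;
     rewrite exprn_ge0.
have Gsum : asumm (fun x : (nat * nat) * int => G x.1 x.2).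
  rewrite /asumm /summ (@esumr_pair _ _ _ (fun p j => normc (G p j))).
    by apply: le_lt_trans tot; apply: le_esum => p _; exact: row.
  by move=> *; exact: normc_ge0.
have Grow p : asumm (G p) by exact: le_lt_trans (row p) (ltry _).
have BilE n m : t ^+ n * t ^+ m * Bil (pc a0 n) (pc a0 m) k = csum (G (n, m)).
  rewrite /Bil -csumZ//; apply: (@Bil_rowE _ d) => //; first exact: ltW.
    by apply: le_lt_trans (pc_geometric n (ltW d0) d1) (ltry _).
  by apply: le_lt_trans (pc_geometric m (ltW d0) d1) (ltry _).
transitivity (csum (fun n => \sum_(i < n.+1) csum (G (val i, (n - val i)%N)))).
  apply: eq_csum => n; rewrite /= pcS mulrACA divff ?pnatr_eq0// mul1r mulr_sumr.
  apply: eq_bigr => i _; rewrite -BilE -exprD subnKC//; exact: (ltn_ord i).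
rewrite -(@csum_cauchy _ (fun i l => csum (G (i, l)))); last first.
  apply: asumm_le tot => p; apply: csum_le; rewrite -surjective_pairing.
  exact: row.
rewrite (eq_csum (g := fun p => csum (G p))); last by case.
rewrite csum_swap//; apply: eq_csum => j.
rewrite /sol -mulrA csumM; [|exact: (asumm_sol _ (ltW d0) d1)..].
rewrite -csumZ.
  by apply: eq_csum => -[n m]; rewrite /G /=; ring.
have h i := asumm_sol i (ltW d0) d1 ht.
rewrite /asumm; under [X in summ X]eq_fun do rewrite normcM.
by apply: (@summ_prod _ _ _ (fun n => normc (t ^+ n * pc a0 n j))
   (fun n => normc (t ^+ n * pc a0 n (k - j)))); rewrite ?[summ _]h// => *;
   exact: normc_ge0.
Qed.

(** The Taylor remainder of [t ^ n] is at most
    [|h|^2 (|t| + eta)^n / eta^2], and for some [eta] the radius [|t| + eta]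
    is still inside the disk of convergence. *)
Lemma sol_derivative d t : 0 < d -> d < 1 -> normc t * (Kps * N) < 1 - d ->
  exists2 eta, 0 < eta & exists2 M, 0 <= M & forall h, normc h <= eta ->
    (nrm d (fun k => (sol (t + h) k - sol t k - h * Bil (sol t) (sol t) k)%R) <=
     (M * normc h ^+ 2)%:E)%E.
Proof.
move=> d0 d1 ht.
have [eta eta0 hrho] := room KN_gt0 ht; set rho := normc t + eta in hrho.
have rho0 : 0 <= rho by rewrite addr_ge0 ?normc_ge0 ?ltW.
have d0' := ltW d0; have eta0' := ltW eta0.
exists eta => //.
exists ((eta ^+ 2)^-1 * (N / (1 - rho * (Kps * N / (1 - d))))).
  rewrite mulr_ge0 ?invr_ge0 ?sqr_ge0// divr_ge0 ?(ltW N0)// subr_ge0 ltW//.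
  exact: ratio_lt1.
move=> h hh.
have hth : normc (t + h) * (Kps * N) < 1 - d.
  apply: le_lt_trans hrho; rewrite ler_wpM2r ?(ltW KN_gt0)//.
  by rewrite (le_trans (ler_normcD _ _))// lerD2l.
have -> : (fun k => sol (t + h) k - sol t k - h * Bil (sol t) (sol t) k) =
  fun k => csum (fun n => ((t + h) ^+ n - t ^+ n - h * (n%:R * t ^+ n.-1)) * pc a0 n k).
  apply/funext => k; rewrite -(sol_equation k d0 d1 ht).
  have s1 := asumm_sol k d0' d1 hth.
  have s2 := asumm_sol k d0' d1 ht.
  have s3 : asumm (fun n => n%:R * t ^+ n.-1 * pc a0 n k).
    apply: (@superposition_asumm d rho eta^-1 _ d0' d1 rho0 _ hrho).
      by rewrite invr_ge0.
    move=> n; rewrite ler_pdivlMl// mulrC; exact: pow_derivative.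
  rewrite -csumZ// -csumB// -csumB//; last 2 first.
  - exact: asummB.
  - exact: asummZ.
  by apply: eq_csum => n; ring.
rewrite [leRHS](_ : _ = ((normc h ^+ 2 / eta ^+ 2) *
    (N / (1 - rho * (Kps * N / (1 - d)))))%:E); last by congr EFin; ring.
apply: superposition_bound => //.
  by rewrite divr_ge0 ?sqr_ge0.
move=> n; rewrite mulrAC ler_pdivlMr ?exprn_gt0//; exact: pow_remainder.
Qed.

End PowerSeriesSolution.

(** * Mean value inequalities *)
Section MeanValue.
Context {R : realType}.
Local Notation C := R[i].

(** First-order expansion with an explicit epsilon: the form in which
    derivatives are established and used for complex-valued functions. *)
Definition expands (f : R -> R) (x l : R) : Prop :=
  forall eps, 0 < eps -> exists2 eta, 0 < eta & forall h, `|h| <= eta ->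
    `|f (x + h) - f x - h * l| <= eps * `|h|.

Lemma expands_is_derive (f : R -> R) (x l : R) :
  expands f x l -> is_derive x 1 f l.
Proof.
move=> fl.
have c : h^-1 *: ((f \o shift x) (h *: 1) - f x) @[h --> 0^'] --> l.
  apply/cvgrPdist_le => eps eps0; have [eta eta0 H] := fl _ eps0.
  near=> h.
  have h0 : h != 0 by near: h; exact: nbhs_dnbhs_neq.
  have hh : `|h| <= eta.
    near: h; apply: nbhs_dnbhs.
    by have := @nbhs0_le R R eta eta0.
  have := H h hh; rewrite /= -ler_pdivrMr ?normr_gt0// -normfV -normrM.
  rewrite /GRing.scale/= mulr1 distrC [h + x]addrC.
  suff -> : (f (x + h) - f x - h * l) / h = h^-1 * (f (x + h) - f x) - l by [].
  by field.
split; first by apply/cvg_ex; exists l.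
by apply/cvg_lim.
Unshelve. all: by end_near. Qed.

Lemma is_derive_monomial (s c x : R) n :
  is_derive x 1 (fun y : R => c * (y - s) ^+ n.+1) (c * (n.+1%:R * (x - s) ^+ n)).
Proof.
have -> : (fun y => c * (y - s) ^+ n.+1) = cst c * ((id - cst s) ^+ n.+1).
  apply/funext => y; rewrite /= fctE; congr (_ * _).
  by rewrite exprfctE.
apply: is_derive_eq.
by rewrite scaler0 addr0 subr0 /= /GRing.scale/= mulr1.
Qed.

(** The mean value theorem for [f y - K (y - s)^(n+1) / (n + 1)], whose
    derivative is nonpositive. *)
Lemma increment_le (f df : R -> R) (s x K : R) n : 0 <= x ->
  (forall y, 0 <= y <= x -> expands f (s + y) (df y)) ->
  (forall y, 0 <= y <= x -> df y <= K * y ^+ n) ->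
  f (s + x) - f s <= K * x ^+ n.+1 / n.+1%:R.
Proof.
move=> x0 hf hdf.
pose c := K / n.+1%:R.
pose g y := f y - c * (y - s) ^+ n.+1.
have dg y : y \in `[s, s + x] ->
    is_derive y 1 g (df (y - s) - c * (n.+1%:R * (y - s) ^+ n)).
  rewrite in_itv/= => /andP[y1 y2].
  have h : 0 <= y - s <= x by rewrite subr_ge0 y1/= lerBlDl.
  have := expands_is_derive (hf _ h); rewrite subrKC => h1.
  exact: (@is_deriveB _ _ _ _ _ _ _ _ _ h1 (is_derive_monomial s c y n)).
have gc : {within `[s, s + x], continuous g}.
  by apply: derivable_within_continuous => y /dg [].
have sx : s <= s + x by rewrite lerDl.
have [z zi] := MVT_segment sx (fun y yi => dg y (subset_itv_oo_cc yi)) gc.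
rewrite [s + x - s]addrAC subrr add0r => e.
move: zi; rewrite in_itv/= => /andP[z1 z2].
have hz : 0 <= z - s <= x by rewrite subr_ge0 z1/= lerBlDl.
have : (df (z - s) - c * (n.+1%:R * (z - s) ^+ n)) * x <= 0.
  rewrite mulr_le0_ge0// subr_le0 (le_trans (hdf _ hz))//.
  by rewrite /c mulrA divfK ?pnatr_eq0.
rewrite -e /g subrr expr0n/= mulr0 subr0 [s + x - s]addrAC subrr add0r.
have -> : K * x ^+ n.+1 / n.+1%:R = c * x ^+ n.+1 by rewrite /c mulrAC.
move: (c * x ^+ n.+1) => Y; lra.
Qed.

(** Mean value inequality in a weighted l^1 space, for curves that are only
    known to be differentiable coefficient by coefficient: a finite part of
    the norm is, after rotation of the coefficients, the value of a linear
    functional, and a real function results. *)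
Lemma nrm_increment_le d (Z V : R -> int -> C) (s x K : R) n : 0 <= x ->
  (forall k, Z s k = 0) ->
  (forall y k, 0 <= y <= x -> forall eps, 0 < eps ->
     exists2 eta, 0 < eta & forall h, `|h| <= eta ->
     normc (Z (s + y + h) k - Z (s + y) k - h%:C * V y k) <= eps * `|h|) ->
  (forall y, 0 <= y <= x -> (nrm d (V y) <= (K * y ^+ n)%:E)%E) ->
  (nrm d (Z (s + x)%R) <= (K * x ^+ n.+1 / n.+1%:R)%:E)%E.
Proof.
move=> x0 Z0 dZ VK; apply: esumr_le => F uF; rewrite lee_fin.
have [th th1 thE] : exists2 th : int -> C, (forall k, normc (th k) = 1) &
    forall k, Re (th k * Z (s + x) k) = normc (Z (s + x) k).
  have h k := normc_rotate (Z (s + x) k).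
  exists (fun k => s2val (cid2 (h k))) => k; by case: (cid2 (h k)).
pose f y := \sum_(k <- F) wt d k * Re (th k * Z y k).
have fs : f s = 0 by apply: big1 => k _; rewrite Z0 mulr0 mulr0.
have -> : \sum_(k <- F) wt d k * normc (Z (s + x) k) = f (s + x) - f s.
  by rewrite fs subr0; apply: eq_bigr => k _; rewrite thE.
pose df y := \sum_(k <- F) wt d k * Re (th k * V y k).
apply: (@increment_le f df) => // y hy.
- move=> eps eps0.
  pose S := 1 + \sum_(k <- F) wt d k.
  have S0 : 0 < S by rewrite ltr_pwDl// sumr_ge0// => k _; exact: wt_ge0.
  have [eta eta0 H] : exists2 eta, 0 < eta & forall k, k \in F ->
      forall h, `|h| <= eta ->
      normc (Z (s + y + h) k - Z (s + y) k - h%:C * V y k) <= eps / S * `|h|.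
    elim: F {uF f fs df S S0} (eps / S) (divr_gt0 eps0 S0) => [|k F IH] e e0.
      by exists 1.
    have [eta eta0 H] := IH _ e0; have [eta' eta0' H'] := dZ y k hy _ e0.
    exists (Num.min eta eta') => [|j]; first by rewrite lt_min eta0.
    by rewrite inE => /orP[/eqP ->|jF] h; rewrite le_min => /andP[h1 h2]; [exact: H'|exact: H].
  exists eta => // h hh.
  have -> : f (s + y + h) - f (s + y) - h * df y = \sum_(k <- F) wt d k *
      Re (th k * (Z (s + y + h) k - Z (s + y) k - h%:C * V y k)).
    rewrite /f /df mulr_sumr -!sumrB; apply: eq_bigr => k _.
    rewrite [th k * (_ - _)](_ : _ = th k * Z (s + y + h) k - th k * Z (s + y) k -
      h%:C * (th k * V y k)); last by ring.
    by rewrite !RecB RecZ; ring.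
  apply: le_trans (ler_norm_sum _ _ _) _.
  apply: (@le_trans _ _ (\sum_(k <- F) wt d k * (eps / S * `|h|))).
    rewrite big_seq [leRHS]big_seq; apply: ler_sum => k kF.
    rewrite normrM ger0_norm ?wt_ge0// ler_wpM2l ?wt_ge0//.
    rewrite (le_trans (normc_Re _))// normcM th1 mul1r; exact: H.
  rewrite -mulr_suml mulrA ler_wpM2r// mulrA ler_pdivrMr// mulrC.
  by rewrite ler_wpM2l ?(ltW eps0)// /S lerDr.
- rewrite -lee_fin; apply: le_trans (VK y hy).
  apply: (@le_trans _ _ (\sum_(k <- F) wt d k * normc (V y k))%:E).
    rewrite lee_fin; apply: ler_sum => k _; rewrite ler_wpM2l ?wt_ge0//.
    by rewrite (le_trans (ler_norm _))// (le_trans (normc_Re _))// normcM th1 mul1r.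
  by apply: esumr_seq => // k; rewrite mulr_ge0 ?wt_ge0 ?normc_ge0.
Qed.

End MeanValue.

(** * Uniqueness for the coefficients *)
Section CoefficientUniqueness.
Context {R : realType}.
Local Notation C := R[i].

(** What uniqueness needs to know of a solution. The expansion is asked for
    each coefficient separately, which is weaker than differentiability in
    any of the norms. *)
Definition coef_solution (d r : R) (a : C -> int -> C) : Prop :=
  (forall t, normc t < r -> exists2 eta, 0 < eta & exists M : R,
     forall h, normc h <= eta -> (nrm d (a (t + h)%R) <= M%:E)%E) /\
  (forall t, normc t < r -> forall k eps, 0 < eps -> exists2 eta, 0 < eta &
     forall h, normc h <= eta ->
     normc (a (t + h) k - a t k - h * Bil (a t) (a t) k) <= eps * normc h).

Lemma halves_le0 (y B : R) : (forall n, y <= B * 2^-1 ^+ n) -> y <= 0.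
Proof.
move=> h; rewrite leNgt; apply/negP => y0.
have B0 : 0 < B by have := h 0%N; rewrite expr0 mulr1; exact: lt_le_trans.
have [n hn] : exists n : nat, B / y < n%:R.
  by exists (Num.truncn (B / y)).+1; rewrite truncnS_gt.
have := h n; rewrite exprVn ler_pdivlMr ?exprn_gt0//.
apply/negP; rewrite -ltNge -ltr_pdivrMl// mulrC (lt_le_trans hn)//.
by rewrite -natrX ler_nat ltnW// ltn_expl.
Qed.

Variables (d r : R) (a b : C -> int -> C).
Hypotheses (d0 : 0 < d) (d1 : d <= 1).
Hypotheses (sa : coef_solution d r a) (sb : coef_solution d r b).

Section AlongRay.
Variable t : C.
Hypothesis tr : normc t < r.

Let Z (y : R) (k : int) : C := a (y%:C * t) k - b (y%:C * t) k.
(* The derivative of [Z] along the ray, by [Bil_diff]. *)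
Let V (y : R) (k : int) : C := t *
  (Bil (fun j => Z y j) (a (y%:C * t)) k + Bil (b (y%:C * t)) (fun j => Z y j) k).

Let on_disk (y : R) : 0 <= y <= 1 -> normc (y%:C * t) < r.
Proof.
move=> /andP[y0 y1]; rewrite normcM normcR ger0_norm//.
by rewrite (le_lt_trans _ tr)// ler_piMl ?normc_ge0.
Qed.

Let fin_at (x : C -> int -> C) (y : R) : coef_solution d r x -> 0 <= y <= 1 ->
  (nrm d (x (y%:C * t)%R) < +oo)%E.
Proof.
move=> [h _] /on_disk /h[eta eta0 [M]] /(_ 0).
by rewrite normc0 addr0 => /(_ (ltW eta0)) /le_lt_trans -> //; exact: ltry.
Qed.

Let Z_derive (y : R) k : 0 <= y <= 1 -> forall eps, 0 < eps ->
  exists2 eta, 0 < eta & forall h : R, `|h| <= eta ->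
    normc (Z (y + h) k - Z y k - h%:C * V y k) <= eps * `|h|.
Proof.
move=> y01 eps eps0.
pose T := normc t + 1.
have T0 : 0 < T by rewrite ltr_wpDl ?normc_ge0.
have e0 : 0 < eps / (2 * T) by rewrite divr_gt0// mulr_gt0.
have [ea ea0 Ha] := sa.2 _ (on_disk y01) k _ e0.
have [eb eb0 Hb] := sb.2 _ (on_disk y01) k _ e0.
exists (Num.min ea eb / T) => [|h]; first by rewrite divr_gt0// lt_min ea0.
rewrite ler_pdivlMr// le_min => /andP[h1 h2].
have nh : normc (h%:C * t) = `|h| * normc t by rewrite normcM normcR.
have le1 : normc (h%:C * t) <= `|h| * T by rewrite nh ler_wpM2l// lerDl.
have {}Ha := Ha (h%:C * t) (le_trans le1 h1).
have {}Hb := Hb (h%:C * t) (le_trans le1 h2).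
have yh : (y + h)%:C * t = y%:C * t + h%:C * t by rewrite rmorphD mulrDl.
rewrite /V -(Bil_diff k d0 d1 (fin_at sa y01) (fin_at sb y01)).
set A := (X in normc X <= _) in Ha; set B := (X in normc X <= _) in Hb.
have -> : Z (y + h) k - Z y k - h%:C * (t * (Bil (a (y%:C * t)) (a (y%:C * t)) k -
    Bil (b (y%:C * t)) (b (y%:C * t)) k)) = A - B.
  by rewrite /Z yh /A /B; ring.
apply: le_trans (ler_normcB _ _) _; apply: le_trans (lerD Ha Hb) _.
apply: le_trans (_ : eps / (2 * T) * (`|h| * T) + eps / (2 * T) * (`|h| * T) <= _).
  by apply: lerD; rewrite ler_wpM2l// ltW.
by rewrite le_eqVlt; apply/orP; left; apply/eqP; field; rewrite gt_eqF.
Qed.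

(** Uniqueness for short times in the scale of spaces: in the n-th iterate
    of the integral inequality the width [d - d'] is spent in [n] equal
    steps, and the resulting factor [n^n] is balanced by the [n!] of the
    iterated integrals. *)
Let local_zero (s : R) : 0 <= s <= 1 -> (forall k, Z s k = 0) ->
  exists2 eta, 0 < eta & forall x, 0 <= x <= eta -> s + x <= 1 ->
    forall k, Z (s + x) k = 0.
Proof.
move=> /andP[s0 s1] Zs.
have s01 : 0 <= s <= 1 by rewrite s0.
have [ea ea0 [Ma HMa]] := sa.1 _ (on_disk s01).
have [eb eb0 [Mb HMb]] := sb.1 _ (on_disk s01).
pose T := normc t + 1; pose M := 1 + `|Ma| + `|Mb|.
have T0 : 0 < T by rewrite ltr_wpDl ?normc_ge0.
have M0 : 0 < M by rewrite ltr_wpDr// ltr_wpDr.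
pose e1 := Num.min ea eb / T.
have e10 : 0 < e1 by rewrite divr_gt0// lt_min ea0.
have bnd x : 0 <= x <= e1 ->
    (nrm d (a ((s + x)%:C * t)%R) <= M%:E)%E /\ (nrm d (b ((s + x)%:C * t)%R) <= M%:E)%E.
  move=> /andP[x0]; rewrite ler_pdivlMr// le_min => /andP[h1 h2].
  have nh : normc (x%:C * t) <= x * T.
    by rewrite normcM normcR ger0_norm// ler_wpM2l// lerDl.
  rewrite rmorphD mulrDl; split.
    apply: le_trans (HMa _ (le_trans nh h1)) _; rewrite lee_fin /M.
    have := ler_norm Ma; have := normr_ge0 Mb; lra.
  apply: le_trans (HMb _ (le_trans nh h2)) _; rewrite lee_fin /M.
  have := ler_norm Mb; have := normr_ge0 Ma; lra.
(* Two terms in the derivative, each with 9 for the bilinear estimate and 2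
   for [natr_succ2_le], times e for [exp_step]; [M] bounds both solutions
   and [T] the modulus of [t]. *)
pose A := 36 * M * T * expR 1.
have A0 : 0 < A by rewrite /A mulr_gt0 ?expR_gt0// mulr_gt0// mulr_gt0.
have main n : forall d' x, 0 <= d' -> d' < d -> 0 <= x <= e1 -> s + x <= 1 ->
    (nrm d' (Z (s + x)%R) <= (2 * M * (A / (d - d')) ^+ n * x ^+ n)%:E)%E.
  elim: n => [|n IH] d' x d'0 d'd xe sx1.
    have [ha hb] := bnd x xe; rewrite !expr0 !mulr1.
    apply: le_trans (le_nrm _ (ltW d'd)) _; apply: le_trans (nrmB _ _ _) _.
    by rewrite (_ : 2 * M = M + M) ?EFinD ?leeD//; ring.
  have dd0 : 0 < d - d' by rewrite subr_gt0.
  have n1 : 0 < n.+1%:R :> R by rewrite ltr0n.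
  have n2 : 0 < n.+2%:R :> R by rewrite ltr0n.
  pose e := (d - d') / n.+2%:R.
  have e0 : 0 < e by rewrite divr_gt0.
  have e_le1 : e <= 1.
    rewrite ler_pdivrMr// mul1r; apply: le_trans (_ : 1 <= _).
      by rewrite lerBlDr (le_trans d1)// lerDl.
    by rewrite (ler_nat R 1).
  have de : d - (d' + e) = (d - d') * (n.+1%:R / n.+2%:R).
    have -> : n.+1%:R = n.+2%:R - 1 :> R by rewrite -[n.+2%:R]natr1 addrK.
    by rewrite /e; field; rewrite gt_eqF.
  have ded : d' + e < d by rewrite -subr_gt0 de mulr_gt0// divr_gt0.
  have d'e0 : 0 <= d' + e by rewrite addr_ge0// ltW.
  have /andP[x0 xe1] := xe.
  pose K := 2 * M * (A / (d - d')) ^+ n.+1 * n.+1%:R.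
  have -> : 2 * M * (A / (d - d')) ^+ n.+1 * x ^+ n.+1 = K * x ^+ n.+1 / n.+1%:R.
    by rewrite /K [_ * n.+1%:R * _]mulrAC mulfK ?gt_eqF.
  apply: (@nrm_increment_le R d' Z (fun y => V (s + y)) s x K n x0 Zs).
    move=> y k /andP[y0 yx]; apply: Z_derive.
    by rewrite addr_ge0//= (le_trans _ sx1)// lerD2l.
  move=> y /andP[y0 yx].
  have ye : 0 <= y <= e1 by rewrite y0 (le_trans yx).
  have sy1 : s + y <= 1 by rewrite (le_trans _ sx1)// lerD2l.
  have [ha hb] := bnd y ye.
  have hz := IH (d' + e) y d'e0 ded ye sy1.
  have ha' := le_trans (le_nrm _ (ltW ded)) ha.
  have hb' := le_trans (le_nrm _ (ltW ded)) hb.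
  have B1 := Bil_bound d'0 e0 e_le1 hz ha'.
  have B2 := Bil_bound d'0 e0 e_le1 hb' hz.
  rewrite nrmZ.
  set z := 2 * M * (A / (d - (d' + e))) ^+ n * y ^+ n in hz B1 B2.
  apply: (@le_trans _ _ (T%:E * (9 / e * (z * M) + 9 / e * (M * z))%:E)%E).
    rewrite lee_pmul ?lee_fin ?normc_ge0 ?nrm_ge0 ?lerDl//.
    by rewrite (le_trans (nrmD _ _ _))// EFinD leeD.
  rewrite -EFinM lee_fin.
  have q1 : (A / (d - (d' + e))) ^+ n <= (A / (d - d')) ^+ n * expR 1.
    have -> : A / (d - (d' + e)) = A / (d - d') * (n.+2%:R / n.+1%:R).
      by rewrite de; field; rewrite !gt_eqF.
    rewrite exprMn; apply: ler_wpM2l; last exact: exp_step.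
    by rewrite exprn_ge0// divr_ge0 ?(ltW A0) ?(ltW dd0).
  have q2 : 9 / e <= 18 / (d - d') * n.+1%:R.
    rewrite /e invf_div mulrA ler_pdivrMr//.
    rewrite [leRHS](_ : _ = 9 * (2 * n.+1%:R)); last first.
      by field; rewrite gt_eqF.
    by apply: ler_wpM2l => //; exact: natr_succ2_le.
  have yn0 : 0 <= y ^+ n by rewrite exprn_ge0.
  apply: (@le_trans _ _ (T * (18 / (d - d') * n.+1%:R * 2 * M *
     (2 * M * ((A / (d - d')) ^+ n * expR 1) * y ^+ n)))).
    rewrite ler_wpM2l ?(ltW T0)//.
    rewrite [leLHS](_ : _ = 9 / e * (2 * M * z)); last by ring.
    rewrite [leRHS](_ : _ = 18 / (d - d') * n.+1%:R * (2 * M *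
       (2 * M * ((A / (d - d')) ^+ n * expR 1) * y ^+ n))); last by ring.
    have M2 : 0 <= 2 * M by rewrite mulr_ge0// ltW.
    have z0 : 0 <= z.
      rewrite /z; apply: mulr_ge0 => //; apply: mulr_ge0 => //.
      by rewrite exprn_ge0// divr_ge0 ?(ltW A0)// ltW// subr_gt0.
    apply: ler_pM => //; first by rewrite divr_ge0// ltW.
      by rewrite mulr_ge0.
    by rewrite ler_wpM2l// ler_wpM2r// ler_wpM2l.
  rewrite /K [_ ^+ n.+1]exprSr le_eqVlt; apply/orP; left; apply/eqP.
  move: ((A / (d - d')) ^+ n) => Q; rewrite /A.
  move: (expR 1) (d - d') dd0 => E D D0.
  by field; rewrite gt_eqF.
(* For these times the ratio [A x / d] is at most 1/2. *)
pose e2 := Num.min e1 (d / (2 * A)).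
exists e2 => [|x /andP[x0]]; first by rewrite lt_min e10 divr_gt0// mulr_gt0.
rewrite le_min => /andP[xe1 xe2] sx1 k.
apply: eq0_normc; apply/eqP; rewrite eq_le normc_ge0 andbT.
apply: (@halves_le0 _ (2 * M)) => n.
have xe : 0 <= x <= e1 by rewrite x0.
have := main n 0 x (lexx 0) d0 xe sx1; rewrite subr0 -mulrA -exprMn => h.
rewrite -lee_fin; apply: le_trans (le_trans (_ : _ <= _)%E h) _.
  apply: le_trans (nrm_term 0 (Z (s + x)) k).
  by rewrite lee_fin ler_peMl ?normc_ge0// wt_ge1.
rewrite lee_fin ler_wpM2l ?mulr_ge0 ?(ltW M0)// lerXn2r ?nnegrE ?invr_ge0//.
  by rewrite mulr_ge0// divr_ge0 ?(ltW A0) ?(ltW d0).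
rewrite -ler_pdivlMl ?divr_gt0//; apply: le_trans xe2 _.
by rewrite le_eqVlt; apply/orP; left; apply/eqP; field; rewrite !gt_eqF.
Qed.

Hypothesis init : forall k, a 0 k = b 0 k.

(** Continuation: the supremum of the times up to which the two solutions
    agree on the ray is attained by continuity, and [local_zero] goes beyond
    it unless it is 1. *)
Lemma ray_zero k : a t k = b t k.
Proof.
have Z0 j : Z 0 j = 0 by rewrite /Z mul0r init subrr.
pose S := [set y : R | 0 <= y <= 1 /\ forall x, 0 <= x <= y -> forall j, Z x j = 0].
have S0 : S 0.
  split; first by rewrite lexx ler01.
  by move=> x /le_anti <- j.
have Sub : has_ubound S by exists 1 => y [/andP[]].
have hS : has_sup S by split; [exists 0|].
pose s := sup S.
have s0 : 0 <= s by exact: ub_le_sup.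
have s1 : s <= 1 by apply: ge_sup => [|y [/andP[]]//]; exists 0.
have s01 : 0 <= s <= 1 by rewrite s0.
have below x : 0 <= x < s -> forall j, Z x j = 0.
  move=> /andP[x0 xs] j.
  have [y [_ Hy] xy] := sup_adherent (eq_ind _ is_true (xs) _ (esym (subr_gt0 x s))) hS.
  by apply: Hy; rewrite x0 ltW// (le_lt_trans _ xy)// -/s; lra.
have Zs j : Z s j = 0.
  apply: eq0_normc; apply/eqP; rewrite eq_le normc_ge0 andbT.
  have [->|sn0] := eqVneq s 0; first by rewrite Z0 normc0.
  have sgt0 : 0 < s by rewrite lt_def sn0.
  apply/ler_addgt0Pl => e e0; rewrite addr0.
  have [eta eta0 H] := Z_derive j s01 ltr01.
  pose v := normc (V s j) + 1.
  have v0 : 0 < v by rewrite ltr_wpDl ?normc_ge0.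
  pose h := - Num.min (Num.min eta s) (e / v).
  have m0 : 0 < Num.min (Num.min eta s) (e / v).
    by rewrite !lt_min eta0 sgt0 divr_gt0.
  have hh : `|h| = Num.min (Num.min eta s) (e / v) by rewrite normrN gtr0_norm.
  have hle1 : `|h| <= eta by rewrite hh !ge_min lexx.
  have hle2 : `|h| <= s by rewrite hh !ge_min lexx orbT.
  have hle3 : `|h| <= e / v by rewrite hh !ge_min lexx !orbT.
  have := H h hle1; rewrite below; last first.
    have -> : h = - `|h| by rewrite hh.
    by rewrite subr_ge0 hle2 gtrBl hh.
  rewrite sub0r mul1r -opprD normcN => H'.
  have -> : Z s j = (Z s j + h%:C * V s j) - h%:C * V s j by rewrite addrK.
  apply: le_trans (ler_normcB _ _) _; apply: le_trans (lerD H' (lexx _)) _.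
  rewrite normcM normcR -[X in X + _]mulr1 -mulrDr addrC -/v.
  by rewrite -ler_pdivlMr.
have up_to x : 0 <= x <= s -> forall j, Z x j = 0.
  rewrite le_eqVlt (le_eqVlt x) => /andP[+ /orP[/eqP -> //|xs]] j.
  by rewrite -le_eqVlt => x0; apply: below; rewrite x0.
have [eta eta0 H] := local_zero s01 Zs.
have s_eq1 : s = 1.
  apply/eqP; rewrite eq_le s1/= leNgt; apply/negP => slt.
  pose x := Num.min eta (1 - s).
  have x0 : 0 < x by rewrite lt_min eta0 subr_gt0.
  have sx1 : s + x <= 1 by rewrite -lerBrDl ge_min lexx orbT.
  have : S (s + x).
    split; first by rewrite addr_ge0 ?(ltW x0).
    move=> y /andP[y0 yx] j; have [ys|sy] := leP y s.
      by apply: up_to; rewrite y0.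
    rewrite -(subrKC s y); apply: H; last by rewrite subrKC (le_trans yx).
    by rewrite subr_ge0 ltW//= lerBlDl (le_trans yx)// lerD2l ge_min lexx.
  move/(ub_le_sup Sub); rewrite -/s; lra.
have := up_to 1; rewrite s_eq1 ler01 lexx => /(_ isT k).
by rewrite /Z mul1r => /subr0_eq.
Qed.

End AlongRay.

End CoefficientUniqueness.

(** * Exponential modes *)
Section ExponentialModes.
Context {R : realType}.
Local Notation C := R[i].
Implicit Types (j k : int) (x y : R).

Lemma increment_bound (f df : R -> R) (M y : R) :
  (forall x, is_derive x 1 f (df x)) ->
  (forall x, `|x| <= `|y| -> `|df x| <= M) -> `|f y - f 0| <= M * `|y|.
Proof.
move=> hf hM.
have fc a b : {within `[a, b], continuous f}.
  by apply: derivable_within_continuous => z _; case: (hf z).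
have [y0|y0] := leP 0 y.
  have [c + ->] := MVT_segment y0 (fun x _ => hf x) (fc 0 y).
  rewrite in_itv/= => /andP[c0 cy]; rewrite subr0 normrM ler_wpM2r// hM//.
  by rewrite !ger0_norm.
have [c + e] := MVT_segment (ltW y0) (fun x _ => hf x) (fc y 0).
rewrite in_itv/= => /andP[cy c0]; rewrite distrC e sub0r normrM normrN.
by rewrite ler_wpM2r// hM// !ler0_norm ?lerN2// ltW.
Qed.

Lemma sin_le x : `|sin x| <= `|x|.
Proof.
have := @increment_bound sin cos 1 x (fun x => is_derive_sin x) (fun x _ => cos_max x).
by rewrite sin0 subr0 mul1r.
Qed.

Lemma cos_sub1_le x : `|cos x - 1| <= x ^+ 2.
Proof.
have := @increment_bound cos (fun x => - sin x) `|x| x (fun x => is_derive_cos x).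
rewrite cos0 -expr2 real_normK ?num_real//; apply => y yx.
by rewrite normrN (le_trans (sin_le y)).
Qed.

Lemma sin_subx_le x : `|sin x - x| <= x ^+ 2.
Proof.
have d y : is_derive y 1 (fun z => sin z - z) (cos y - 1).
  exact: (@is_deriveB _ _ _ _ _ _ _ _ _ (is_derive_sin y) (is_derive_id y 1)).
have := @increment_bound _ _ `|x| x d.
rewrite sin0 subr0 subr0 -expr2 real_normK ?num_real//; apply => y yx.
have := @increment_bound cos (fun x => - sin x) 1 y (fun x => is_derive_cos x).
rewrite cos0 mul1r => h; apply: le_trans (h _) yx => z _.
by rewrite normrN sin_max.
Qed.

Lemma expmodeDl j k x : expmode (j + k) x = expmode j x * expmode k x.
Proof.
have e : 2 * pi * (j + k)%:~R * x = 2 * pi * j%:~R * x + 2 * pi * k%:~R * x.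
  by rewrite intrD mulrDr mulrDl.
by apply: complex_eqP; rewrite ?RecM ?ImcM /expmode e ?cosD ?sinD//= addrC [cos _ * sin _]mulrC.
Qed.

Lemma expmodeDr k x y : expmode k (x + y) = expmode k x * expmode k y.
Proof.
have e : 2 * pi * k%:~R * (x + y) = 2 * pi * k%:~R * x + 2 * pi * k%:~R * y.
  by rewrite mulrDr.
by apply: complex_eqP; rewrite ?RecM ?ImcM /expmode e ?cosD ?sinD//= addrC [cos _ * sin _]mulrC.
Qed.

Lemma expmode0 x : expmode 0 x = 1.
Proof. by rewrite /expmode mulr0 mul0r cos0 sin0. Qed.

Lemma normc_expmode k x : normc (expmode k x) = 1.
Proof. by rewrite /expmode /= cos2Dsin2 sqrtr1. Qed.

Lemma expmodeN k x : expmode (- k) x * expmode k x = 1.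
Proof. by rewrite -expmodeDl addNr expmode0. Qed.

Lemma expmode_at1 k : expmode k (1 : R) = 1.
Proof.
have e1 : expmode 1 (1 : R) = 1.
  apply: complex_eqP; rewrite /expmode /= !mulr1 mulrC mulr_natr.
    exact: cos2pi.
  exact: sin2pi.
have en (n : nat) : expmode n (1 : R) = 1.
  by elim: n => [|n IH]; rewrite ?expmode0// -addn1 PoszD expmodeDl IH e1 mulr1.
case: k => n; first exact: en.
by rewrite NegzE; have := expmodeN n.+1%:Z (1 : R); rewrite en mulr1.
Qed.

Lemma expmode_periodic k : periodic (@expmode R k) 1.
Proof. by move=> x; rewrite expmodeDr expmode_at1 mulr1. Qed.

(** By [expmodeDr] it is enough to expand at 0, where the cosine and the
    sine have explicit second order remainders. *)
Lemma expmode_expand k x h :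
  normc (expmode k (x + h) - expmode k x - h%:C * (Dk k * expmode k x)) <=
  2 * (2 * pi * `|k%:~R|) ^+ 2 * h ^+ 2.
Proof.
have -> : expmode k (x + h) - expmode k x - h%:C * (Dk k * expmode k x) =
    expmode k x * (expmode k h - 1 - h%:C * Dk k).
  by rewrite expmodeDr; ring.
rewrite normcM normc_expmode mul1r; set th := 2 * pi * k%:~R * h.
have -> : expmode k h - 1 - h%:C * Dk k = (cos th - 1) +i* (sin th - th).
  apply: complex_eqP; rewrite !(RecB, ImcB) ?RecZ ?ImcZ /= /th; ring.
apply: le_trans (normc_ReIm _) _ => /=.
apply: le_trans (lerD (cos_sub1_le th) (sin_subx_le th)) _.
rewrite le_eqVlt; apply/orP; left; apply/eqP.
have -> : 2 * (2 * pi * `|k%:~R|) ^+ 2 * h ^+ 2 = 2 * th ^+ 2.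
  by rewrite /th -mulrA !exprMn real_normK ?num_real.
by move: (th ^+ 2) => X; ring.
Qed.

End ExponentialModes.

(** * Absolutely convergent Fourier series *)
Section FourierSeries.
Context {R : realType}.
Local Notation C := R[i].
Implicit Types (a b : int -> C) (d e x h : R) (k j : int).

Definition synth a x : C := csum (fun k => a k * expmode k x).

Definition deriv a k : C := Dk k * a k.

Definition conv a b k : C := csum (fun j => a j * b (k - j)).

Lemma asumm_mode a x : asumm a -> asumm (fun k => a k * expmode k x).
Proof. by apply: asumm_le => k; rewrite normcM normc_expmode mulr1. Qed.

Lemma nrm_asumm d a : 0 <= d -> (nrm d a < +oo)%E -> asumm a.
Proof.
move=> d0 ha; apply: asumm_le ha => k.
by rewrite ler_peMl ?normc_ge0// wt_ge1.
Qed.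

Lemma synthD a b x : asumm a -> asumm b ->
  synth (fun k => a k + b k) x = synth a x + synth b x.
Proof.
move=> ha hb; rewrite /synth -csumD; [|exact: asumm_mode..].
by apply: eq_csum => k; rewrite mulrDl.
Qed.

Lemma synthZ (c : C) a x : asumm a -> synth (fun k => c * a k) x = c * synth a x.
Proof.
move=> ha; rewrite /synth -csumZ; last exact: asumm_mode.
by apply: eq_csum => k; rewrite mulrA.
Qed.

Lemma synthN a x : synth (fun k => - a k) x = - synth a x.
Proof. by rewrite /synth -csumN; apply: eq_csum => k; rewrite mulNr. Qed.

Lemma synthB a b x : asumm a -> asumm b ->
  synth (fun k => a k - b k) x = synth a x - synth b x.
Proof. by move=> ha hb; rewrite synthD ?synthN//; exact: asummN. Qed.

Lemma synth_le a x M : (esumr (fun k => normc (a k)) <= M%:E)%E -> normc (synth a x) <= M.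
Proof.
move=> h; apply: csum_le; apply: le_trans h; apply: le_esumr => k.
by rewrite normcM normc_expmode mulr1.
Qed.

Lemma synth_periodic a : periodic (synth a) 1.
Proof. by move=> x; apply: eq_csum => k; rewrite expmode_periodic. Qed.

Lemma wt_deriv d e k : 0 < e -> wt d k * normc (Dk k) <= e^-1 * wt (d + e) k.
Proof.
move=> e0; rewrite normc_Dk wt_split [leRHS]mulrCA ler_wpM2l ?wt_ge0//.
exact: freq_le_exp.
Qed.

Lemma nrm_deriv d e a : 0 <= d -> d < e -> (nrm e a < +oo)%E -> (nrm d (deriv a) < +oo)%E.
Proof.
move=> d0 de ha; have ed : 0 < e - d by rewrite subr_gt0.
apply: (@le_summ _ _ _ (fun k => (e - d)^-1 * (wt e k * normc (a k)))).
  move=> k; rewrite normcM mulrA [leRHS]mulrA ler_wpM2r ?normc_ge0//.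
  by have := wt_deriv d k ed; rewrite subrKC.
apply: summZ => //; first by rewrite invr_ge0 ltW.
by move=> k; rewrite mulr_ge0 ?wt_ge0 ?normc_ge0.
Qed.

(** Termwise differentiation: the second order remainder of a mode is
    bounded by [k ^ 2], which exponentially decreasing coefficients absorb. *)
Lemma synth_expand d a : 0 < d -> (nrm d a < +oo)%E ->
  exists2 M, 0 <= M & forall x h,
    normc (synth a (x + h) - synth a x - h%:C * synth (deriv a) x) <= M * h ^+ 2.
Proof.
move=> d0 /[dup] ha /nrm_fin[A A0 hA].
have sa := nrm_asumm (ltW d0) ha.
have sD : asumm (deriv a) by apply: nrm_asumm (nrm_deriv (lexx 0) d0 ha).
exists (4 * pi / d * A) => [|x h].
  by rewrite !mulr_ge0 ?pi_ge0// invr_ge0 ltW.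
have -> : synth a (x + h) - synth a x - h%:C * synth (deriv a) x =
  csum (fun k => a k * (expmode k (x + h) - expmode k x -
                        h%:C * (Dk k * expmode k x))).
  rewrite /synth -csumZ; last exact: asumm_mode.
  rewrite -csumB; [|exact: asumm_mode..].
  rewrite -csumB; last 2 first.
  - by apply: asummB; exact: asumm_mode.
  - by apply: asummZ; exact: asumm_mode.
  by apply: eq_csum => k; rewrite /deriv; ring.
apply: csum_le; apply: (@le_trans _ _ (esumr (fun k => 4 * pi / d * h ^+ 2 *
    (wt d k * normc (a k))))).
  apply: le_esumr => k; rewrite normcM mulrC.
  rewrite [leRHS](_ : _ = 4 * pi / d * h ^+ 2 * wt d k * normc (a k)); last by ring.
  rewrite ler_wpM2r ?normc_ge0//; apply: le_trans (expmode_expand _ _ _) _.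
  rewrite [leRHS](_ : _ = 4 * pi / d * wt d k * h ^+ 2); last by ring.
  rewrite ler_wpM2r ?sqr_ge0//.
  set K := `|k%:~R|; have K0 : 0 <= K by exact: normr_ge0.
  have p0 : 0 <= 2 * pi :> R by rewrite ltW// pi2_gt0.
  rewrite [leLHS](_ : _ = 4 * pi * (K * (2 * pi * K))); last by ring.
  rewrite [leRHS](_ : _ = 4 * pi * ((1 + K) * (d^-1 * expR (2 * pi * d * K)))).
    rewrite ler_wpM2l ?mulr_ge0 ?pi_ge0//.
    by apply: ler_pM; rewrite ?lerDr ?mulr_ge0 ?pi_ge0//; exact: freq_le_exp.
  by rewrite /wt -/K; ring.
rewrite esumrZ; last 2 first.
- by rewrite mulr_ge0 ?sqr_ge0 ?mulr_ge0 ?pi_ge0// invr_ge0 ltW.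
- by move=> k; rewrite mulr_ge0 ?wt_ge0 ?normc_ge0.
rewrite [leRHS](_ : _ = ((4 * pi / d * h ^+ 2)%:E * A%:E)%E); last first.
  by rewrite -EFinM mulrAC.
rewrite lee_pmul ?lee_fin ?nrm_ge0//.
by rewrite mulr_ge0 ?sqr_ge0 ?mulr_ge0 ?pi_ge0// invr_ge0 ltW.
Qed.

Lemma expands_sqr (f : R -> R) x l M : 0 <= M ->
  (forall h, `|f (x + h) - f x - h * l| <= M * h ^+ 2) -> expands f x l.
Proof.
move=> M0 H e e0; exists (e / (M + 1)) => [|h hh]; first by rewrite divr_gt0// ltr_wpDl.
apply: le_trans (H h) _; rewrite -real_normK ?num_real// expr2 mulrA ler_wpM2r//.
apply: le_trans (ler_wpM2l M0 hh) _.
rewrite mulrA ler_pdivrMr ?ltr_wpDl// mulrC ler_wpM2l ?(ltW e0)//; lra.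
Qed.

Lemma synth_is_derive d a x : 0 < d -> (nrm d a < +oo)%E ->
  is_derive x 1 (fun y => Re (synth a y)) (Re (synth (deriv a) x)) /\
  is_derive x 1 (fun y => Im (synth a y)) (Im (synth (deriv a) x)).
Proof.
move=> d0 ha; have [M M0 H] := synth_expand d0 ha.
split; apply: expands_is_derive; apply: (expands_sqr M0) => h.
  by rewrite -RecZ -!RecB (le_trans (normc_Re _)).
by rewrite -ImcZ -!ImcB (le_trans (normc_Im _)).
Qed.

Lemma synth_continuous d a : 0 < d -> (nrm d a < +oo)%E ->
  continuous (fun y => Re (synth a y)) /\ continuous (fun y => Im (synth a y)).
Proof.
move=> d0 ha; split => x; apply/differentiable_continuous/derivable1_diffP.
  by case: (synth_is_derive x d0 ha) => -[].
by case: (synth_is_derive x d0 ha) => _ [].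
Qed.

Lemma csum_shear (f : int -> int -> C) : asumm (fun p => f p.1 p.2) ->
  csum (fun p => f p.1 p.2) = csum (fun k => csum (fun j => f j (k - j))).
Proof.
move=> hf; pose g (p : int * int) : int * int := (p.1 + p.2, p.1).
pose h (p : int * int) : int * int := (p.2, p.1 - p.2).
have gh : cancel g h by case=> x y; rewrite /g /h /= addrAC subrr add0r.
have hg : cancel h g by case=> x y; rewrite /g /h /= addrC subrK.
rewrite (@csum_pair _ _ _ (fun k j => f j (k - j))).
  by rewrite -(csum_reindex (fun p : int * int => f p.1 p.2) hg gh).
by move: hf; rewrite /asumm -(summ_reindex (fun p : int * int => normc (f p.1 p.2)) hg gh).
Qed.

Lemma asumm_prod a b : asumm a -> asumm b ->
  asumm (fun p : int * int => a p.1 * b p.2).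
Proof.
move=> ha hb; rewrite /asumm; under [X in summ X]eq_fun do rewrite normcM.
by apply: (@summ_prod _ _ _ (fun k => normc (a k)) (fun k => normc (b k))) => // k;
   exact: normc_ge0.
Qed.

Lemma asumm_conv_row a b k : asumm a -> asumm b -> asumm (fun j => a j * b (k - j)).
Proof.
move=> ha hb; have := asumm_prod ha hb; rewrite /asumm /summ.
rewrite (@esumr_shear _ (fun j l => normc (a j * b l))); last by move=> *; exact: normc_ge0.
apply: le_lt_trans.
apply: (@esum_term R _ (fun k => esumr (fun j => normc (a j * b (k - j))))) => l.
by apply: esumr_ge0 => j; exact: normc_ge0.
Qed.

(** The shear (j, l) -> (j, j + l) collects the products of modes with the
    same total frequency. *)
Lemma synthM a b x : asumm a -> asumm b -> synth a x * synth b x = synth (conv a b) x.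
Proof.
move=> ha hb; have ma := asumm_mode x ha; have mb := asumm_mode x hb.
rewrite /synth csumM//.
rewrite (@csum_shear (fun j l => a j * expmode j x * (b l * expmode l x))); last first.
  exact: (@asumm_prod (fun j => a j * expmode j x) (fun l => b l * expmode l x)).
apply: eq_csum => k; rewrite /conv mulrC -csumZ; last exact: asumm_conv_row.
apply: eq_csum => j.
have -> : expmode k x = expmode j x * expmode (k - j) x.
  by rewrite -expmodeDl subrKC.
by ring.
Qed.

Lemma nrm_conv d a b : 0 <= d -> (nrm d a < +oo)%E -> (nrm d b < +oo)%E ->
  (nrm d (conv a b) < +oo)%E.
Proof.
move=> d0 ha hb; have sa := nrm_asumm d0 ha; have sb := nrm_asumm d0 hb.
have w0 (c : int -> C) k : 0 <= wt d k * normc (c k).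
  by rewrite mulr_ge0 ?wt_ge0 ?normc_ge0.
have := summ_prod (w0 a) (w0 b) ha hb; rewrite /summ.
rewrite (@esumr_shear _ (fun j l => wt d j * normc (a j) * (wt d l * normc (b l)))); last first.
  by move=> j l; exact: mulr_ge0.
apply: le_lt_trans; apply: le_esum => k _.
apply: (@le_trans _ _ (esumr (fun j => wt d k * normc (a j * b (k - j))))).
  rewrite esumrZ ?wt_ge0//; last by move=> *; exact: normc_ge0.
  rewrite EFinM lee_pmul ?lee_fin ?wt_ge0 ?normc_ge0//.
  by rewrite csum_le_esumr// asumm_conv_row.
apply: le_esumr => j; rewrite normcM.
rewrite [leRHS](_ : _ = wt d j * wt d (k - j) * (normc (a j) * normc (b (k - j)))); last by ring.
rewrite ler_wpM2r ?mulr_ge0 ?normc_ge0//.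
by rewrite -{1}(subrKC j k) wtD.
Qed.

(** The bilinear form collects the convolutions that occur in the equation. *)
Lemma BilE d a k : 0 < d -> d <= 1 -> (nrm d a < +oo)%E ->
  Bil a a k = - (conv a (deriv a) k +
    mk k * (2 * a 0 * a k + 2^-1 * conv (deriv a) (deriv a) k)).
Proof.
move=> d0 d1 ha; have sa := nrm_asumm (ltW d0) ha.
have sD : asumm (deriv a) by apply: nrm_asumm (nrm_deriv (lexx 0) d0 ha).
have s1 := asumm_conv_row k sa sD; have s2 := asumm_conv_row k sD sD.
have s0 : asumm (fun j => if j == 0 then 2 * a 0 * a k else 0).
  by apply: (@asumm_seq _ _ _ [:: 0]) => j; rewrite inE => /negbTE ->.
have e0 : 2 * a 0 * a k = csum (fun j => if j == 0 then 2 * a 0 * a k else 0).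
  by rewrite (@csum1 _ _ _ 0) ?eqxx// => j /negbTE ->.
rewrite {1}e0 /conv -(csumZ _ s2) -csumD//; last exact: asummZ.
rewrite -csumZ; last by apply: asummD => //; exact: asummZ.
rewrite -csumD//; last by apply: asummZ; apply: asummD => //; exact: asummZ.
rewrite -csumN; apply: eq_csum => j; rewrite /bker /deriv subrKC.
by case: eqP => [->|_]; rewrite ?subr0; ring.
Qed.

End FourierSeries.

(** * Integrals over a period and Fourier coefficients *)
Section Integrals.
Context {R : realType}.
Local Notation C := R[i].
Local Notation mu := (@lebesgue_measure R).
Implicit Types (f g : R -> C) (k j : int).

Definition cint f : Prop :=
  mu.-integrable `[0, 1] (EFin \o (fun x => Re (f x))) /\
  mu.-integrable `[0, 1] (EFin \o (fun x => Im (f x))).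

Lemma measurable_unit : measurable (`[0, 1]%classic : set R).
Proof. exact: measurable_itv. Qed.

Lemma unit_mass : mu `[0, 1] = 1%:E.
Proof. by rewrite lebesgue_measure_itv/= lte_fin ltr01 oppr0 adde0. Qed.

Lemma integrable_eq (u v : R -> R) : (forall x, u x = v x) ->
  mu.-integrable `[0, 1] (EFin \o u) -> mu.-integrable `[0, 1] (EFin \o v).
Proof. by move=> /funext ->. Qed.

Local Notation rint u := (mu.-integrable `[0, 1] (EFin \o (u : R -> R))).

Lemma rintD (u v : R -> R) : rint u -> rint v -> rint (fun x => u x + v x).
Proof. exact: integrableD. Qed.

Lemma rintB (u v : R -> R) : rint u -> rint v -> rint (fun x => u x - v x).
Proof. exact: integrableB. Qed.

Lemma rintZ (c : R) (u : R -> R) : rint u -> rint (fun x => c * u x).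
Proof. exact: integrableZl. Qed.

Lemma rintM (u h : R -> R) (M : R) : rint u -> measurable_fun [set: R] h ->
  (forall x, `|h x| <= M) -> rint (fun x => u x * h x).
Proof.
move=> hu mh hM.
have := @integrableMl _ _ R mu _ measurable_unit (EFin \o u) h hu (measurable_funTS mh).
apply; exists M; split; rewrite ?num_real// => N MN x _ /=.
by rewrite (le_trans (hM _))// ltW.
Qed.

Lemma cintD f g : cint f -> cint g -> cint (fun x => f x + g x).
Proof.
move=> [f1 f2] [g1 g2]; split.
  by apply: integrable_eq (rintD f1 g1) => x; rewrite RecD.
by apply: integrable_eq (rintD f2 g2) => x; rewrite ImcD.
Qed.

Lemma cintZ (c : C) f : cint f -> cint (fun x => c * f x).
Proof.
move=> [f1 f2]; split.
  apply: integrable_eq (rintB (rintZ (Re c) f1) (rintZ (Im c) f2)) => x.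
  by rewrite RecM.
apply: integrable_eq (rintD (rintZ (Re c) f2) (rintZ (Im c) f1)) => x.
by rewrite ImcM.
Qed.

Lemma meanD f g : cint f -> cint g -> mean (fun x => f x + g x) = mean f + mean g.
Proof.
move=> [f1 f2] [g1 g2]; apply: complex_eqP; rewrite ?RecD ?ImcD /=.
  by rewrite -RintegralD//; apply: eq_Rintegral => x _; rewrite RecD.
by rewrite -RintegralD//; apply: eq_Rintegral => x _; rewrite ImcD.
Qed.

Lemma meanZ (c : C) f : cint f -> mean (fun x => c * f x) = c * mean f.
Proof.
move=> [f1 f2].
apply: complex_eqP; rewrite ?RecM ?ImcM /=.
  rewrite -!RintegralZl// -RintegralB ?rintZ//.
  by apply: eq_Rintegral => x _; rewrite RecM.
rewrite -!RintegralZl// -RintegralD ?rintZ//.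
by apply: eq_Rintegral => x _; rewrite ImcM.
Qed.

Lemma eq_mean f g : (forall x, f x = g x) -> mean f = mean g.
Proof. by move=> /funext ->. Qed.

Lemma cint_eq f g : (forall x, f x = g x) -> cint f -> cint g.
Proof. by move=> /funext ->. Qed.

Lemma eq_fourier f g k : (forall x, f x = g x) -> fourier f k = fourier g k.
Proof. by move=> /funext ->. Qed.

Lemma cint_continuous f : continuous (fun x => Re (f x)) ->
  continuous (fun x => Im (f x)) -> cint f.
Proof.
move=> h1 h2; split; apply: continuous_compact_integrable.
- exact: segment_compact.
- exact: continuous_subspaceT.
- exact: segment_compact.
- exact: continuous_subspaceT.
Qed.

Lemma continuous_expmode k : continuous (fun x => Re (expmode k x) : R) /\
  continuous (fun x => Im (expmode k x) : R).
Proof.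
have l : continuous (fun x : R => 2 * pi * k%:~R * x) by exact: mulrl_continuous.
split => x; apply: continuous_comp; rewrite ?[_ @ _]l//.
- exact: l.
- exact: continuous_cos.
- exact: l.
- exact: continuous_sin.
Qed.

Lemma cint_expmode k : cint (expmode k).
Proof. by have [h1 h2] := continuous_expmode k; exact: cint_continuous. Qed.

Lemma cint_bounded_mul f g (M : R) : cint f ->
  measurable_fun [set: R] (fun x => Re (g x)) ->
  measurable_fun [set: R] (fun x => Im (g x)) ->
  (forall x, normc (g x) <= M) -> cint (fun x => f x * g x).
Proof.
move=> [f1 f2] mr mi gM.
have br x : `|Re (g x)| <= M by rewrite (le_trans (normc_Re _)).
have bi x : `|Im (g x)| <= M by rewrite (le_trans (normc_Im _)).
split.
  apply: integrable_eq (rintB (rintM f1 mr br) (rintM f2 mi bi)) => x.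
  by rewrite RecM.
apply: integrable_eq (rintD (rintM f1 mi bi) (rintM f2 mr br)) => x.
by rewrite ImcM.
Qed.

Lemma measurable_expmode k :
  measurable_fun [set: R] (fun x => Re (expmode k x)) /\
  measurable_fun [set: R] (fun x => Im (expmode k x)).
Proof.
by have [h1 h2] := continuous_expmode k; split; exact: continuous_measurable_fun.
Qed.

Lemma cint_mode f k : cint f -> cint (fun x => f x * expmode k x).
Proof.
move=> hf; have [m1 m2] := measurable_expmode k.
by apply: (cint_bounded_mul (M := 1)) => // x; rewrite normc_expmode.
Qed.

Lemma fourierD f g k : cint f -> cint g ->
  fourier (fun x => f x + g x) k = fourier f k + fourier g k.
Proof.
move=> hf hg; rewrite /fourier -meanD; [|exact: cint_mode..].
by apply: eq_mean => x; rewrite mulrDl.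
Qed.

Lemma fourierZ (c : C) f k : cint f -> fourier (fun x => c * f x) k = c * fourier f k.
Proof.
move=> hf; rewrite /fourier -meanZ; last exact: cint_mode.
by apply: eq_mean => x; rewrite mulrA.
Qed.

Lemma cintB f g : cint f -> cint g -> cint (fun x => f x - g x).
Proof.
move=> hf hg; apply: cint_eq (cintD hf (cintZ (-1) hg)) => x; by rewrite mulN1r.
Qed.

Lemma fourierB f g k : cint f -> cint g ->
  fourier (fun x => f x - g x) k = fourier f k - fourier g k.
Proof.
move=> hf hg; rewrite -[X in _ - X]mul1r -mulNr -fourierZ// -fourierD//.
  by apply: eq_fourier => x; rewrite mulN1r.
exact: cintZ.
Qed.

(** On a period, which has finite measure, [|f| <= 1 + |f|^2]. *)
Lemma cint_L2 f : L2circle f -> cint f.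
Proof.
move=> [_ mr mi hf].
have dom (u : R -> R) : measurable_fun [set: R] u ->
    (forall x, `|u x| <= normc (f x)) -> mu.-integrable `[0, 1] (EFin \o u).
  move=> mu_ hu; apply/integrableP; split.
    by apply/measurable_EFinP; exact: measurable_funTS.
  apply: (@le_lt_trans _ _ (\int[mu]_(x in `[0%R, 1%R]) (1 + (normc (f x) ^+ 2)%:E))%E).
    have mn : measurable_fun (`[0, 1]%classic : set R) (fun x => normc (f x) ^+ 2).
      apply: (eq_measurable_fun (fun x => Re (f x) ^+ 2 + Im (f x) ^+ 2)).
        by move=> x _; rewrite normc_sqr.
      by apply: measurable_funD; apply: measurable_funX; exact: measurable_funTS.
    apply: ge0_le_integral => //.
    - by apply: measurableT_comp => //; apply/measurable_EFinP; exact: measurable_funTS.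
    - apply: emeasurable_funD => //; exact/measurable_EFinP.
    - move=> x _; rewrite /= -EFinD lee_fin (le_trans (hu x))//.
      have := normc_ge0 (f x); move: (normc _) => n n0; nra.
  rewrite ge0_integralD//.
  - by rewrite integral_cst//= unit_mass mul1e lte_add_pinfty// ltry.
  - by move=> x _; rewrite lee_fin sqr_ge0.
  - apply/measurable_EFinP.
    apply: (eq_measurable_fun (fun x => Re (f x) ^+ 2 + Im (f x) ^+ 2)).
      by move=> x _; rewrite normc_sqr.
    by apply: measurable_funD; apply: measurable_funX; exact: measurable_funTS.
split; apply: dom => // x; [exact: normc_Re|exact: normc_Im].
Qed.

Lemma mean_le f (M : R) : cint f -> (forall x, normc (f x) <= M) -> normc (mean f) <= M.
Proof.
move=> hf fM; have [th th1 <-] := normc_rotate (mean f).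
rewrite -meanZ// /=; have [h1 _] := cintZ th hf.
apply: (@le_trans _ _ (\int[mu]_(x in `[0, 1]) M)%R).
  apply: le_Rintegral => //.
    by apply: (@continuous_compact_integrable _ (fun=> M));
       [exact: segment_compact|exact: continuous_subspaceT (@cst_continuous _ _ M)].
  move=> x _; rewrite (le_trans (ler_norm _))// (le_trans (normc_Re _))//.
  by rewrite normcM th1 mul1r.
by rewrite Rintegral_cst//= unit_mass mulr1.
Qed.

Lemma ae_imp (P Q : R -> Prop) : (forall x, P x -> Q x) ->
  {ae mu, forall x, P x} -> {ae mu, forall x, Q x}.
Proof.
move=> PQ; apply: filterS => //; exact: (ae_filter_ringOfSetsType mu).
Qed.

Lemma ae_and (P Q : R -> Prop) : {ae mu, forall x, P x} ->
  {ae mu, forall x, Q x} -> {ae mu, forall x, P x /\ Q x}.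
Proof.
by move=> p q; exact: (@filterI _ _ (ae_filter_ringOfSetsType mu) _ _ p q).
Qed.

Lemma mean_eqae f g : cint f -> cint g -> eqae f g -> mean f = mean g.
Proof.
move=> [f1 f2] [g1 g2] fg; apply: complex_eqP; rewrite /= /Rintegral; congr fine;
  apply: ae_eq_integral => //.
- by case/integrableP: f1.
- by case/integrableP: g1.
- by apply: ae_imp fg => x /= ->.
- by case/integrableP: f2.
- by case/integrableP: g2.
- by apply: ae_imp fg => x /= ->.
Qed.

Lemma fourier_eqae f g k : cint f -> cint g -> eqae f g -> fourier f k = fourier g k.
Proof.
move=> hf hg fg; apply: mean_eqae; [exact: cint_mode..|].
by apply: ae_imp fg => x ->.
Qed.

Lemma Rintegral_derive (F f : R -> R) : (forall x : R, is_derive x (1 : R) F (f x)) ->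
  continuous f -> \int[mu]_(x in `[0, 1]) f x = F 1 - F 0.
Proof.
move=> dF cf.
have cF : continuous F.
  by move=> x; apply/differentiable_continuous/derivable1_diffP; case: (dF x).
rewrite /Rintegral (@continuous_FTC2 _ f F 0 1)//.
- exact: continuous_subspaceT.
- split; first by move=> x _; case: (dF x).
  + by apply: cvg_at_right_filter; exact: cF.
  + by apply: cvg_at_left_filter; exact: cF.
- by move=> x _; rewrite derive1E; case: (dF x).
Qed.

Lemma mean_derive f g :
  (forall x : R, is_derive x (1 : R) (fun y => Re (f y)) (Re (g x))) ->
  (forall x : R, is_derive x (1 : R) (fun y => Im (f y)) (Im (g x))) ->
  continuous (fun x => Re (g x)) -> continuous (fun x => Im (g x)) ->
  mean g = f 1 - f 0.
Proof.
move=> d1 d2 c1 c2; apply: complex_eqP; rewrite ?RecB ?ImcB /=.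
  exact: Rintegral_derive d1 c1.
exact: Rintegral_derive d2 c2.
Qed.

Lemma mean_expmode k : mean (expmode k) = if k == 0 then 1 else 0 :> C.
Proof.
case: eqVneq => [->|k0].
  apply: complex_eqP; rewrite /= /expmode mulr0.
    under eq_Rintegral do rewrite mul0r cos0.
    by rewrite Rintegral_cst//= unit_mass mulr1.
  under eq_Rintegral do rewrite mul0r sin0.
  by rewrite Rintegral_cst//= mul0r.
(* For a nonzero frequency, the mode is the derivative of the periodic
   function [expmode k / Dk k]. *)
have D0 : Dk k != 0 :> C.
  apply/eqP => /(congr1 (@normc R)); rewrite normc_Dk normc0 => /eqP.
  by rewrite !mulf_eq0 normr_eq0 intr_eq0 (negbTE k0) orbF pnatr_eq0/= gt_eqF// pi_gt0.
have [c1 c2] := continuous_expmode k.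
pose M := normc ((Dk k)^-1 : C) * (2 * (2 * pi * `|k%:~R|) ^+ 2).
have M0 : 0 <= M by rewrite mulr_ge0 ?normc_ge0// mulr_ge0// sqr_ge0.
have H x h : normc ((Dk k)^-1 * expmode k (x + h) - (Dk k)^-1 * expmode k x -
    h%:C * expmode k x) <= M * h ^+ 2.
  have -> : (Dk k)^-1 * expmode k (x + h) - (Dk k)^-1 * expmode k x - h%:C * expmode k x =
    (Dk k)^-1 * (expmode k (x + h) - expmode k x - h%:C * (Dk k * expmode k x)).
    by rewrite !mulrBr [_ * (h%:C * _)]mulrCA mulKf.
  by rewrite normcM /M -mulrA ler_wpM2l ?normc_ge0// expmode_expand.
have d1 x : is_derive x (1 : R) (fun y => Re ((Dk k)^-1 * expmode k y)) (Re (expmode k x)).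
  apply: expands_is_derive; apply: (expands_sqr M0) => h.
  by rewrite -RecZ -!RecB (le_trans (normc_Re _)).
have d2 x : is_derive x (1 : R) (fun y => Im ((Dk k)^-1 * expmode k y)) (Im (expmode k x)).
  apply: expands_is_derive; apply: (expands_sqr M0) => h.
  by rewrite -ImcZ -!ImcB (le_trans (normc_Im _)).
rewrite (mean_derive d1 d2 c1 c2).
by have := @expmode_periodic R k 0; rewrite add0r => ->; rewrite subrr.
Qed.

(** A partial sum that includes the mode [k] has the right coefficient, and
    the tail is uniformly small. *)
Lemma fourier_synth (a : int -> C) k : asumm a -> cint (synth a) ->
  fourier (synth a) k = a k.
Proof.
move=> sa ci; apply/eqP; rewrite -subr_eq0; apply/eqP/eq0_normc/eqP.
rewrite eq_le normc_ge0 andbT; apply/ler_addgt0Pl => e e0; rewrite addr0.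
have [s0 [us0 hs0]] := esumr_tail (fun k => normc_ge0 (a k)) sa e0.
pose s := undup (k :: s0).
have us : uniq s by exact: undup_uniq.
have hs : (esumr (fun j => if j \in s then 0%R else normc (a j)) <= e%:E)%E.
  apply: le_trans hs0; apply: le_esumr => j; rewrite mem_undup inE.
  by case: (j == k) => //=; case: ifP => // _; exact: normc_ge0.
pose p x := \sum_(j <- s) a j * expmode j x.
have cp (r : seq int) : cint (fun x => \sum_(j <- r) a j * expmode j x) /\
    fourier (fun x => \sum_(j <- r) a j * expmode j x) k =
    \sum_(j <- r) (if j == k then a j else 0).
  elim: r => [|j r [IH1 IH2]].
    have c0 : cint (fun=> 0).
      by apply: cint_continuous; exact: cst_continuous.
    split; first by apply: cint_eq c0 => x; rewrite big_nil.
    rewrite big_nil /fourier (@eq_mean _ (fun x => 0 * (fun=> 0 : C) x)) ?meanZ ?mul0r//.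
    by move=> x; rewrite big_nil !mul0r.
  have cj : cint (fun x => a j * expmode j x) by apply: cintZ; exact: cint_expmode.
  split; first by apply: cint_eq (cintD cj IH1) => x; rewrite big_cons.
  rewrite big_cons -IH2 -[in RHS](_ : fourier (fun x => a j * expmode j x) k = if j == k then a j else 0).
    by rewrite -fourierD//; apply: eq_fourier => x; rewrite big_cons.
  rewrite fourierZ; last exact: cint_expmode.
  rewrite /fourier (@eq_mean _ (expmode (j - k))); last by move=> x; rewrite expmodeDl.
  by rewrite mean_expmode subr_eq0; case: ifP => _; rewrite ?mulr1 ?mulr0.
have [cpi fp] := cp s.
have fpk : fourier p k = a k.
  rewrite fp -big_mkcond -big_filter filter_pred1_uniq//= ?big_seq1//.
  by rewrite mem_undup inE eqxx.
rewrite -{1}fpk -fourierB//; apply: mean_le.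
  by apply: cint_mode; exact: cintB.
move=> x; rewrite normcM normc_expmode mulr1 /synth /p.
apply: csum_approx => //; first exact: asumm_mode.
apply: le_trans hs; apply: le_esumr => j; case: ifP => // _.
by rewrite normcM normc_expmode mulr1.
Qed.

Lemma synth_cint d (a : int -> C) : 0 < d -> (nrm d a < +oo)%E -> cint (synth a).
Proof. by move=> d0 /(synth_continuous d0)[c1 c2]; exact: cint_continuous. Qed.

Lemma synth_L2 d (a : int -> C) : 0 < d -> (nrm d a < +oo)%E -> L2circle (synth a).
Proof.
move=> d0 ha; have [c1 c2] := synth_continuous d0 ha.
have sa := nrm_asumm (ltW d0) ha.
split; [exact: synth_periodic|exact: continuous_measurable_fun..|].
have fn := esumr_fin (fun k => normc_ge0 (a k)) sa.
pose M := fine (esumr (fun k => normc (a k))).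
have hM x : normc (synth a x) <= M by apply: synth_le; rewrite fineK.
apply: (@le_lt_trans _ _ (\int[mu]_(x in `[0%R, 1%R]) (cst (M ^+ 2)%:E x))%E); last first.
  by rewrite integral_cst//= unit_mass mule1 ltry.
apply: ge0_le_integral => //.
- by move=> x _; rewrite lee_fin sqr_ge0.
- apply/measurable_EFinP.
  apply: (eq_measurable_fun (fun x => Re (synth a x) ^+ 2 + Im (synth a x) ^+ 2)).
    by move=> x _; rewrite normc_sqr.
  by apply: measurable_funD; apply: measurable_funX; apply: measurable_funTS;
     exact: continuous_measurable_fun.
- move=> x _; rewrite lee_fin lerXn2r ?nnegrE ?normc_ge0//.
  exact: le_trans (normc_ge0 _) (hM x).
Qed.

End Integrals.

(** * Trigonometric approximation of the indicator of an arc *)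
Section StepApproximation.
Context {R : realType}.
Local Notation C := R[i].
Local Notation mu := (@lebesgue_measure R).
Implicit Types (f : R -> C) (k j : int) (x y t : R).

Lemma bernoulli_up t (n : nat) : 0 <= t -> 1 + n%:R * t <= (1 + t) ^+ n.
Proof.
move=> t0; elim: n => [|n IH]; first by rewrite mul0r addr0 expr0.
rewrite exprS; apply: le_trans (ler_wpM2l _ IH); last by rewrite addr_ge0.
rewrite -natr1; have : 0 <= n%:R * t * t by rewrite !mulr_ge0.
by move: (n%:R : R) => m; nra.
Qed.

Lemma bernoulli_down t (n : nat) : 0 <= t -> t <= 1 -> 1 - n%:R * t <= (1 - t) ^+ n.
Proof.
move=> t0 t1; elim: n => [|n IH]; first by rewrite mul0r subr0 expr0.
rewrite exprS; apply: le_trans (ler_wpM2l _ IH); last by rewrite subr_ge0.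
rewrite -natr1; have : 0 <= n%:R * t * t by rewrite !mulr_ge0.
by move: (n%:R : R) => m; nra.
Qed.

(** On [0, 1] these polynomials converge boundedly to the step function that
    jumps from 1 to 0 at 1/2. *)
Definition cutoff (n : nat) (a : R) : R := (1 - a ^+ n) ^+ (2 ^ n).

Lemma cutoff01 n a : 0 <= a <= 1 -> 0 <= cutoff n a <= 1.
Proof.
move=> /andP[a0 a1].
have p0 : 0 <= a ^+ n by rewrite exprn_ge0.
have p1 : a ^+ n <= 1 by rewrite exprn_ile1.
by rewrite exprn_ge0 ?subr_ge0// exprn_ile1 ?subr_ge0// gerBl.
Qed.

(** By the inequality of Bernoulli, the value is at least [1 - (2 a) ^ n]. *)
Lemma cutoff_lt a : 0 <= a < 2^-1 -> cutoff n a @[n --> \oo] --> (1 : R).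
Proof.
move=> /andP[a0 a1].
have p n : 0 <= a ^+ n <= 1 by rewrite exprn_ge0// exprn_ile1//; lra.
apply: (@squeeze_cvgr _ _ _ _ (fun n => 1 - (2 * a) ^+ n) (cst 1)).
- apply: nearW => n; have /andP[p0 p1] := p n.
  have a01 : 0 <= a <= 1 by rewrite a0; lra.
  have /andP[_ ->] := cutoff01 n a01; rewrite andbT.
  apply: le_trans (bernoulli_down (2 ^ n) p0 p1).
  by rewrite natrX exprMn.
- rewrite -[X in _ --> X]subr0; apply: cvgB; first exact: cvg_cst.
  by apply: cvg_expr; rewrite ger0_norm ?mulr_ge0//; lra.
- exact: cvg_cst.
Qed.

(** As [(1 - p) (1 + p) <= 1], the value is at most the inverse of
    [(1 + a ^ n) ^ (2 ^ n)], which is at least [(2 a) ^ n]. *)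
Lemma cutoff_gt a : 2^-1 < a <= 1 -> cutoff n a @[n --> \oo] --> (0 : R).
Proof.
move=> /andP[a0 a1]; have a00 : 0 < a by lra.
have p n : 0 < a ^+ n <= 1 by rewrite exprn_gt0// exprn_ile1//; lra.
apply: (@squeeze_cvgr _ _ _ _ (cst 0) (fun n => ((2 * a)^-1) ^+ n)).
- apply: nearW => n; have /andP[p0 p1] := p n.
  have a01 : 0 <= a <= 1 by rewrite a1 ltW.
  have /andP[c0 _] := cutoff01 n a01; rewrite c0/=.
  have h1 := bernoulli_up (2 ^ n) (ltW p0).
  have h2 : (1 + a ^+ n) ^+ (2 ^ n) * cutoff n a <= 1.
    rewrite /cutoff -exprMn exprn_ile1//.
    - by rewrite mulr_ge0// ?subr_ge0// addr_ge0// ltW.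
    - nra.
  rewrite exprVn -[leRHS]mul1r ler_pdivlMr ?exprn_gt0 ?mulr_gt0// mulrC.
  apply: le_trans h2; rewrite ler_wpM2r//; apply: le_trans h1.
  by rewrite exprMn natrX lerDr.
- exact: cvg_cst.
- apply: cvg_expr; rewrite ger0_norm ?invr_ge0 ?mulr_ge0 ?(ltW a00)//.
  by rewrite invf_lt1 ?mulr_gt0//; lra.
Qed.

(** For [x] and [y] in the open unit interval,
    [sin (pi y) * sin (pi (x - y))] is positive exactly when [y < x], and it
    is a trigonometric polynomial of degree one in [y]. Thus [arc x] is
    below 1/2 exactly on the arc from 0 to [x]. *)
Definition arc x y : R := (1 - sin (pi * y) * sin (pi * (x - y))) / 2.

Lemma arc01 x y : 0 <= arc x y <= 1.
Proof.
have : `|sin (pi * y) * sin (pi * (x - y))| <= 1.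
  by rewrite normrM mulr_ile1 ?sin_max.
by rewrite ler_norml /arc => /andP[]; move: (sin _ * sin _) => q; lra.
Qed.

Lemma sin_pi_gt0 y : 0 < y < 1 -> 0 < sin (pi * y).
Proof.
move=> /andP[y0 y1]; apply: sin_gt0_pi; rewrite mulr_gt0 ?pi_gt0//=.
by rewrite -[ltRHS]mulr1 ltr_pM2l ?pi_gt0.
Qed.

Lemma arc_lt x y : 0 < y -> y < x -> x < 1 -> arc x y < 2^-1.
Proof.
move=> y0 yx x1; rewrite /arc.
have h1 : 0 < sin (pi * y) by apply: sin_pi_gt0; rewrite y0 (lt_trans yx).
have h2 : 0 < sin (pi * (x - y)).
  by apply: sin_pi_gt0; rewrite subr_gt0 yx/= (lt_trans _ x1)// gtrBl.
by have := mulr_gt0 h1 h2; move: (sin _ * sin _) => q; lra.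
Qed.

Lemma arc_gt x y : 0 < x -> x < y -> y < 1 -> 2^-1 < arc x y.
Proof.
move=> x0 xy y1; rewrite /arc.
have y0 : 0 < y by exact: lt_trans xy.
have h1 : 0 < sin (pi * y) by apply: sin_pi_gt0; rewrite y0.
have h2 : 0 < sin (pi * (y - x)).
  by apply: sin_pi_gt0; rewrite subr_gt0 xy/= (lt_trans _ y1)// gtrBl.
have -> : pi * (x - y) = - (pi * (y - x)) by rewrite -mulrN opprB.
rewrite sinN mulrN; have := mulr_gt0 h1 h2; move: (sin _ * sin _) => q; lra.
Qed.

(** The product of sines is half the difference of the cosines of
    [pi (2 y - x)] and [pi x]. *)
Lemma arc_mode x : exists c0 c1 c2 : C, forall y,
  (arc x y)%:C = c0 + c1 * expmode 1 y + c2 * expmode (-1) y.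
Proof.
exists ((2^-1 + 4^-1 * cos (pi * x))%:C),
  ((- 8^-1 * cos (pi * x)) +i* (8^-1 * sin (pi * x))),
  ((- 8^-1 * cos (pi * x)) +i* (- 8^-1 * sin (pi * x))) => y.
have e1 : arc x y = 2^-1 - 4^-1 * (cos (2 * pi * y) * cos (pi * x) +
    sin (2 * pi * y) * sin (pi * x)) + 4^-1 * cos (pi * x).
  have dE : 2 * pi * y = pi * y + pi * y by rewrite -mulrA [2 * _]mulr_natl mulr2n.
  rewrite /arc dE mulrBr sinB cosD sinD; have := cos2Dsin2 (pi * y).
  move: (cos (pi * y)) (sin (pi * y)) (cos (pi * x)) (sin (pi * x)) => c s cx sx h.
  rewrite [RHS](_ : _ = (1 - s * (sx * c - cx * s)) / 2 -
     4^-1 * cx * (c ^+ 2 + s ^+ 2 - 1)); last by field.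
  by rewrite h subrr mulr0 subr0.
have E1 : expmode 1 y = cos (2 * pi * y) +i* sin (2 * pi * y) by rewrite /expmode mulr1.
have E2 : expmode (-1) y = cos (2 * pi * y) +i* (- sin (2 * pi * y)).
  by rewrite /expmode mulrN1z mulrN1 mulNr cosN sinN.
rewrite E1 E2; move: (cos (2 * pi * y)) (sin (2 * pi * y)) e1 => c s ->.
move: (cos (pi * x)) (sin (pi * x)) => cx sx.
apply: complex_eqP.
  by rewrite !(RecD, RecM)/=; field.
by rewrite !(ImcD, ImcM)/=; field.
Qed.

End StepApproximation.

(** * Uniqueness of Fourier coefficients *)
Section FourierUniqueness.
Context {R : realType}.
Local Notation C := R[i].
Local Notation mu := (@lebesgue_measure R).
Implicit Types (f : R -> C) (u : R -> R) (k j : int) (x y t : R).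

(** The functions to be proved zero; they form a module over the
    trigonometric polynomials. *)
Definition killed f : Prop := cint f /\ forall k, fourier f k = 0.

Lemma killed_eq f g : (forall x, f x = g x) -> killed f -> killed g.
Proof. by move=> /funext ->. Qed.

Lemma killedD f g : killed f -> killed g -> killed (fun x => f x + g x).
Proof.
move=> [cf kf] [cg kg]; split=> [|k]; first exact: cintD.
by rewrite fourierD// kf kg addr0.
Qed.

Lemma killedZ (c : C) f : killed f -> killed (fun x => c * f x).
Proof.
move=> [cf kf]; split=> [|k]; first exact: cintZ.
by rewrite fourierZ// kf mulr0.
Qed.

Lemma killed_mode j f : killed f -> killed (fun x => f x * expmode j x).
Proof.
move=> [cf kf]; split=> [|k]; first exact: cint_mode.
rewrite -(kf (k - j)); apply: eq_mean => x.
by rewrite opprB expmodeDl mulrA.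
Qed.

Lemma killed_arc x f : killed f -> killed (fun y => f y * (arc x y)%:C).
Proof.
move=> kf; have [c0 [c1 [c2 H]]] := arc_mode x.
apply: (killed_eq _ (killedD (killedD (killedZ c0 kf)
  (killedZ c1 (killed_mode 1 kf))) (killedZ c2 (killed_mode (-1) kf)))) => y.
by rewrite H; ring.
Qed.

Lemma killed_cutoff x n f : killed f -> killed (fun y => f y * (cutoff n (arc x y))%:C).
Proof.
have cM (a b : R) : (a * b)%:C = a%:C * b%:C :> C by exact: rmorphM.
have cB (a b : R) : (a - b)%:C = a%:C - b%:C :> C by exact: rmorphB.
have pw m g : killed g -> killed (fun y => g y * (arc x y ^+ m)%:C).
  move=> kg; elim: m => [|m IH]; first by apply: killed_eq kg => y; rewrite expr0 mulr1.
  by apply: killed_eq (killed_arc x IH) => y; rewrite exprSr cM mulrA.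
rewrite /cutoff; move: (2 ^ n)%N => N kf; elim: N => [|N IH].
  by apply: killed_eq kf => y; rewrite expr0 mulr1.
apply: killed_eq (killedD IH (killedZ (-1) (pw n _ IH))) => y.
by rewrite exprSr cM cB; ring.
Qed.

Definition cutoff_orthogonal (u : R -> R) : Prop :=
  mu.-integrable `[0, 1] (EFin \o u) /\
  forall x n, \int[mu]_(y in `[0, 1]) (u y * cutoff n (arc x y)) = 0.

Lemma killed_Re f : killed f -> cutoff_orthogonal (fun x => Re (f x)).
Proof.
move=> kf; split=> [|x n]; first by case: kf => -[].
have [_ /(_ 0)] := killed_cutoff x n kf; move=> /(congr1 (@complex.Re R)).
rewrite /fourier oppr0 /mean /= => e; rewrite -[RHS]e; apply: eq_Rintegral => y _.
by rewrite expmode0 mulr1 [in RHS]mulrC RecZ mulrC.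
Qed.

Lemma killed_Im f : killed f -> cutoff_orthogonal (fun x => Im (f x)).
Proof.
move=> kf; split=> [|x n]; first by case: kf => -[].
have [_ /(_ 0)] := killed_cutoff x n kf; move=> /(congr1 (@complex.Im R)).
rewrite /fourier oppr0 /mean /= => e; rewrite -[RHS]e; apply: eq_Rintegral => y _.
by rewrite expmode0 mulr1 [in RHS]mulrC ImcZ mulrC.
Qed.

Lemma measurable_cutoff_arc x n :
  measurable_fun [set: R] (fun y => cutoff n (arc x y)).
Proof.
have cs (g : R -> R) : continuous g -> measurable_fun [set: R] (fun y => sin (g y)).
  move=> cg; apply: continuous_measurable_fun => z.
  by apply: continuous_comp; [exact: cg|exact: continuous_sin].
have c1 : measurable_fun [set: R] (fun y : R => sin (pi * y)).
  by apply: cs; exact: mulrl_continuous.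
have c2 : measurable_fun [set: R] (fun y : R => sin (pi * (x - y))).
  apply: cs => z; apply: cvgM; first exact: cvg_cst.
  by apply: cvgB; [exact: cvg_cst|exact: cvg_id].
rewrite /cutoff /arc; apply: measurable_funX; apply: measurable_funB => //.
apply: measurable_funX; apply: measurable_funM => //.
by apply: measurable_funB => //; exact: measurable_funM.
Qed.

Lemma ae_finite (A : set R) (P : R -> Prop) : finite_set A ->
  (forall x, ~ A x -> P x) -> {ae mu, forall x, P x}.
Proof.
move=> fA H; exists A; split.
- apply: countable_measurable; last exact: finite_set_countable.
  by move=> t; exact: measurable_set1.
- by apply: countable_lebesgue_measure0; exact: finite_set_countable.
- by move=> x /=; apply: contra_notP => /H.
Qed.

(** Dominated convergence: off the points 0, [x] and 1, the cutoff of
    [arc x] converges to the indicator of the values below [x]. *)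
Lemma integral_initial u x : 0 < x -> x < 1 -> cutoff_orthogonal u ->
  \int[mu]_(y in `[0, 1]) ((u \_ `]-oo, x]) y) = 0.
Proof.
move=> x0 x1 [iu hu].
have mu_ : measurable_fun (`[0, 1]%classic : set R) u.
  by case/integrableP: iu => /measurable_EFinP.
pose fn n y := (u y * cutoff n (arc x y))%:E.
pose l : R -> \bar R := fun y => ((u \_ `]-oo, x]) y)%:E.
pose g y := (`|(u y)%:E|)%E.
have h1 n : measurable_fun (`[0, 1]%classic : set R) (fn n).
  apply/measurable_EFinP; apply: measurable_funM => //.
  by apply: measurable_funTS; exact: measurable_cutoff_arc.
have h2 : measurable_fun (`[0, 1]%classic : set R) l.
  apply/measurable_EFinP/measurable_restrict; [exact: measurable_itv|exact: measurable_unit|].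
  by apply: (measurable_funS measurable_unit _ mu_); exact: subIsetl.
have h3 : {ae mu, forall y, (`[0, 1]%classic : set R) y -> fn ^~ y @ \oo --> l y}.
  apply: (@ae_finite [set 0; x; 1]) => [|y ny /=].
    by rewrite !finite_setU; split => //; split.
  rewrite in_itv/= => /andP[y0 y1].
  have yn0 : 0 < y by rewrite lt_def y0 andbT; apply: contra_notN ny => /eqP ->; left; left.
  have yn1 : y < 1.
    by rewrite lt_def y1 andbT eq_sym; apply: contra_notN ny => /eqP ->; right.
  apply: cvg_EFin; first exact: nearW.
  have [yx|xy|yx] := ltgtP y x; last by case: ny; left; right.
  - have -> : (u \_ `]-oo, x]) y = u y * 1.
      by rewrite patchE mem_set ?mulr1//= in_itv/= ltW.
    apply: cvgM; first exact: cvg_cst.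
    apply: cutoff_lt; rewrite arc_lt// andbT; by case/andP: (arc01 x y).
  - have -> : (u \_ `]-oo, x]) y = u y * 0.
      by rewrite patchE memNset ?mulr0//= in_itv/=; apply/negP; rewrite -ltNge.
    apply: cvgM; first exact: cvg_cst.
    apply: cutoff_gt; rewrite arc_gt//=; by case/andP: (arc01 x y).
have h4 : mu.-integrable `[0, 1] g by exact: integrable_abse.
have h5 : {ae mu, forall y n, (`[0, 1]%classic : set R) y -> (`|fn n y| <= g y)%E}.
  apply: aeW => y n _; rewrite /fn /g /= lee_fin normrM ler_piMr//.
  have /andP[c0 c1] := cutoff01 n (arc01 x y); by rewrite ger0_norm.
have [_ _ lim0] := @dominated_convergence _ (measurableTypeR R) R (@lebesgue_measure R) _
  (@measurable_unit R) fn l g h1 h2 h3 h4 h5.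
have : (\int[mu]_(y in `[0%R, 1%R]) l y)%E = 0%E.
  rewrite -(cvg_lim _ lim0)//; apply: lim_near_cst => //; apply: nearW => n /=.
  have fin : (\int[mu]_(y in `[0%R, 1%R]) fn n y)%E \is a fin_num.
    apply: integrable_fin_num => //.
    apply: (rintM (M := 1) iu (measurable_cutoff_arc x n)) => y.
    have /andP[c0 c1] := cutoff01 n (arc01 x y); by rewrite ger0_norm.
  by rewrite -(fineK fin) -[fine _]/(\int[mu]_(y in `[0, 1]) (u y * cutoff n (arc x y))) hu.
by rewrite /Rintegral => ->.
Qed.

(** The primitive of [u] vanishes, and Lebesgue differentiation recovers [u]
    from it. *)
Lemma cutoff_orthogonal_ae u : \int[mu]_(y in `[0, 1]) u y = 0 -> cutoff_orthogonal u ->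
  {ae mu, forall y, 0 <= y <= 1 -> u y = 0}.
Proof.
move=> tot hu; have [iu _] := hu.
pose g := u \_ `[0, 1].
have ig : mu.-integrable setT (EFin \o g).
  have /integrable_mkcond := iu; move=> /(_ measurable_unit).
  by rewrite restrict_EFin.
have F0 x : \int[mu]_(y in `]-oo, x]) g y = 0.
  rewrite -Rintegral_mkcondr setIC Rintegral_mkcondr.
  have [x0|x0] := ltP 0 x; last first.
    rewrite /Rintegral (_ : (\int[mu]_(y in `[0%R, 1%R]) _)%E = 0%E)//.
    transitivity (\int[mu]_(y in `[0%R, 1%R]) (cst 0 y))%E; last by rewrite integral_cst//= mul0e.
    apply: ae_eq_integral => //.
      apply/measurable_EFinP/measurable_restrict; [exact: measurable_itv|exact: measurable_unit|].
      case/integrableP: iu => /measurable_EFinP mu_ _.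
      by apply: (measurable_funS measurable_unit _ mu_); exact: subIsetl.
    apply: (@ae_finite [set 0]) => // y yn0; rewrite /= in_itv/= => /andP[y0 _].
    rewrite patchE memNset//= in_itv/=; apply/negP; rewrite -ltNge.
    by rewrite (le_lt_trans x0)// lt_def y0 andbT; apply/eqP.
  have [x1|x1] := ltP x 1; first exact: integral_initial hu.
  rewrite -[RHS]tot; apply: eq_Rintegral => y /set_mem /=; rewrite in_itv/= => /andP[_ y1].
  by rewrite patchE mem_set//= in_itv/= (le_trans y1).
have iN y : mu.-integrable `]-oo, y] (EFin \o g).
  by apply: integrableS ig => //.
have := FTC1Ny iN (integrable_locally measurable_unit iu).
apply: ae_imp => y; rewrite (_ : (fun x => _) = cst 0); last by apply/funext => x; exact: F0.
move=> [_]; rewrite derive1_cst => e yI.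
by move: e; rewrite /g patchE mem_set//= in_itv.
Qed.

Lemma killed_zero f : killed f -> {ae mu, forall y, 0 <= y <= 1 -> f y = 0}.
Proof.
move=> kf; have [_ /(_ 0)] := kf.
rewrite /fourier (@eq_mean _ _ f); last by move=> x; rewrite oppr0 expmode0 mulr1.
move=> m0; have r0 : \int[mu]_(y in `[0, 1]) Re (f y) = 0 := congr1 (@complex.Re R) m0.
have i0 : \int[mu]_(y in `[0, 1]) Im (f y) = 0 := congr1 (@complex.Im R) m0.
have h1 := cutoff_orthogonal_ae r0 (killed_Re kf); have h2 := cutoff_orthogonal_ae i0 (killed_Im kf).
by apply: ae_imp (ae_and h1 h2) => y [e1 e2] yI; apply: complex_eqP; rewrite ?e1 ?e2.
Qed.

Lemma lebesgue_measure_shift (c : R) (A : set R) : measurable A ->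
  pushforward mu ((fun x => x + c) : _ -> measurableTypeR R) A = mu A.
Proof.
move=> mA; apply/esym/lebesgue_measure_unique => //=.
  by apply: measurable_funD.
move=> mf _ [[a b]] _ <-.
have -> : pushforward mu ((fun x => x + c) : _ -> measurableTypeR R) `]a, b] = mu `]a - c, b - c].
  congr mu; apply/seteqP; split => x /=; rewrite !in_itv/= ltrBlDr lerBrDr//.
rewrite !lebesgue_measure_itv/= !lte_fin ltrD2r; case: ifP => // _.
by rewrite -!EFinD; congr EFin; ring.
Qed.

(** The exceptional set is covered by the integer translates of a null set. *)
Lemma ae_periodic f : periodic f 1 -> {ae mu, forall y, 0 <= y <= 1 -> f y = 0} ->
  {ae mu, forall y, f y = 0}.
Proof.
move=> pf [N [mN N0 HN]].
have pn (n : nat) y : f (y + n%:R) = f y.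
  by elim: n => [|n IH]; rewrite ?addr0// -natr1 addrA pf.
have mshift (c : R) : measurable [set x | N (x + c)].
  have mf : measurable_fun [set: R] ((fun x => x + c) : R -> measurableTypeR R).
    by apply: measurable_funD.
  by have := mf measurableT _ mN; rewrite setTI.
have zshift (c : R) : mu.-negligible [set x | N (x + c)].
  exists [set x | N (x + c)].
  by split; [exact: mshift|exact: etrans (lebesgue_measure_shift c mN) N0|].
pose M (n : nat) := [set x | N (x + n%:R)] `|` [set x | N (x - n%:R)].
have MN : mu.-negligible (\bigcup_n M n).
  by apply: negligible_bigcup => n; apply: negligibleU; exact: zshift.
apply: negligibleS MN => y /= fy.
have fl := Num.Theory.ge_floor y; have fl1 := Num.Theory.lt_succ_floor y.
have out z : f z = f y -> 0 <= z <= 1 -> N z.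
  by move=> fz z01; apply: HN => /= /(_ z01); rewrite fz.
case E : (Num.floor y) fl fl1 => [n|n] fl fl1.
- exists n => //; right; apply: out.
    by rewrite -(pn n) subrK.
  by move: fl fl1; rewrite intrD; lra.
- exists n.+1 => //; left; apply: out; first exact: pn.
  move: fl fl1; rewrite NegzE intrD mulrNz; lra.
Qed.

(** This converts almost everywhere identities between functions into
    identities between coefficients. *)
Lemma fourier_inj f g : periodic f 1 -> periodic g 1 -> cint f -> cint g ->
  (forall k, fourier f k = fourier g k) -> eqae f g.
Proof.
move=> pf pg cf cg fg.
have k : killed (fun x => f x - g x).
  by split=> [|k]; [exact: cintB|rewrite fourierB// fg subrr].
have p : periodic (fun x => f x - g x) 1 by move=> x; rewrite pf pg.
apply: ae_imp (ae_periodic p (killed_zero k)) => x /eqP.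
by rewrite subr_eq0 => /eqP.
Qed.

(** Two different values persist on an interval, which has positive measure. *)
Lemma eqae_continuous (u v : R -> R) : continuous u -> continuous v ->
  {ae mu, forall x, u x = v x} -> forall x, u x = v x.
Proof.
move=> cu cv [N [mN N0 HN]] x; apply/eqP/negP => /negP uv.
have e0 : 0 < `|u x - v x| by rewrite normr_gt0 subr_eq0.
have cw : continuous (fun y => u y - v y) by move=> y; apply: cvgB; [exact: cu|exact: cv].
have := cw x => /cvgrPdist_lt /(_ _ e0) [d /= d0 H].
have sub : `]x - d, x + d[ `<=` N.
  move=> y; rewrite /= in_itv/= => /andP[y1 y2]; apply: HN => /= e.
  have := H y; rewrite /ball_ /= e subrr subr0 ltxx => h.
  have : false by apply: h; rewrite ltr_norml; lra.
  by [].
have : (mu `](x - d)%R, (x + d)%R[ <= mu N)%E.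
  apply: le_measure => //; apply: mem_set; last exact: mN.
  exact: measurable_itv.
rewrite N0 lebesgue_measure_itv/= lte_fin ifT; last by lra.
rewrite -EFinB lee_fin; lra.
Qed.

End FourierUniqueness.

(** * The operator A^{-1} on Fourier series *)
Section InverseOperator.
Context {R : realType}.
Local Notation C := R[i].
Implicit Types (f : R -> C) (k : int) (x : R).

(** The frequencies from [-n] to [n], in the order in which the symmetric
    partial sums include them. *)
Fixpoint symseq (n : nat) : seq int :=
  if n is m.+1 then n%:Z :: - n%:Z :: symseq m else [:: 0].

Lemma mem_symseq n k : (k \in symseq n) = (absz k <= n)%N.
Proof.
elim: n => [|n IH]; first by rewrite inE leqn0 absz_eq0.
rewrite /= !inE IH; apply/idP/idP; lia.
Qed.

Lemma symseq_uniq n : uniq (symseq n).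
Proof.
elim: n => // n IH; rewrite /= inE !mem_symseq IH !negb_or andbT; lia.
Qed.

Lemma sum_symseq (V : nmodType) (F : int -> V) n : \sum_(k <- symseq n) F k =
  F 0 + \sum_(1 <= k < n.+1) (F k%:Z + F (- k%:Z)).
Proof.
elim: n => [|n IH]; first by rewrite big_seq1 big_geq// addr0.
by rewrite big_nat_recr//= !big_cons IH -NegzE addrA addrC -addrA.
Qed.

Lemma complex_cvg (u : nat -> C^o) (l : C^o) :
  (forall e : R, 0 < e -> exists N, forall n, (N <= n)%N -> normc (u n - l) <= e) ->
  u n @[n --> \oo] --> l.
Proof.
move=> H; apply/cvgrPdist_le => e e0.
have [re ime] : 0 < Re e /\ Im e = 0.
  by move: e0; rewrite ltcE => /andP[/eqP /= h1 h2]; split => //; rewrite h1.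
have [N HN] := H _ re; exists N => // n /= /HN h.
by rewrite lecE /= ime eqxx /=; rewrite normcB in h; exact: h.
Qed.

Lemma csum_symmetric (F : int -> C) : asumm F ->
  limn (fun n => \sum_(1 <= k < n.+1) (F k%:Z + F (- k%:Z)) : C^o) = csum F - F 0.
Proof.
move=> hF; apply: cvg_lim; first exact: norm_hausdorff.
apply: complex_cvg => e e0.
have [s [us hs]] := esumr_tail (fun k => normc_ge0 (F k)) hF e0.
exists (\max_(k <- s) absz k)%N => n hn.
have -> : \sum_(1 <= k < n.+1) (F k%:Z + F (- k%:Z)) - (csum F - F 0) =
    - (csum F - \sum_(k <- symseq n) F k) by rewrite sum_symseq; ring.
rewrite normcN; apply: csum_approx => //; first exact: symseq_uniq.
apply: le_trans hs; apply: le_esumr => k.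
case ks: (k \in s); last by case: ifP => // _; exact: normc_ge0.
by rewrite mem_symseq ifT// (leq_trans _ hn)// (@leq_bigmax_seq _ s xpredT absz).
Qed.

(** The coefficients of [A^{-1}] of a function with coefficients [g]. *)
Definition invcoef (g : int -> C) k : C :=
  if k == 0 then g 0 else g k / ((2 * pi * k%:~R) ^+ 2)%:C.

Lemma normc_invcoef (g : int -> C) k : normc (invcoef g k) <= normc (g k).
Proof.
rewrite /invcoef; case: eqVneq => [->//|k0].
rewrite normcM normcV normcR ler_piMr ?normc_ge0//.
have p1 : 1 <= 2 * pi :> R by have := pi_ge2 R; lra.
have h : 1 <= `|(2 * pi * k%:~R) ^+ 2| :> R.
  rewrite normrX exprn_ege1// normrM ger0_norm; last by rewrite (le_trans _ p1).
  by rewrite -[leLHS]mulr1 ler_pM// absz_int.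
by rewrite invf_le1// (lt_le_trans _ h).
Qed.

Lemma Ainv_synth f (g : int -> C) x : (forall k, fourier f k = g k) -> asumm g ->
  Ainv f x = synth (invcoef g) x.
Proof.
move=> fg hg; have hq : asumm (invcoef g) by exact: asumm_le (normc_invcoef g) hg.
have hF := asumm_mode x hq.
have F0 : invcoef g 0 * expmode 0 x = g 0 by rewrite /invcoef eqxx expmode0 mulr1.
have := csum_symmetric hF; rewrite F0 -/(synth _ _) => e.
rewrite -[RHS](subrK (g 0)) addrC -e /Ainv fg; congr (_ + _).
apply: (congr1 (fun u : nat -> C^o => limn u)); apply/funext => n; apply: eq_big_nat => k /andP[k1 _].
rewrite !fg /invcoef oppr_eq0.
have -> : (k%:Z == 0) = false by apply/negbTE; lia.
by rewrite mulrNz mulrN sqrrN.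
Qed.

Lemma deriv_invcoef (g : int -> C) k : deriv (invcoef g) k = mk k * g k.
Proof.
rewrite /deriv /invcoef /Dk /mk; case: eqVneq => [->|k0].
  by rewrite !mulr0 invr0 !mul0r.
have w0 : 2 * pi * k%:~R != 0 :> R.
  by rewrite mulf_neq0 ?intr_eq0// gt_eqF// pi2_gt0.
move: (2 * pi * k%:~R) w0 => w w0.
have -> : (0 +i* w^-1) = (0 +i* w) / (w ^+ 2)%:C :> C.
  rewrite -fmorphV mulrC; apply: complex_eqP; rewrite ?RecZ ?ImcZ /= ?mulr0//.
  by field.
by rewrite mulrA [X in X = _]mulrAC.
Qed.

End InverseOperator.

(** * Comparison of Gevrey norms with weighted l^1 norms *)
Section GevreyNorm.
Context {R : realType}.
Local Notation C := R[i].
Local Notation br := (@bracket R).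
Implicit Types (d e s : R) (k : int) (a : int -> C).

(** The square of the norm in G^{d,s} of a function with coefficients [a]. *)
Definition gsum d s a : \bar R := esumr (fun k =>
  br k `^ (2 * s) * expR (4 * pi * d * `|k%:~R|) * normc (a k) ^+ 2).

Lemma gterm_ge0 d s a k :
  0 <= br k `^ (2 * s) * expR (4 * pi * d * `|k%:~R|) * normc (a k) ^+ 2.
Proof. by rewrite mulr_ge0 ?sqr_ge0// mulr_ge0 ?powR_ge0 ?expR_ge0. Qed.

Lemma gsum_ge0 d s a : (0 <= gsum d s a)%E.
Proof. by apply: esumr_ge0 => k; exact: gterm_ge0. Qed.

Lemma gevrey_norm_le d s (f : R -> C) (M : R) : 0 <= M ->
  (gevrey_norm d s f <= M%:E)%E = (gsum d s (fourier f) <= (M ^+ 2)%:E)%E.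
Proof.
move=> M0.
have -> : gevrey_norm d s f = (gsum d s (fourier f) `^ 2^-1)%E by [].
have := gsum_ge0 d s (fourier f); case: (gsum _ _ _) => [x||]//.
  rewrite lee_fin => x0; rewrite poweR_EFin powR12_sqrt// !lee_fin.
  by rewrite -(ler_sqrt _ (sqr_ge0 M)) sqrtr_sqr ger0_norm.
by move=> _; rewrite poweRyr// gt_eqF// invr_gt0.
Qed.

Lemma bracket_ge1 k : 1 <= br k.
Proof.
rewrite /bracket -[leLHS]sqrtr1 ler_sqrt; first by rewrite lerDl sqr_ge0.
by rewrite addr_ge0 ?sqr_ge0.
Qed.

Lemma bracket_le k : br k <= 1 + `|k%:~R|.
Proof.
rewrite /bracket -[leRHS]ger0_norm ?addr_ge0// -sqrtr_sqr ler_sqrt ?sqr_ge0//.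
rewrite sqrrD expr1n real_normK ?num_real// mul1r addrAC lerDl mulrn_wge0//.
Qed.

Lemma bracket_ge k : 1 + `|k%:~R| <= 2 * br k.
Proof.
have b1 := bracket_ge1 k.
have : `|k%:~R| <= br k :> R.
  by rewrite /bracket -sqrtr_sqr ler_sqrt ?lerDr// addr_ge0 ?sqr_ge0.
lra.
Qed.

(** Comparison with a telescoping sum, the discrete form of the integral of
    [x ^ (- r - 1)]. *)
Lemma powR_telescope (r : R) (n : nat) : 0 < r ->
  r * n.+2%:R `^ (- (r + 1)) <= n.+1%:R `^ (- r) - n.+2%:R `^ (- r).
Proof.
move=> r0; set x : R := n.+1%:R; set y : R := n.+2%:R.
have x0 : 0 < x by rewrite ltr0n.
have y0 : 0 < y by rewrite ltr0n.
have yx : y = x + 1 by rewrite /y -natr1.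
have lnxy : y^-1 <= ln y - ln x.
  have := expR_ge1Dx (ln x - ln y); rewrite -ln_div ?posrE// lnK ?posrE ?divr_gt0//.
  rewrite ln_div ?posrE//.
  have -> : x / y = 1 - y^-1.
    have xy : x = y - 1 by rewrite yx addrK.
    by rewrite {1}xy mulrBl divff ?gt_eqF// mul1r.
  by move: (ln x) (ln y) (y^-1) => a b c; lra.
have pE (z t : R) : 0 < z -> z `^ t = expR (t * ln z).
  by move=> z0; rewrite /powR gt_eqF.
rewrite !pE//; set A := ln x in lnxy *; set B := ln y in lnxy *.
have -> : expR (- (r + 1) * B) = y^-1 * expR (- r * B).
  by rewrite opprD mulrDl expRD mulN1r expRN [expR B]lnK ?posrE// mulrC.
have -> : expR (- r * A) = expR (r * (B - A)) * expR (- r * B).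
  by rewrite -expRD; congr expR; ring.
rewrite -[X in _ - X]mul1r -mulrBl mulrA ler_wpM2r ?expR_ge0//.
have := expR_ge1Dx (r * (B - A)); have := ler_wpM2l (ltW r0) lnxy.
move: (expR (r * (B - A))) (r * (B - A)) (r * y^-1) => a b c; lra.
Qed.

Lemma powR_partial_sum (r : R) (n : nat) : 0 < r ->
  \sum_(i < n) i.+1%:R `^ (- (r + 1)) <= 1 + r^-1.
Proof.
move=> r0; case: n => [|n]; first by rewrite big_ord0 addr_ge0// invr_ge0 ltW.
rewrite big_ord_recl/= powR1 lerD2l.
apply: (@le_trans _ _ (r^-1 * (1 - n.+1%:R `^ (- r)))); last first.
  by rewrite ler_piMr ?invr_ge0 ?(ltW r0)// gerBl powR_ge0.
rewrite ler_pdivlMl//; elim: n => [|n IH]; first by rewrite big_ord0 powR1 mulr0 subrr.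
rewrite big_ord_recr/= mulrDr; apply: le_trans (lerD IH (powR_telescope n r0)) _.
by rewrite addrA subrK.
Qed.

Lemma summ_bracket s : 2^-1 < s -> summ (fun k => br k `^ (- (2 * s))).
Proof.
move=> s2; pose r := 2 * s - 1; have r0 : 0 < r by rewrite /r; lra.
have b0 k : 0 <= br k by rewrite (le_trans ler01)// bracket_ge1.
pose F k : R := 2 `^ (2 * s) * (1 + `|k%:~R|) `^ (- (2 * s)).
have F0 k : 0 <= F k by rewrite mulr_ge0 ?powR_ge0.
have brF k : br k `^ (- (2 * s)) <= F k.
  rewrite /F !powRN ler_pdivlMr ?powR_gt0 ?ltr_pwDl// mulrC.
  rewrite ler_pdivrMr ?powR_gt0 ?(lt_le_trans ltr01 (bracket_ge1 k))//.
  rewrite -powRM//; apply: ge0_ler_powR; rewrite ?nnegrE ?mulr_ge0 ?addr_ge0//; first lra.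
  exact: bracket_ge.
have Fnat (n : nat) : F n = 2 `^ (2 * s) * n.+1%:R `^ (- (r + 1)).
  rewrite /F -pmulrn ger0_norm// [1 + _]addrC natr1; congr (_ * _ `^ _).
  by rewrite /r; ring.
have Fneg (n : nat) : F (- n%:Z) = F n by rewrite /F mulrNz normrN.
apply: le_summ brF _.
apply: (le_lt_trans _ (ltry (2 * (2 `^ (2 * s) * (1 + r^-1))))).
apply: esumr_le => t ut; rewrite lee_fin.
pose m := (\max_(k <- t) absz k)%N.
apply: (@le_trans _ _ (\sum_(k <- symseq m) F k)).
  rewrite [leRHS](bigID (mem t))/= -[X in _ <= X + _]big_filter.
  rewrite (perm_big [seq k <- symseq m | k \in t]); first by rewrite lerDl sumr_ge0.
  apply: uniq_perm; rewrite ?filter_uniq ?symseq_uniq// => k.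
  rewrite mem_filter mem_symseq; case kt: (k \in t) => //=.
  by rewrite (@leq_bigmax_seq _ t xpredT absz).
rewrite sum_symseq.
apply: (@le_trans _ _ (2 * \sum_(i < m.+1) F i)).
  rewrite -(big_mkord xpredT (fun i : nat => F i)) big_ltn// mulrDr mulr_sumr.
  apply: lerD; first by rewrite ler_peMl// ler1n.
  by apply: ler_sum => k _; rewrite Fneg mulr_natl mulr2n.
rewrite ler_wpM2l//; under eq_bigr do rewrite Fnat.
by rewrite -mulr_sumr ler_wpM2l ?powR_ge0// powR_partial_sum.
Qed.

Lemma gterm_sqr d s a k :
  br k `^ (2 * s) * expR (4 * pi * d * `|k%:~R|) * normc (a k) ^+ 2 =
  (br k `^ s * expR (2 * pi * d * `|k%:~R|) * normc (a k)) ^+ 2.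
Proof.
rewrite !exprMn; congr (_ * _ * _).
  by rewrite -powR_mulrn ?powR_ge0// -powRrM mulrC.
rewrite -expRM_natl; congr expR; move: (pi : R) => p; ring.
Qed.

(** Cauchy-Schwarz: since [<k> ^ (- s)] is square summable for [s > 1 / 2],
    a Sobolev exponent [s + 1] in the l^2 norm controls one derivative in
    l^1. *)
Lemma nrm_le_gsum s : 2^-1 < s -> exists2 K, 0 < K & forall d a G, 0 < G ->
  (gsum d (s + 1) a <= (G ^+ 2)%:E)%E -> (nrm d a <= (K * G)%:E)%E.
Proof.
move=> s2; have hS := summ_bracket s2.
pose S := esumr (fun k => br k `^ (- (2 * s))).
have Sf : S \is a fin_num by apply: esumr_fin => // k; exact: powR_ge0.
have S0 : 0 <= fine S by rewrite fine_ge0// esumr_ge0// => k; exact: powR_ge0.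
have b1 k := bracket_ge1 k.
have bp k : 0 < br k by rewrite (lt_le_trans ltr01).
exists (2 * fine S + 2^-1) => [|d a G G0 hG]; first by rewrite ltr_wpDl// mulr_ge0.
pose y k := br k `^ (s + 1) * expR (2 * pi * d * `|k%:~R|) * normc (a k).
pose x k := br k `^ (- s).
have y0 k : 0 <= y k by rewrite !mulr_ge0 ?powR_ge0 ?expR_ge0 ?normc_ge0.
have x0 k : 0 <= x k by rewrite powR_ge0.
(* Cauchy-Schwarz in the form [2 x y <= 2 G x ^ 2 + y ^ 2 / (2 G)], where
   [G] is a bound of the l^2 norm of [y]. *)
apply: (@le_trans _ _ (esumr (fun k => 2 * G * br k `^ (- (2 * s)) + (2 * G)^-1 * y k ^+ 2))).
  apply: le_esumr => k.
  apply: (@le_trans _ _ (2 * (x k * y k))).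
    have -> : x k * y k = br k * expR (2 * pi * d * `|k%:~R|) * normc (a k).
      rewrite /x /y !mulrA -powRD; last by rewrite (gt_eqF (bp k)) implybT.
      by rewrite (_ : - s + (s + 1) = 1) ?powRr1 ?(ltW (bp k))//; ring.
    rewrite !mulrA ler_wpM2r ?normc_ge0// ler_wpM2r ?expR_ge0//.
    exact: bracket_ge.
  have -> : br k `^ (- (2 * s)) = x k ^+ 2.
    by rewrite /x -powR_mulrn ?powR_ge0// -powRrM mulNr [s * _]mulrC.
  rewrite -subr_ge0 [leRHS](_ : _ = (2 * G)^-1 * (2 * G * x k - y k) ^+ 2).
    by rewrite mulr_ge0 ?sqr_ge0// invr_ge0 mulr_ge0// ltW.
  by field; rewrite gt_eqF.
rewrite esumrD; last 2 first.
- by move=> k; rewrite mulr_ge0 ?powR_ge0// mulr_ge0// ltW.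
- by move=> k; rewrite mulr_ge0 ?sqr_ge0// invr_ge0 mulr_ge0// ltW.
rewrite !esumrZ; last 4 first.
- by rewrite invr_ge0 mulr_ge0// ltW.
- by move=> k; exact: sqr_ge0.
- by rewrite mulr_ge0// ltW.
- by move=> k; exact: powR_ge0.
have hy : (esumr (fun k => (y k ^+ 2)%R) <= (G ^+ 2)%:E)%E.
  by apply: le_trans hG; apply: le_esumr => k; rewrite gterm_sqr.
rewrite -/S -(fineK Sf) [leRHS](_ : _ = (2 * G * fine S)%:E + ((2 * G)^-1 * G ^+ 2)%:E)%E.
  rewrite EFinM leeD2l// [leRHS]EFinM lee_pmul// ?lee_fin.
  - by rewrite invr_ge0 mulr_ge0// ltW.
  - by apply: esumr_ge0 => k; exact: sqr_ge0.
by rewrite -EFinD; congr EFin; field; rewrite gt_eqF.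
Qed.

(** A larger width of analyticity absorbs every power of the frequency, and
    an l^1 norm bounds the l^2 norm. *)
Lemma gsum_le_nrm s d e : 0 < s -> d < e -> exists2 K, 0 < K & forall a N, 0 <= N ->
  (nrm e a <= N%:E)%E -> (gsum d (s + 1) a <= ((K * N) ^+ 2)%:E)%E.
Proof.
move=> s0 de; have ed : 0 < 2 * pi * (e - d).
  by rewrite mulr_gt0 ?pi2_gt0// subr_gt0.
(* With this [c], [(c (1 + X)) ^ s <= exp (c s X) <= exp (2 pi (e - d) X)];
   the first inequality uses [c <= 1]. *)
pose c := Num.min 1 (2 * pi * (e - d) / s).
have c0 : 0 < c by rewrite lt_min ltr01 divr_gt0.
have c1 : c <= 1 by rewrite ge_min lexx.
have cs : c * s <= 2 * pi * (e - d) by rewrite -ler_pdivlMr// ge_min lexx orbT.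
exists (c^-1 `^ s) => [|a N N0 hN]; first by rewrite powR_gt0// invr_gt0.
set K := c^-1 `^ s; have K0 : 0 <= K by exact: powR_ge0.
pose y k := br k `^ (s + 1) * expR (2 * pi * d * `|k%:~R|) * normc (a k).
have y0 k : 0 <= y k by rewrite !mulr_ge0 ?powR_ge0 ?expR_ge0 ?normc_ge0.
have n0 k : 0 <= wt e k * normc (a k) by rewrite mulr_ge0 ?wt_ge0 ?normc_ge0.
have yK k : y k <= K * (wt e k * normc (a k)).
  rewrite /y mulrA ler_wpM2r ?normc_ge0//.
  set X := `|k%:~R : R|; have X0 : 0 <= X by exact: normr_ge0.
  have pX : 0 < 1 + X by rewrite ltr_pwDl.
  have h1 : br k `^ (s + 1) <= (1 + X) * (1 + X) `^ s.
    rewrite mulrC -[X in _ * X]powRr1 ?(ltW pX)// -powRD; last by rewrite (gt_eqF pX) implybT.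
    apply: ge0_ler_powR; rewrite ?nnegrE ?(ltW pX)//; first lra.
      by rewrite (le_trans ler01)// bracket_ge1.
    exact: bracket_le.
  have h2 : (1 + X) `^ s <= K * expR (2 * pi * (e - d) * X).
    apply: (@le_trans _ _ ((c^-1 * expR (c * X)) `^ s)).
      apply: ge0_ler_powR; rewrite ?nnegrE ?mulr_ge0 ?invr_ge0 ?expR_ge0 ?(ltW pX) ?(ltW c0) ?(ltW s0)//.
      rewrite -ler_pdivrMl ?invr_gt0// invrK; apply: le_trans (expR_ge1Dx _).
      by rewrite mulrDr mulr1 lerD2r.
    rewrite powRM ?expR_ge0 ?invr_ge0 ?(ltW c0)// -expRM ler_wpM2l// ler_expR.
    by rewrite mulrAC ler_wpM2r.
  have wE : wt e k = (1 + X) * (expR (2 * pi * (e - d) * X) * expR (2 * pi * d * X)).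
    by rewrite /wt -expRD -/X; congr (_ * expR _); ring.
  rewrite wE [leRHS](_ : _ = (1 + X) * (K * expR (2 * pi * (e - d) * X)) *
     expR (2 * pi * d * X)); last by ring.
  rewrite ler_wpM2r ?expR_ge0//; apply: le_trans h1 _.
  by rewrite ler_wpM2l ?(ltW pX).
apply: (@le_trans _ _ (esumr (fun k => K ^+ 2 * N * (wt e k * normc (a k))))).
  apply: le_esumr => k; rewrite gterm_sqr -/(y k).
  have yN : wt e k * normc (a k) <= N by rewrite -lee_fin (le_trans (nrm_term e a k)).
  rewrite [leRHS](_ : _ = (K * N) * (K * (wt e k * normc (a k)))); last by ring.
  rewrite expr2; apply: ler_pM => //.
  by apply: le_trans (yK k) _; exact: ler_wpM2l.
rewrite esumrZ; last 2 first.
- by rewrite mulr_ge0// sqr_ge0.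
- by [].
rewrite [leRHS](_ : _ = ((K ^+ 2 * N)%:E * N%:E)%E).
  by rewrite lee_pmul ?nrm_ge0// lee_fin mulr_ge0// sqr_ge0.
by rewrite -EFinM; congr EFin; ring.
Qed.

End GevreyNorm.

(** * The equation on functions and on coefficients *)
Section Dictionary.
Context {R : realType}.
Local Notation C := R[i].
Local Notation mu := (@lebesgue_measure R).
Implicit Types (f u v : R -> C) (d e s : R) (a : int -> C) (k : int).

Lemma eqae_sym f u : eqae f u -> eqae u f.
Proof. by apply: ae_imp => x ->. Qed.

Lemma eqae_trans f u v : eqae f u -> eqae u v -> eqae f v.
Proof. by move=> h1 h2; apply: ae_imp (ae_and h1 h2) => x [-> ->]. Qed.

Lemma eqae_ext f u : (forall x, f x = u x) -> eqae f u.
Proof. by move=> h; apply: aeW. Qed.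

Lemma gevrey_bound d s f : gevrey d s f ->
  exists2 G, 0 < G & (gevrey_norm d s f <= G%:E)%E.
Proof.
move=> [_ h]; have g0 : (0 <= gevrey_norm d s f)%E by exact: poweR_ge0.
have gf : gevrey_norm d s f \is a fin_num by rewrite ge0_fin_numE.
exists (fine (gevrey_norm d s f) + 1); first by rewrite ltr_wpDl// fine_ge0.
by rewrite -{1}(fineK gf) lee_fin lerDl.
Qed.

Lemma gevrey_nrm d s f : 2^-1 < s -> gevrey d (s + 1) f -> (nrm d (fourier f) < +oo)%E.
Proof.
move=> s2 /gevrey_bound[G G0]; rewrite gevrey_norm_le ?(ltW G0)// => hG.
have [K K0 H] := nrm_le_gsum s2.
exact: le_lt_trans (H _ _ _ G0 hG) (ltry _).
Qed.

Lemma fourier_synth_nrm d a k : 0 < d -> (nrm d a < +oo)%E -> fourier (synth a) k = a k.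
Proof.
move=> d0 ha; apply: fourier_synth; first exact: nrm_asumm (ltW d0) ha.
exact: synth_cint d0 ha.
Qed.

(** Every class with an exponentially decreasing spectrum has the sum of its
    Fourier series as a smooth representative. *)
Lemma eqae_synth d f : 0 < d -> periodic f 1 -> cint f -> (nrm d (fourier f) < +oo)%E ->
  eqae f (synth (fourier f)).
Proof.
move=> d0 pf cf hf; apply: fourier_inj => //.
- exact: synth_periodic.
- exact: synth_cint d0 hf.
- by move=> k; rewrite (fourier_synth_nrm _ d0).
Qed.

Lemma synth_gevrey d e s a : 0 < s -> 0 < d -> d < e -> (nrm e a < +oo)%E ->
  gevrey d (s + 1) (synth a).
Proof.
move=> s0 d0 de ha; have e0 := lt_trans d0 de.
split; first exact: synth_L2 e0 ha.
have [A A0 hA] := nrm_fin ha; have [K K0 H] := gsum_le_nrm s0 de.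
apply: (le_lt_trans _ (ltry (K * A))); rewrite gevrey_norm_le ?mulr_ge0 ?(ltW K0)//.
rewrite (_ : fourier (synth a) = a); first exact: H.
by apply/funext => k; exact: fourier_synth_nrm e0 ha.
Qed.

Lemma is_dx_synth d a : 0 < d -> (nrm d a < +oo)%E -> is_dx (synth a) (synth (deriv a)).
Proof.
move=> d0 ha; exists (synth a).
have d2 : 0 < d / 2 by rewrite divr_gt0.
have hD : (nrm (d / 2) (deriv a) < +oo)%E by apply: nrm_deriv ha; [exact: ltW|lra].
have [c1 c2] := synth_continuous d2 hD.
split => //; first exact: eqae_ext.
- by move=> x; case: (synth_is_derive x d0 ha).
- by move=> x; case: (synth_is_derive x d0 ha).
Qed.

(** The derivative of a class is unique: its continuous representative is
    the sum of the Fourier series. *)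
Lemma is_dx_unique d a u g : 0 < d -> (nrm d a < +oo)%E -> eqae u (synth a) ->
  is_dx u g -> forall x, g x = synth (deriv a) x.
Proof.
move=> d0 ha ua [w [uw dR dI _ _]] x.
have [c1 c2] := synth_continuous d0 ha.
have wa := eqae_trans (eqae_sym uw) ua.
have cR : continuous (fun y => Re (w y)).
  by move=> y; apply/differentiable_continuous/derivable1_diffP; case: (dR y).
have cI : continuous (fun y => Im (w y)).
  by move=> y; apply/differentiable_continuous/derivable1_diffP; case: (dI y).
have eR : (fun y => Re (w y)) = (fun y => Re (synth a y)).
  by apply/funext; apply: eqae_continuous => //; apply: ae_imp wa => y ->.
have eI : (fun y => Im (w y)) = (fun y => Im (synth a y)).
  by apply/funext; apply: eqae_continuous => //; apply: ae_imp wa => y ->.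
have [sR sI] := synth_is_derive x d0 ha.
apply: complex_eqP.
  have := @derive_val _ _ _ _ _ _ _ (dR x); rewrite eR => <-.
  exact: (@derive_val _ _ _ _ _ _ _ sR).
have := @derive_val _ _ _ _ _ _ _ (dI x); rewrite eI => <-.
exact: (@derive_val _ _ _ _ _ _ _ sI).
Qed.

Section Equation.
Variables (d : R) (a : int -> C) (u : R -> C).
Hypotheses (d0 : 0 < d) (d1 : d <= 1) (ha : (nrm d a < +oo)%E).
Hypotheses (cu : cint u) (ua : eqae u (synth a)).

(* Half of the width is given up once, for the derivative. *)
Let d2 : 0 < d / 2. Proof. by rewrite divr_gt0. Qed.
Let d2d : d / 2 < d. Proof. by move: d0; lra. Qed.

Let hD : (nrm (d / 2) (deriv a) < +oo)%E.
Proof. exact: nrm_deriv (ltW d2) d2d ha. Qed.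

Let ha2 : (nrm (d / 2) a < +oo)%E.
Proof. exact: le_lt_trans (le_nrm _ (ltW d2d)) ha. Qed.

(** The coefficients of [2 mu(u) u + u_x^2 / 2]. *)
Definition quad k : C := 2 * a 0 * a k + 2^-1 * conv (deriv a) (deriv a) k.

Lemma quad_nrm : (nrm (d / 2) quad < +oo)%E.
Proof.
rewrite /quad (le_lt_trans (nrmD _ _ _))// !nrmZ lte_add_pinfty//.
  by rewrite lte_mul_pinfty ?lee_fin ?normc_ge0.
by rewrite lte_mul_pinfty ?lee_fin ?normc_ge0//; exact: nrm_conv (ltW d2) hD hD.
Qed.

Lemma quad_synth x : 2 * a 0 * synth a x + 2^-1 * synth (deriv a) x ^+ 2 = synth quad x.
Proof.
have sa := nrm_asumm (ltW d0) ha; have sD := nrm_asumm (ltW d2) hD.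
have sc := nrm_asumm (ltW d2) (nrm_conv (ltW d2) hD hD).
rewrite expr2 (synthM x sD sD) -(synthZ (2 * a 0) x sa) -(synthZ 2^-1 x sc).
by rewrite -(synthD x (asummZ (2 * a 0) sa) (asummZ 2^-1 sc)).
Qed.

Lemma mean_coef : mean u = a 0.
Proof.
rewrite -(fourier_synth_nrm 0 d0 ha) /fourier.
rewrite (mean_eqae cu _ ua); last exact: synth_cint d0 ha.
by apply: eq_mean => x; rewrite oppr0 expmode0 mulr1.
Qed.

Lemma Ainv_quad x :
  Ainv (fun y => 2 * mean u * u y + 2^-1 * synth (deriv a) y ^+ 2) x =
  synth (invcoef quad) x.
Proof.
apply: Ainv_synth; last exact: nrm_asumm (ltW d2) quad_nrm.
move=> k; rewrite -(fourier_synth_nrm k d2 quad_nrm) mean_coef.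
have cq := synth_cint d2 quad_nrm.
have e : eqae (fun y => 2 * a 0 * u y + 2^-1 * synth (deriv a) y ^+ 2) (synth quad).
  by apply: ae_imp ua => y ->; exact: quad_synth.
apply: fourier_eqae => //.
have cD : cint (fun y => 2^-1 * synth (deriv a) y ^+ 2).
  apply: (@cint_eq _ (fun y => synth quad y - 2 * a 0 * synth a y)).
    by move=> y; rewrite -quad_synth addrAC subrr add0r.
  by apply: cintB => //; apply: cintZ; exact: synth_cint d0 ha.
by apply: cintD => //; exact: cintZ.
Qed.

Lemma invcoef_quad_nrm : (nrm (d / 2) (invcoef quad) < +oo)%E.
Proof.
apply: le_summ quad_nrm => k; rewrite ler_wpM2l ?wt_ge0//; exact: normc_invcoef.
Qed.

Lemma Bil_nrm : (nrm (d / 2) (Bil a a) < +oo)%E.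
Proof.
have [A A0 hA] := nrm_fin ha.
apply: (le_lt_trans _ (ltry _)); apply: (Bil_bound (ltW d2) d2).
- by rewrite (le_trans _ d1)// ltW.
- by rewrite -splitr; exact: hA.
- by rewrite -splitr; exact: hA.
Qed.

(** Frequency by frequency this is [BilE]. *)
Lemma equation_series x :
  synth (Bil a a) x + synth a x * synth (deriv a) x +
  synth (deriv (invcoef quad)) x = 0.
Proof.
have sa := nrm_asumm (ltW d0) ha; have sD := nrm_asumm (ltW d2) hD.
have sB := nrm_asumm (ltW d2) Bil_nrm.
have sc := nrm_asumm (ltW d2) (nrm_conv (ltW d2) ha2 hD).
have sq : asumm (deriv (invcoef quad)).
  by apply: nrm_asumm (nrm_deriv (lexx 0) d2 invcoef_quad_nrm).
rewrite (synthM x sa sD) -(synthD x sB sc) -(synthD x (asummD sB sc) sq).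
rewrite /synth (@csum1 _ _ _ 0) => [|k _].
  by rewrite (BilE _ d0)// deriv_invcoef /quad; ring.
by rewrite (BilE _ d0)// deriv_invcoef /quad; ring.
Qed.

End Equation.

Lemma equation_synth d a : 0 < d -> d <= 1 -> (nrm d a < +oo)%E ->
  equation_at (synth a) (synth (Bil a a)).
Proof.
move=> d0 d1 ha; exists (synth (deriv a)), (synth (deriv (invcoef (quad a)))).
have ca := synth_cint d0 ha.
split; first exact: is_dx_synth d0 ha.
- rewrite (_ : Ainv _ = synth (invcoef (quad a))).
    by apply: (is_dx_synth _ (invcoef_quad_nrm d0 ha)); rewrite divr_gt0.
  by apply/funext => x; exact: (Ainv_quad d0 ha ca (eqae_ext (fun=> erefl))).
- by apply: eqae_ext => x; exact: equation_series d0 d1 ha x.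
Qed.

(** By [is_dx_unique] both derivatives in the equation are known from the
    coefficients of [u]; the time derivative is then the only unknown of the
    equation. *)
Lemma equation_coef d u ut k : 0 < d -> d <= 1 -> periodic u 1 -> cint u -> cint ut ->
  (nrm d (fourier u) < +oo)%E -> equation_at u ut ->
  fourier ut k = Bil (fourier u) (fourier u) k.
Proof.
move=> d0 d1 pu cu cut; set a := fourier u => ha [ux [w [dux dw eq]]].
have ua := eqae_synth d0 pu cu ha.
have uxE := is_dx_unique d0 ha ua dux.
have d2 : 0 < d / 2 by rewrite divr_gt0.
have hq := invcoef_quad_nrm d0 ha.
have AE : Ainv (fun x => 2 * mean u * u x + 2^-1 * ux x ^+ 2) = synth (invcoef (quad a)).
  rewrite (_ : ux = synth (deriv a)); last exact/funext.
  by apply/funext => x; exact: Ainv_quad d0 ha cu ua x.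
rewrite AE in dw.
have wE := is_dx_unique d2 hq (eqae_ext (fun=> erefl)) dw.
have hB := Bil_nrm d0 d1 ha.
rewrite -(fourier_synth_nrm k d2 hB); apply: fourier_eqae => //.
  exact: synth_cint d2 hB.
apply: ae_imp (ae_and eq ua) => x [e ux_]; move: e; rewrite ux_ uxE wE.
have := equation_series d0 d1 ha x => /eqP; rewrite -addrA addr_eq0 => /eqP ->.
by move/eqP; rewrite -addrA addr_eq0 => /eqP.
Qed.

End Dictionary.

(** * Existence and uniqueness of solutions *)
Section Solutions.
Context {R : realType}.
Local Notation C := R[i].
Implicit Types (d s : R) (t h : C) (k : int).

Lemma near_zero (P : C -> Prop) (eta : R) : 0 < eta ->
  (forall h, h != 0 -> normc h <= eta -> P h) ->
  \forall h \near (0 : C^o)^', P h.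
Proof.
move=> eta0 H; exists (eta%:C : C); first by rewrite /= ltcR.
move=> h /=; rewrite /ball_ /= sub0r normrN ltcE => /andP[_ hlt] h0.
by apply: H => //; exact: ltW.
Qed.

Lemma near_zeroP (P : C -> Prop) : (\forall h \near (0 : C^o)^', P h) ->
  exists2 eta : R, 0 < eta & forall h, h != 0 -> normc h <= eta -> P h.
Proof.
move=> /= [e /= e0 H].
have [re ime] : 0 < Re e /\ Im e = 0.
  by move: e0; rewrite ltcE => /andP[/eqP /= h1 h2]; split => //; rewrite h1.
exists (Re e / 2) => [|h h0 hh]; first by rewrite divr_gt0.
apply: H => //=; rewrite /ball_ /= sub0r normrN ltcE /= ime eqxx /=.
apply: (@le_lt_trans _ _ (Re e / 2)); first exact: hh.
by rewrite ltr_pdivrMr// mulr_natr mulr2n ltrDl.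
Qed.

(** Limits in the punctured neighbourhoods of the complex number 0, whose
    radii are complex, are expressed by the modulus. *)
Lemma cvg_zero (F : C -> \bar R) : (forall h, (0 <= F h)%E) ->
  (forall e : R, 0 < e -> exists2 eta : R, 0 < eta &
     forall h, h != 0 -> normc h <= eta -> (F h <= e%:E)%E) ->
  F h @[h --> (0 : C^o)^'] --> 0%E.
Proof.
move=> F0 H; apply/fine_cvgP; split.
  have [eta eta0 He] := H 1 ltr01.
  apply: (near_zero eta0) => h h0 hh.
  by rewrite ge0_fin_numE// (le_lt_trans (He h h0 hh))// ltry.
apply/cvgrPdist_le => e e0; have [eta eta0 He] := H e e0.
apply: (near_zero eta0) => h h0 hh /=.
have Fe := He h h0 hh.
have Ff : F h \is a fin_num by rewrite ge0_fin_numE// (le_lt_trans Fe)// ltry.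
by rewrite sub0r normrN ger0_norm ?fine_ge0// -lee_fin fineK.
Qed.

Lemma cvg_zeroP (F : C -> \bar R) : F h @[h --> (0 : C^o)^'] --> 0%E ->
  forall e : R, 0 < e -> exists2 eta : R, 0 < eta &
    forall h, h != 0 -> normc h <= eta -> (F h <= e%:E)%E.
Proof.
move=> /fine_cvgP[Ff /cvgrPdist_le H] e e0.
have [eta1 eta10 H1] := near_zeroP Ff.
have [eta2 eta20 H2] := near_zeroP (H e e0).
exists (Num.min eta1 eta2) => [|h h0]; first by rewrite lt_min eta10.
rewrite le_min => /andP[h1 h2].
rewrite -(fineK (H1 h h0 h1)) lee_fin; apply: le_trans (H2 h h0 h2).
by rewrite sub0r normrN ler_norm.
Qed.

(** Difference quotients that converge in the Gevrey norm converge in the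
    weighted l^1 norm of the same width, by [nrm_le_gsum]; local boundedness
    and the expansion of each coefficient both follow. *)
Lemma Gsolution_coef d s r u0 (v : C -> R -> C) : 2^-1 < s -> 0 < d -> d <= 1 ->
  Gsolution d (s + 1) r u0 v -> coef_solution d r (fun t => fourier (v t)).
Proof.
move=> s2 d0 d1 [[hg _] _ heq].
have [K K0 HK] := nrm_le_gsum s2.
have main t : normc t < r -> exists2 w, (nrm d w < +oo)%E /\
    w = Bil (fourier (v t)) (fourier (v t)) & forall e, 0 < e ->
    exists2 eta, 0 < eta & forall h, h != 0 -> normc h <= eta ->
    (nrm d (fun k => (h^-1 * (fourier (v (t + h)) k - fourier (v t) k) - w k)%R) <= e%:E)%E.
  move=> tr; have gt := hg t tr.
  have [w [gw lim] eqw] := heq t tr.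
  have cw := cint_L2 gw.1; have ct := cint_L2 gt.1.
  have wE k : fourier w k = Bil (fourier (v t)) (fourier (v t)) k.
    apply: (equation_coef k d0 d1 _ ct cw (gevrey_nrm s2 gt) eqw).
    by case: gt => -[].
  exists (fourier w); first by split; [exact: gevrey_nrm gw|apply/funext].
  move=> e e0; have eK0 : 0 < e / K by rewrite divr_gt0.
  have [eta eta0 H] := cvg_zeroP lim eK0.
  exists (Num.min eta ((r - normc t) / 2)) => [|h h0].
    by rewrite lt_min eta0 divr_gt0// subr_gt0.
  rewrite le_min => /andP[h1 h2].
  have thr : normc (t + h) < r.
    by apply: le_lt_trans (ler_normcD _ _) _; lra.
  have gth := hg _ thr; have cth := cint_L2 gth.1.
  have := H h h0 h1; rewrite gevrey_norm_le ?(ltW eK0)// => /HK -/(_ eK0).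
  rewrite mulrC divfK ?gt_eqF//; apply: le_trans.
  rewrite le_eqVlt; apply/orP; left; apply/eqP; congr nrm; apply/funext => k.
  rewrite fourierB ?fourierZ ?fourierB//; first exact: cintB.
  by apply: cintZ; exact: cintB.
split=> [t tr|t tr k e e0].
  have [w [wf _] H] := main t tr; have [eta eta0 He] := H 1 ltr01.
  have [A A0 hA] := nrm_fin (gevrey_nrm s2 (hg t tr)).
  have [W W0 hW] := nrm_fin wf.
  exists eta => //; exists (A + eta * (1 + W)) => h hh.
  have [->|h0] := eqVneq h 0.
    by rewrite addr0 (le_trans hA)// lee_fin lerDl mulr_ge0 ?addr_ge0// ltW.
  rewrite (_ : fourier (v (t + h)) = fun k => fourier (v t) k + h *
    ((h^-1 * (fourier (v (t + h)) k - fourier (v t) k) - w k) + w k)); last first.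
    by apply/funext => k; rewrite subrK mulrA divff// mul1r subrKC.
  apply: le_trans (nrmD _ _ _) _; rewrite EFinD leeD// nrmZ EFinM.
  rewrite lee_pmul ?lee_fin ?normc_ge0 ?nrm_ge0//.
  by apply: le_trans (nrmD _ _ _) _; rewrite EFinD leeD// He.
have [w [wf wE] H] := main t tr; have [eta eta0 He] := H e e0.
exists eta => // h hh.
have [->|h0] := eqVneq h 0.
  by rewrite addr0 subrr mul0r subrr normc0 mulr0.
rewrite -wE.
have -> : fourier (v (t + h)) k - fourier (v t) k - h * w k =
    h * (h^-1 * (fourier (v (t + h)) k - fourier (v t) k) - w k).
  by rewrite mulrBr mulrA divff// mul1r.
rewrite normcM mulrC ler_wpM2r ?normc_ge0// -lee_fin.
apply: le_trans (He h h0 hh); apply: le_trans (nrm_term _ _ k).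
by rewrite lee_fin ler_peMl ?normc_ge0// wt_ge1// ltW.
Qed.

Lemma Gsolution_unique d s r u0 (u v : C -> R -> C) t : 2^-1 < s -> 0 < d -> d <= 1 ->
  gevrey 1 (s + 1) (toC u0) ->
  Gsolution d (s + 1) r u0 u -> Gsolution d (s + 1) r u0 v ->
  normc t < r -> eqae (v t) (u t).
Proof.
move=> s2 d0 d1 g0 hu hv tr.
have r0 : 0 < r by exact: le_lt_trans (normc_ge0 t) tr.
have z0 : normc (0 : C) < r by rewrite normc0.
have init (w : C -> R -> C) : Gsolution d (s + 1) r u0 w ->
    forall k, fourier (w 0) k = fourier (toC u0) k.
  move=> [[hg _] w0 _] k; apply: fourier_eqae => //; apply: cint_L2.
    by case: (hg 0 z0).
  by case: g0.
have [[gu _] _ _] := hu; have [[gv _] _ _] := hv.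
have [[pu _ _ _] _] := gu t tr; have [[pv _ _ _] _] := gv t tr.
apply: fourier_inj => //.
- by apply: cint_L2; case: (gv t tr).
- by apply: cint_L2; case: (gu t tr).
move=> k; apply: (ray_zero d0 d1 (Gsolution_coef s2 d0 d1 hv) (Gsolution_coef s2 d0 d1 hu) tr).
by move=> j; rewrite (init _ hv) (init _ hu).
Qed.

Section Existence.
Variables (s : R) (u0 : R -> R) (N T : R).
Hypotheses (s0 : 0 < s) (N0 : 0 < N) (T0 : 0 < T) (TN : T * (Kps * N) <= 1).
Hypothesis g0 : gevrey 1 (s + 1) (toC u0).
Hypothesis hN : (nrm 1 (fourier (toC u0)) <= N%:E)%E.

Definition usol t : R -> C := synth (sol (fourier (toC u0)) t).

(** The disk is open, so that a width [e > d] is still available at [t]; its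
    l^1 norm dominates the norm of G^{d,s+1} there. *)
Lemma disk_room d t : 0 < d -> d < 1 -> normc t < T * (1 - d) ->
  exists2 e, d < e & e < 1 /\ normc t * (Kps * N) < 1 - e.
Proof.
move=> d0 d1 ht.
have K0 := KN_gt0 N0.
have h : normc t * (Kps * N) < 1 - d.
  apply: (@lt_le_trans _ _ (T * (1 - d) * (Kps * N))); first by rewrite ltr_pM2r.
  rewrite mulrAC ler_piMl// subr_ge0 ltW//.
have h0 : 0 <= normc t * (Kps * N) by rewrite mulr_ge0 ?normc_ge0 ?ltW.
exists ((d + (1 - normc t * (Kps * N))) / 2); first lra.
by split; lra.
Qed.

(** The remainder of [sol_derivative] is of order [h ^ 2] in the norm of
    width [e]; the bilinear term needs a width [e2] between [d] and [e], and
    [gsum_le_nrm] leads from [e2] to [d]. *)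
Lemma usol_derive d t : 0 < d -> d < 1 -> normc t < T * (1 - d) ->
  is_Gderive d (s + 1) usol t
    (synth (Bil (sol (fourier (toC u0)) t) (sol (fourier (toC u0)) t))).
Proof.
set a0 := fourier (toC u0); move=> d0 d1 /(disk_room d0 d1)[e de [e1 he]].
have e0 := lt_trans d0 de; have e0' := ltW e0.
have [B B0 hsol] := nrm_fin (sol_bound N0 hN e0' e1 he).
pose e2 := (d + e) / 2.
have de2 : d < e2 by rewrite /e2; lra.
have e2e : e2 < e by rewrite /e2; lra.
have e20 := lt_trans d0 de2.
have hB : (nrm e2 (Bil (sol a0 t) (sol a0 t)) < +oo)%E.
  have ee : e2 + (e - e2) = e by ring.
  apply: (le_lt_trans _ (ltry _)); apply: (@Bil_bound _ e2 (e - e2) B B) => //.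
  - exact: ltW.
  - by rewrite subr_gt0.
  - by lra.
  - by rewrite ee.
  - by rewrite ee.
split; first exact: synth_gevrey s0 d0 de2 hB.
have [eta eta0 [M M0 HM]] := sol_derivative N0 hN e0 e1 he.
have [K K0 HK] := gsum_le_nrm s0 de2.
have [eta' eta'0 hroom] := room (KN_gt0 N0) he.
apply: cvg_zero => [h|eps eps0]; first exact: poweR_ge0.
exists (Num.min (Num.min eta eta') (eps / (K * (M + 1)))) => [|h h0].
  by rewrite !lt_min eta0 eta'0 divr_gt0// mulr_gt0// ltr_wpDl.
rewrite !le_min => /andP[/andP[h1 h2] h3].
have hth : normc (t + h) * (Kps * N) < 1 - e.
  apply: le_lt_trans hroom; rewrite ler_wpM2r ?(ltW (KN_gt0 N0))//.
  by rewrite (le_trans (ler_normcD _ _))// lerD2l.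
have hsolh := sol_bound N0 hN e0' e1 hth.
pose c k := h^-1 * (sol a0 (t + h) k - sol a0 t k) - Bil (sol a0 t) (sol a0 t) k.
have cE : c = fun k => h^-1 * (sol a0 (t + h) k - sol a0 t k - h * Bil (sol a0 t) (sol a0 t) k).
  by apply/funext => k; rewrite /c [RHS]mulrBr mulKf.
have hc : (nrm e2 c <= (M * normc h)%:E)%E.
  apply: le_trans (le_nrm _ (ltW e2e)) _; rewrite cE nrmZ normcV.
  apply: (@le_trans _ _ ((normc h)^-1%:E * (M * normc h ^+ 2)%:E)%E).
    by rewrite lee_pmul ?lee_fin ?invr_ge0 ?normc_ge0 ?nrm_ge0// HM.
  rewrite -EFinM lee_fin expr2 mulrCA mulKf//.
  by rewrite gt_eqF// normc_gt0.
have fc : fourier (fun x => h^-1 * (usol (t + h) x - usol t x) -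
    synth (Bil (sol a0 t) (sol a0 t)) x) = c.
  have sa := nrm_asumm e0' hsolh.
  have sb : asumm (sol a0 t).
    by apply: (nrm_asumm e0'); apply: le_lt_trans hsol (ltry _).
  have sB := nrm_asumm (ltW e20) hB.
  have cf : (nrm e2 c < +oo)%E by exact: le_lt_trans hc (ltry _).
  apply/funext => k; rewrite -(fourier_synth_nrm k e20 cf); apply: eq_fourier => x.
  rewrite /usol -/a0 -(synthB x sa sb) -(synthZ h^-1 x (asummB sa sb)).
  by rewrite -(synthB x (asummZ h^-1 (asummB sa sb)) sB).
rewrite gevrey_norm_le ?(ltW eps0)// fc.
apply: le_trans (HK _ _ _ hc) _; first by rewrite mulr_ge0 ?normc_ge0.
rewrite lee_fin lerXn2r ?nnegrE ?mulr_ge0 ?normc_ge0 ?(ltW K0) ?(ltW eps0)//.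
move: h3; rewrite ler_pdivlMr ?mulr_gt0 ?ltr_wpDl// => h3; apply: le_trans h3.
rewrite [leLHS](_ : _ = normc h * (K * M)); last by ring.
by rewrite ler_wpM2l ?normc_ge0// ler_wpM2l ?(ltW K0)// lerDl.
Qed.

Lemma usol_solution d : 0 < d -> d < 1 -> Gsolution d (s + 1) (T * (1 - d)) u0 usol.
Proof.
move=> d0 d1; have L2 := g0.1.
split.
- split=> t ht; last by eexists; exact: usol_derive d0 d1 ht.
  have [e de [e1 he]] := disk_room d0 d1 ht.
  exact: synth_gevrey s0 d0 de (sol_bound N0 hN (ltW (lt_trans d0 de)) e1 he).
- apply: eqae_sym; rewrite (_ : usol 0 = synth (fourier (toC u0))).
    apply: (eqae_synth ltr01); [by case: L2|exact: cint_L2|].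
    exact: le_lt_trans hN (ltry _).
  by congr synth; apply/funext => k; exact: sol0.
- move=> t ht; exists (synth (Bil (sol (fourier (toC u0)) t) (sol (fourier (toC u0)) t))).
    exact: usol_derive d0 d1 ht.
  have [e de [e1 he]] := disk_room d0 d1 ht; have e0 := lt_trans d0 de.
  exact: equation_synth e0 (ltW e1) (sol_bound N0 hN (ltW e0) e1 he).
Qed.

End Existence.

(** A vanishing norm forces all coefficients to vanish, by [nrm_le_gsum]
    with arbitrarily small bounds. *)
Lemma zero_norm_ae s (f : R -> C) : 2^-1 < s -> gevrey 1 (s + 1) f ->
  (gevrey_norm 1 (s + 1) f <= 0)%E -> eqae f (fun=> 0).
Proof.
move=> s2 gf; rewrite gevrey_norm_le// expr0n /= => h0.
have [K K0 HK] := nrm_le_gsum s2.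
have c0 : cint (fun=> 0 : C) by apply: cint_continuous; exact: cst_continuous.
have f0 k : fourier (fun=> 0 : C) k = 0.
  rewrite /fourier (@eq_mean _ _ (fun x => 0 * (fun=> 0 : C) x)) ?meanZ ?mul0r//.
  by move=> x; rewrite !mul0r.
apply: fourier_inj => //; [by case: gf => -[]|by apply: cint_L2; case: gf|move=> k].
rewrite f0; apply: eq0_normc; apply/eqP; rewrite eq_le normc_ge0 andbT.
apply/ler_addgt0Pl => e e0; rewrite addr0.
have eK : 0 < e / K by rewrite divr_gt0.
have := HK 1 (fourier f) _ eK (le_trans h0 _); rewrite lee_fin => /(_ (sqr_ge0 _)).
rewrite mulrC divfK ?gt_eqF// => h; rewrite -lee_fin; apply: le_trans h.
apply: le_trans (nrm_term _ _ k).
by rewrite lee_fin ler_peMl ?normc_ge0// wt_ge1.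
Qed.

End Solutions.

(** * Analytic lifespan of the solution *)

Theorem theorem14 (R : realType) (s : R) (hs : 2^-1 < s) :
  exists c : R, 0 < c /\
    forall u0 : R -> R, gevrey 1 (s + 1) (toC u0) ->
      exists T : R,
        [/\ 0 < T,
            ~ eqae (toC u0) (fun=> 0) ->
              T = c / fine (gevrey_norm 1 (s + 1) (toC u0)) &
            forall d : R, 0 < d -> d < 1 ->
              exists u : R[i] -> R -> R[i],
                Gsolution d (s + 1) (T * (1 - d)) u0 u /\
                forall v : R[i] -> R -> R[i],
                  Gsolution d (s + 1) (T * (1 - d)) u0 v ->
                  forall t : R[i], disk (T * (1 - d)) t -> eqae (v t) (u t)].
Proof.
have s0 : 0 < s by rewrite (lt_trans _ hs)// invr_gt0.
have [K K0 HK] := nrm_le_gsum hs.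
have Kp : 0 < Kps :> R by rewrite mulr_gt0 ?expR_gt0.
exists ((Kps * K)^-1); split=> [|u0 g0]; first by rewrite invr_gt0 mulr_gt0.
have conclude (N T : R) : 0 < N -> 0 < T -> T * (Kps * N) <= 1 ->
    (nrm 1 (fourier (toC u0)) <= N%:E)%E -> forall d : R, 0 < d -> d < 1 ->
    exists u : R[i] -> R -> R[i],
      Gsolution d (s + 1) (T * (1 - d)) u0 u /\
      forall v : R[i] -> R -> R[i], Gsolution d (s + 1) (T * (1 - d)) u0 v ->
      forall t : R[i], disk (T * (1 - d)) t -> eqae (v t) (u t).
  move=> N0 T0 TN hN d d0 d1.
  have hu := usol_solution s0 N0 TN g0 hN d0 d1.
  exists (usol u0); split => // v hv t ht.
  exact: Gsolution_unique hs d0 (ltW d1) g0 hu hv ht.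
have gn0 : (0 <= gevrey_norm 1 (s + 1) (toC u0))%E by exact: poweR_ge0.
have gf : gevrey_norm 1 (s + 1) (toC u0) \is a fin_num.
  by rewrite ge0_fin_numE//; case: g0.
set M := fine (gevrey_norm 1 (s + 1) (toC u0)).
have M0 : 0 <= M by exact: fine_ge0.
have bound G : 0 < G -> M <= G -> (nrm 1 (fourier (toC u0)) <= (K * G)%:E)%E.
  move=> G0 MG; apply: HK (G0) _; rewrite -(gevrey_norm_le _ _ _ (ltW G0)).
  by rewrite -(fineK gf) lee_fin.
(* For zero data the norm is bounded by every positive number, here by
   [1 / (Kps K)], so that 1 is a lifespan. *)
have [Mle0|Mgt0] := leP M 0.
  exists 1; split => //.
    by move=> nz; case: nz; apply: (zero_norm_ae hs g0); rewrite -(fineK gf) lee_fin.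
  have G0 : 0 < (Kps * K)^-1 by rewrite invr_gt0 mulr_gt0.
  apply: (conclude (K * (Kps * K)^-1) 1) => //; first by rewrite mulr_gt0.
    by rewrite mul1r mulrA divff ?gt_eqF ?mulr_gt0.
  by apply: bound => //; rewrite (le_trans Mle0)// ltW.
exists ((Kps * K)^-1 / M); split => //.
  by rewrite divr_gt0// invr_gt0 mulr_gt0.
apply: (conclude (K * M)); [by rewrite mulr_gt0| | |exact: bound].
  by rewrite divr_gt0// invr_gt0 mulr_gt0.
have KK : Kps * K * M != 0 by rewrite gt_eqF// !mulr_gt0.
by rewrite -invfM [Kps * (K * M)]mulrA mulVf.
Qed.
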